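(* Let $G$ be a finite group, $\Theta=\sum_{H\le G}n_HH$ a $G$-Brauer relation, and $M$ a finitely generated $\mathbb{Z}[G]$-module; let $\iota:M_{\mathrm{tors}}\to M$ be the inclusion. Let $m$ be a positive integer such that there exist permutation $\mathbb{Z}[G]$-modules $A_1,A_2$ and an injective $\mathbb{Z}[G]$-homomorphism $(M_{\mathrm{tf}})^m\oplus A_1\to A_2$ with finite cokernel. Then there exists a finite $\mathbb{Z}[G]$-module $V$ with $V\cong V^\vee$ as $\mathbb{Z}[G]$-modules such that \[\mathcal C_\Theta(M)^{2m}=\mathcal C_\Theta(M_{\mathrm{tors}})^{2m}\,\mathcal C_\Theta(V)^{-1}\left(\frac{\hat h^0(\Theta,M_{\mathrm{tors}})\,\hat h^1(\Theta,M_{\mathrm{tors}})}{\hat h^0(\Theta,M)\,\hat h^1(\Theta,M)}\right)^{2m}\kappa^0(\Theta,\iota)^{-2m}\,\kappa^2(\Theta,\iota)^{-2m}.\]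
   Context: Let $G$ be a finite group. A $G$-Brauer relation is a formal sum $\Theta=\sum_{H\le G}n_HH$ over subgroups $H\le G$, $n_H\in\mathbb{Z}$, such that $\bigoplus_{n_H>0}\mathbb{Q}[G/H]^{n_H}\cong\bigoplus_{n_H<0}\mathbb{Q}[G/H]^{-n_H}$ as $\mathbb{Q}[G]$-modules. For a finitely generated $\mathbb{Z}[G]$-module $M$, write $M_{\mathrm{tors}}$ for its $\mathbb{Z}$-torsion subgroup and $M_{\mathrm{tf}}=M/M_{\mathrm{tors}}$. The regulator constant is \[\mathcal C_\Theta(M)=\prod_{H\le G}\Bigl(|M_{\mathrm{tors}}^H|^{-2}\det\bigl(\tfrac{1}{|H|}\langle\cdot,\cdot\rangle|_{(M^H)_{\mathrm{tf}}}\bigr)\Bigr)^{n_H}\in\mathbb{Q}^\times,\] where $\langle\cdot,\cdot\rangle:M\times M\to\mathscr L$ is any $G$-invariant $\mathbb{Z}$-bilinear pairing into a field $\mathscr L\supseteq\mathbb{Q}$ that is non-degenerate on $M_{\mathrm{tf}}$, and the determinant is computed on a $\mathbb{Z}$-basis of $(M^H)_{\mathrm{tf}}$ (the value is independent of the choice of pairing and is positive). For $i\in\mathbb{Z}$ and $H\le G$, $\hat H^i(H,M)$ denotes Tate cohomology, $\hat h^i(H,M)=|\hat H^i(H,M)|$, and $\hat h^i(\Theta,M)=\prod_{H\le G}\hat h^i(H,M)^{n_H}$. For a $\mathbb{Z}[G]$-homomorphism $f:M\to N$, $\kappa^i(\Theta,f)=\prod_{H\le G}|\ker(\hat H^i(H,f))|^{n_H}$.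 We write $M^*=\mathrm{Hom}(M,\mathbb{Z})$ and, for finite $M$, $M^\vee=\mathrm{Hom}(M,\mathbb{Q}/\mathbb{Z})$, both with $G$-action $(g\psi)(m)=\psi(g^{-1}m)$. A permutation $\mathbb{Z}[G]$-module is one of the form $\mathbb{Z}[X]$ for a finite $G$-set $X$. *)

(* Defs.v *)
From HB Require Import structures.
From mathcomp Require Import all_boot all_order all_fingroup all_algebra.
From Stdlib Require Import ClassicalEpsilon.
Set Implicit Arguments. Unset Strict Implicit. Unset Printing Implicit Defensive.
Import Order.TTheory GRing.Theory Num.Theory.
Local Open Scope ring_scope.

(* Number of classes of the "set" S modulo the relation R (intended: R an
   equivalence on S with finitely many classes).  Chosen classically. *)
Definition num_classes (T : Type) (S : T -> Prop) (R : T -> T -> Prop) : nat :=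
  epsilon (inhabits 0%N) (fun k => exists s : 'I_k -> T,
    (forall i, S (s i)) /\ (forall i j, R (s i) (s j) -> i = j) /\
    (forall x, S x -> exists i, R x (s i))).

Definition card_prop (T : Type) (S : T -> Prop) : nat := num_classes S (@eq T).

Definition is_intq (q : rat) : Prop := denq q = 1.

Section ZGmodules.
Variables (gT : finGroupType) (G : {group gT}).

Record zgmod := ZGmod {
  zg_car : zmodType;
  zg_act : gT -> zg_car -> zg_car;
  zg_actD : forall g x y, g \in G -> zg_act g (x + y) = zg_act g x + zg_act g y;
  zg_act1 : forall x, zg_act 1%g x = x;
  zg_actM : forall g h x, g \in G -> h \in G ->
     zg_act (g * h)%g x = zg_act g (zg_act h x) }.

Variable M : zgmod.
Local Notation MT := (zg_car M).
Local Notation zact := (@zg_act M).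

Definition fin_gen : Prop := exists s : seq MT, forall x : MT,
  exists c : 'I_(size s) -> gT -> int,
    x = \sum_(i < size s) \sum_(g in G) zact g (nth 0 s i) *~ c i g.

Definition fin_mod : Prop := exists s : seq MT, forall x : MT, x \in s.

Definition is_tors (x : MT) : Prop := exists k : nat, (0 < k)%N /\ x *+ k = 0.

(* Submodules of M are represented by predicates; M itself and M_tors: *)
Definition whole_mod : MT -> Prop := fun _ => True.
Definition tors_mod : MT -> Prop := is_tors.

Definition fixed (H : {group gT}) (S : MT -> Prop) (x : MT) : Prop :=
  S x /\ forall h, h \in H -> zact h x = x.

Definition nrm (H : {group gT}) (x : MT) : MT := \sum_(h in H) zact h x.

Definition tate0_rel (H : {group gT}) (S : MT -> Prop) (x y : MT) : Prop :=
  exists z, S z /\ x - y = nrm H z.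
Definition tate0 (H : {group gT}) (S : MT -> Prop) : nat :=
  num_classes (fixed H S) (tate0_rel H S).

Definition cocycle1 (H : {group gT}) (S : MT -> Prop) (f : gT -> MT) : Prop :=
  (forall g, g \in H -> S (f g)) /\
  (forall g h, g \in H -> h \in H -> f (g * h)%g = f g + zact g (f h)).
Definition cobound1 (H : {group gT}) (S : MT -> Prop) (f : gT -> MT) : Prop :=
  exists z, S z /\ forall g, g \in H -> f g = zact g z - z.
Definition tate1 (H : {group gT}) (S : MT -> Prop) : nat :=
  num_classes (cocycle1 H S) (fun f f' => cobound1 H S (fun g => f g - f' g)).

Definition cocycle2 (H : {group gT}) (S : MT -> Prop) (f : gT -> gT -> MT) : Prop :=
  (forall g h, g \in H -> h \in H -> S (f g h)) /\
  (forall g h k, g \in H -> h \in H -> k \in H ->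
     zact g (f h k) - f (g * h)%g k + f g (h * k)%g - f g h = 0).
Definition cobound2 (H : {group gT}) (S : MT -> Prop) (f : gT -> gT -> MT) : Prop :=
  exists c : gT -> MT, (forall g, g \in H -> S (c g)) /\
  (forall g h, g \in H -> h \in H -> f g h = zact g (c h) - c (g * h)%g + c g).
Definition tate2 (H : {group gT}) (S : MT -> Prop) : nat :=
  num_classes (cocycle2 H S) (fun f f' => cobound2 H S (fun g h => f g h - f' g h)).

(* |ker(\hat H^i(H, iota))| for the inclusion iota of the submodule S into the
   submodule T (here: M_tors into M), i = 0, 2 *)
Definition ker0 (H : {group gT}) (S T : MT -> Prop) : nat :=
  num_classes (fun x => fixed H S x /\ exists z, T z /\ x = nrm H z) (tate0_rel H S).
Definition ker2 (H : {group gT}) (S T : MT -> Prop) : nat :=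
  num_classes (fun f => cocycle2 H S f /\ cobound2 H T f)
              (fun f f' => cobound2 H S (fun g h => f g h - f' g h)).

Definition thprod (n : {group gT} -> int) (F : {group gT} -> rat) : rat :=
  \prod_(H : {group gT} | H \subset G) F H ^ n H.

Definition hhat0 n S := thprod n (fun H => (tate0 H S)%:R).
Definition hhat1 n S := thprod n (fun H => (tate1 H S)%:R).
Definition kappa0 n S T := thprod n (fun H => (ker0 H S T)%:R).
Definition kappa2 n S T := thprod n (fun H => (ker2 H S T)%:R).

Definition good_pairing (S : MT -> Prop) (p : MT -> MT -> rat) : Prop :=
  (forall x y z, S x -> S y -> S z ->
      p (x + y) z = p x z + p y z /\ p x (y + z) = p x y + p x z) /\
  (forall g x y, g \in G -> S x -> S y -> p (zact g x) (zact g y) = p x y) /\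
  (forall x, S x -> ~ is_tors x -> exists y, S y /\ p x y != 0) /\
  (forall y, S y -> ~ is_tors y -> exists x, S x /\ p x y != 0).

Definition is_tf_basis (H : {group gT}) (S : MT -> Prop) (r : nat) (b : 'I_r -> MT) : Prop :=
  (forall i, fixed H S (b i)) /\
  (forall x, fixed H S x -> exists c : 'I_r -> int,
      is_tors (x - \sum_(i < r) b i *~ c i)) /\
  (forall c : 'I_r -> int, is_tors (\sum_(i < r) b i *~ c i) -> forall i, c i = 0).

Definition reg_term (H : {group gT}) (S : MT -> Prop) (p : MT -> MT -> rat)
    (r : nat) (b : 'I_r -> MT) : rat :=
  ((card_prop (fun x => fixed H S x /\ is_tors x))%:R ^- 2) *
  \det (\matrix_(i < r, j < r) (p (b i) (b j) / #|H|%:R)).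

Definition is_regconst (n : {group gT} -> int) (S : MT -> Prop) (c : rat) : Prop :=
  exists p, good_pairing S p /\
  exists (r : {group gT} -> nat) (b : forall H : {group gT}, 'I_(r H) -> MT),
    (forall H : {group gT}, H \subset G -> is_tf_basis H S (b H)) /\
    c = \prod_(H : {group gT} | H \subset G) reg_term H S p (b H) ^ n H.

(* C_Theta(S) (independent of the choices; chosen classically) *)
Definition regconst (n : {group gT} -> int) (S : MT -> Prop) : rat :=
  epsilon (inhabits 0) (is_regconst n S).

(* V ~= V^\vee = Hom(V, Q/Z); Q/Z-valued maps are represented by Q-valued maps
   considered modulo Z. *)
Definition isQZhom (f : MT -> rat) : Prop :=
  forall x y, is_intq (f (x + y) - f x - f y).

Definition self_dual : Prop := exists Phi : MT -> MT -> rat,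
  (forall v, isQZhom (Phi v)) /\
  (forall v w x, is_intq (Phi (v + w) x - Phi v x - Phi w x)) /\
  (forall g v x, g \in G -> is_intq (Phi (zact g v) x - Phi v (zact g^-1%g x))) /\
  (forall v, (forall x, is_intq (Phi v x)) -> v = 0) /\
  (forall f, isQZhom f -> exists v, forall x, is_intq (f x - Phi v x)).

(* There are permutation modules A1 = Z[X1], A2 = Z[X2] (X1, X2 finite G-sets,
   given by mathcomp right actions; g acts on Z[X] by (g f)(x) = f(x.g)) and an
   injective Z[G]-map (M_tf)^m (+) A1 -> A2 with finite cokernel.  A map out of
   M_tf is a map out of M vanishing on M_tors. *)
Definition perm_embedding (m : nat) : Prop :=
  exists (X1 X2 : finType) (to1 : action G X1) (to2 : action G X2),
  exists (phi : 'I_m -> MT -> {ffun X2 -> int}) (psi : {ffun X1 -> int} -> {ffun X2 -> int}),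
    (forall i x y, phi i (x + y) = phi i x + phi i y) /\
    (forall i g x, g \in G -> phi i (zact g x) = [ffun y => phi i x (to2 y g)]) /\
    (forall i x, is_tors x -> phi i x = 0) /\
    (forall a b, psi (a + b) = psi a + psi b) /\
    (forall g (a : {ffun X1 -> int}), g \in G ->
       psi [ffun y => a (to1 y g)] = [ffun y => psi a (to2 y g)]) /\
    (forall (x : 'I_m -> MT) a, \sum_(i < m) phi i (x i) + psi a = 0 ->
       (forall i, is_tors (x i)) /\ a = 0) /\
    (exists s : seq {ffun X2 -> int}, forall b, exists (x : 'I_m -> MT) a,
       exists2 c, c \in s & b = c + \sum_(i < m) phi i (x i) + psi a).

End ZGmodules.

(* Brauer relations.  The G-set  X_+ = disjoint union over H <= G with n_H > 0
   of G/H x {0..n_H-1}  (and X_- likewise with n_H < 0) is realised inside the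
   finite type  {group} * {set} * 'I_K. *)
Section Brauer.
Variables (gT : finGroupType) (G : {group gT}) (n : {group gT} -> int).

Definition brK : nat := (\sum_(H : {group gT}) absz (n H)).+1.
Definition brT := ({group gT} * {set gT} * 'I_brK)%type.

Definition br_in (pos : bool) (t : brT) : bool :=
  let: (H, C, i) := t in
  [&& H \subset G, C \in lcosets H G, (i < absz (n H))%N &
      (if pos then 0 < n H else n H < 0)].

Definition br_act (g : gT) (t : brT) : brT :=
  let: (H, C, i) := t in (H, (g *: C)%g, i).

Definition br_gf (g : gT) (f : {ffun brT -> rat}) : {ffun brT -> rat} :=
  [ffun t => f (br_act g^-1%g t)].

Definition supported (P : pred brT) (f : {ffun brT -> rat}) : Prop :=
  forall t, ~~ P t -> f t = 0.

Definition is_brauer : Prop :=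
  exists Phi : {ffun brT -> rat} -> {ffun brT -> rat},
    (forall (a : rat) f f', supported (br_in true) f -> supported (br_in true) f' ->
        Phi [ffun t => a * f t + f' t] = [ffun t => a * Phi f t + Phi f' t]) /\
    (forall f, supported (br_in true) f -> supported (br_in false) (Phi f)) /\
    (forall g f, g \in G -> supported (br_in true) f -> Phi (br_gf g f) = br_gf g (Phi f)) /\
    (forall f, supported (br_in true) f -> Phi f = 0 -> f = 0) /\
    (forall f', supported (br_in false) f' ->
        exists f, supported (br_in true) f /\ Phi f = f').

End Brauer.

Arguments whole_mod {gT G} M _.
Arguments tors_mod {gT G} M _.

(* Main.v *)
Require Import Defs.
From HB Require Import structures.
From mathcomp Require Import all_boot all_order all_fingroup all_algebra.
From mathcomp Require generic_quotient.
From mathcomp Require Import ring.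
From Stdlib Require Import ClassicalEpsilon FunctionalExtensionality PropExtensionality.
Set Implicit Arguments. Unset Strict Implicit. Unset Printing Implicit Defensive.
Import Order.TTheory GRing.Theory Num.Theory.
Local Open Scope ring_scope.

Local Notation toQ := (map_mx (intr : int -> rat)).

(* Let L = M_tf carry the form <phi x, phi y> pulled back from a permutation
   lattice Z[X], let L' = Hom(L, Z) and V_1 = L'/L. For H <= G the index of the
   image of M^H in L'^H is |det_H| [M^H : N M + (M_tors)^H], where det_H is the
   determinant of the form divided by |H|. The connecting map V_1^H -> H^1(H, L)
   is onto, because H^1(H, L) -> H^1(H, L') factors through H^1(H, Z[X]) = 0.
   Together with the cohomology sequence of M_tors -> M -> L this gives, for each
   H separately,
     |det_H| h^0(M) h^1(M) kappa^0 kappa^2 = |V_1^H| h^0(M_tors) h^1(M_tors),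
   and V = V_1^m is self-dual through the discriminant form of L.
   The Brauer relation only serves to make the regulator constant independent of
   the pairing: two pairings differ by a G-automorphism alpha of W = M_Q, and the
   product of the det(alpha | W^H)^{n_H} is 1 because alpha commutes with the
   isomorphism Hom_G(Q[X_-], W) = Hom_G(Q[X_+], W) given by the relation. *)

(** * Indices of subgroups *)

(** The exponent 2m comes from two different weights: det_H enters the regulator constant of M once,
    while |V_1^H| enters that of V_1 squared. So the local identity is squared and then raised to
    the power m; the square also removes the absolute value which a lattice index puts on det_H. The
    map M^H -> (M_tf)^H need not be onto. The defect j = [(M_tf)^H : image of M^H] appears twice, in
    the index of the image of M^H in L'^H and in the cohomology sequence, and cancels. Comparing M^H
    with L'^H takes two bases. An invariant functional d satisfies d(N x) = |H| d(x), so L'^H is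
    dual to M modulo the kernel of N (up to torsion), and not to M^H. The norm relates the two
    lattices, and this is where the factor 1/|H| of the regulator enters. Neither M_tf nor a
    cohomology group is formed: every order is an index of predicates on M, on coordinate vectors or
    on cochains, with equalities read modulo torsion where M_tf is meant. The only quotient actually
    built is V. *)

Definition equiv_on (T : Type) (S : T -> Prop) (R : T -> T -> Prop) : Prop :=
  [/\ forall x, S x -> R x x,
      forall x y, S x -> S y -> R x y -> R y x &
      forall x y z, S x -> S y -> S z -> R x y -> R y z -> R x z].

(** An arbitrary finite index type lets products and function spaces index representatives
    directly. *)
Definition class_reps (T : Type) (S : T -> Prop) (R : T -> T -> Prop)
    (I : finType) (s : I -> T) : Prop :=
  (forall i, S (s i)) /\ (forall i j, R (s i) (s j) -> i = j) /\
  (forall x, S x -> exists i, R x (s i)).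

Definition fin_classes (T : Type) (S : T -> Prop) (R : T -> T -> Prop) : Prop :=
  exists (k : nat) (s : 'I_k -> T), class_reps S R s.

Lemma choice_on (I : Type) (T : Type) (P : I -> T -> Prop) :
  (forall i, exists x, P i x) -> exists s : I -> T, forall i, P i (s i).
Proof.
move=> h; exists (fun i => proj1_sig (constructive_indefinite_description _ (h i))).
by move=> i; case: constructive_indefinite_description.
Qed.

Section ClassReps.
Variables (T : Type) (S : T -> Prop) (R : T -> T -> Prop).
Hypothesis eqR : equiv_on S R.

Lemma class_reps_leq (I J : finType) (s : I -> T) (t : J -> T) :
  class_reps S R s -> class_reps S R t -> (#|I| <= #|J|)%N.
Proof.
case: eqR => _ symR transR [sS [sI _]] [tS [_ tC]].
have /choice_on[f fP] : forall i, exists j, R (s i) (t j) by move=> i; exact: tC.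
apply: (@leq_card _ _ f) => i i' eqf; apply: sI.
apply: (transR _ (t (f i)) _) => //; apply: symR => //.
by rewrite eqf.
Qed.

(** The value chosen by [num_classes] means something only once a finite system of representatives
    exists, so a finiteness proof accompanies every index below. Two systems inject into each other,
    hence any of them computes the number. *)
Lemma num_classesE (I : finType) (s : I -> T) :
  class_reps S R s -> num_classes S R = #|I|.
Proof.
move=> tr; rewrite /num_classes.
have : exists k, exists t : 'I_k -> T, class_reps S R t.
  exists #|I|, (fun i => s (enum_val i)); case: tr => sS [sI sC]; split=> //.
  by split=> [i j /sI /enum_val_inj //|x /sC[i Ri]]; exists (enum_rank i); rewrite enum_rankK.
move=> /(epsilon_spec (inhabits 0%N)); set k := epsilon _ _; case=> t tP.
have := class_reps_leq tr tP; have := class_reps_leq tP tr.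
by rewrite card_ord => le1 le2; apply/eqP; rewrite eqn_leq le1 le2.
Qed.

Lemma num_classes_gt0 x : S x -> fin_classes S R -> (0 < num_classes S R)%N.
Proof.
move=> Sx [k [s tr]]; rewrite (num_classesE tr) card_ord.
by case: tr => _ [_ /(_ _ Sx) [i _]]; case: k i {s} => [[]|].
Qed.

End ClassReps.

Section Transfer.
Variables (T T' : Type) (S : T -> Prop) (R : T -> T -> Prop).
Variables (S' : T' -> Prop) (R' : T' -> T' -> Prop) (E : T -> T' -> Prop).
Hypothesis eqR' : equiv_on S' R'.
Hypothesis E_l : forall x, S x -> exists2 y, S' y & E x y.
Hypothesis E_r : forall y, S' y -> exists2 x, S x & E x y.
Hypothesis E_R : forall x x' y y', S x -> S x' -> S' y -> S' y' ->
  E x y -> E x' y' -> (R x x' <-> R' y y').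

Lemma equiv_on_transfer : equiv_on S R.
Proof.
case: eqR' => rfl sym trn; split.
- by move=> x Sx; have [y Sy Ey] := E_l Sx; apply/(E_R _ _ _ _ Ey Ey) => //; exact: rfl.
- move=> x x' Sx Sx' Rx; have [y Sy Ey] := E_l Sx; have [y' Sy' Ey'] := E_l Sx'.
  by apply/(E_R _ _ _ _ Ey' Ey) => //; apply: sym => //; apply/(E_R _ _ _ _ Ey Ey').
move=> x x' x'' Sx Sx' Sx'' Rx Rx'.
have [y Sy Ey] := E_l Sx; have [y' Sy' Ey'] := E_l Sx'; have [y'' Sy'' Ey''] := E_l Sx''.
apply/(E_R _ _ _ _ Ey Ey'') => //; apply: (trn _ y') => //.
  by apply/(E_R _ _ _ _ Ey Ey').
by apply/(E_R _ _ _ _ Ey' Ey'').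
Qed.

Lemma class_reps_transfer (I : finType) (t : I -> T') :
  class_reps S' R' t -> exists s : I -> T, class_reps S R s.
Proof.
move=> [tS [tI tC]].
have /choice_on[s sP] : forall i, exists x, S x /\ E x (t i).
  by move=> i; have [x] := E_r (tS i); exists x.
exists s; split=> [i|]; first by case: (sP i).
split=> [i j Rij|x Sx].
  have [Si Ei] := sP i; have [Sj Ej] := sP j.
  by apply: tI; apply/(E_R _ _ _ _ Ei Ej).
have [y Sy Ey] := E_l Sx; have [i Ri] := tC _ Sy; exists i.
by have [Si Ei] := sP i; apply/(E_R _ _ _ _ Ey Ei).
Qed.

Lemma fin_classes_transfer : fin_classes S' R' -> fin_classes S R.
Proof. by move=> [k [t /class_reps_transfer[s sP]]]; exists k, s. Qed.

(** [E] is a correspondence, not a map: connecting homomorphisms relate lifts to lifts, and in this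
    form no lift has to be chosen. *)
Lemma num_classes_transfer : fin_classes S' R' -> num_classes S R = num_classes S' R'.
Proof.
move=> [k [t tP]]; have [s sP] := class_reps_transfer tP.
by rewrite (num_classesE eqR' tP) (num_classesE equiv_on_transfer sP).
Qed.

End Transfer.

Section Index.
Variable A : zmodType.
Implicit Types P Q R : A -> Prop.

Definition subgrp P : Prop := P 0 /\ forall x y, P x -> P y -> P (x - y).

(** For subgroups this is the index in [P] of its intersection with [Q], that is, the order of the
    image of [P] modulo [Q]. *)
Definition quot_index P Q : nat := num_classes P (fun x y => Q (x - y)).
Definition fin_index P Q : Prop := fin_classes P (fun x y => Q (x - y)).

Lemma subgrpN P x : subgrp P -> P x -> P (- x).
Proof. by move=> [P0 PB] Px; rewrite -sub0r; apply: PB. Qed.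

Lemma subgrpD P x y : subgrp P -> P x -> P y -> P (x + y).
Proof. by move=> sP Px Py; rewrite -[y]opprK; apply: sP.2 => //; apply: subgrpN. Qed.

Lemma subgrp_equiv P Q : subgrp Q -> equiv_on P (fun x y => Q (x - y)).
Proof.
move=> sQ; split=> [x _|x y _ _ Qxy|x y z _ _ _ Qxy Qyz].
- by rewrite subrr; case: sQ.
- by rewrite -opprB; apply: subgrpN.
by rewrite -(subrK y x) -addrA; apply: subgrpD.
Qed.

Lemma fin_index_cover P Q (s : seq A) : subgrp Q ->
  (forall x, P x -> exists2 y, y \in s & Q (x - y)) -> fin_index P Q.
Proof.
move=> sQ cov.
(* The points of the cover need not lie in [P]: each is replaced by a point of [P] in the same
   class, if there is one and its class is new. *)
suff [t [tP [tI tC]]] : exists t : seq A, (forall y, y \in t -> P y) /\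
    (forall i j, (i < size t)%N -> (j < size t)%N -> Q (t`_i - t`_j) -> i = j) /\
    (forall x, P x -> (exists2 y, y \in s & Q (x - y)) ->
       exists2 y, y \in t & Q (x - y)).
  exists (size t), (fun i => t`_i); split=> [i|]; first by apply: tP; rewrite mem_nth.
  split=> [i j Qij|x Px]; first by exact/val_inj/(tI _ _ (ltn_ord i) (ltn_ord j)).
  have [y yt Qy] := tC _ Px (cov _ Px).
  by exists (Ordinal (etrans (index_mem y t) yt)); rewrite /= nth_index.
have [_ symR trnR] := subgrp_equiv (fun _ => True) sQ.
elim: s {cov} => [|y s [t [tP [tI tC]]]].
  by exists [::]; split=> //; split=> // x _ [].
have [[x [Px [Qx nx]]]|nex] := classic
    (exists x, P x /\ Q (x - y) /\ forall z, z \in t -> ~ Q (x - z)).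
  exists (x :: t); split=> [z|]; first by rewrite inE => /predU1P[->|/tP].
  split=> [[|i] [|j] //= li lj Qij|x' Px' [z]].
  - by case: (nx _ (mem_nth 0 lj)).
  - by case: (nx _ (mem_nth 0 li)); apply: symR.
  - by congr _.+1; apply: tI.
  rewrite inE => /predU1P[->|zs] Qz.
    by exists x; [rewrite inE eqxx | apply: (trnR _ y) => //; apply: symR].
  have [|z' z't Qz'] := tC _ Px'; first by exists z.
  by exists z' => //; rewrite inE z't orbT.
exists t; split=> //; split=> // x Px [z].
rewrite inE => /predU1P[->|zs] Qz; last by apply: tC => //; exists z.
have [//|no] := classic (exists2 z, z \in t & Q (x - z)).
by case: nex; exists x; split=> //; split=> // z' z't Qz'; apply: no; exists z'.
Qed.

Lemma fin_indexP P Q : fin_index P Q ->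
  exists s : seq A, forall x, P x -> exists2 y, y \in s & P y /\ Q (x - y).
Proof.
move=> [k [s [sP [_ sC]]]]; exists (codom s) => x /sC[i Qi].
by exists (s i); rewrite ?codom_f.
Qed.

Lemma fin_indexS P P' Q Q' : subgrp Q' -> (forall x, P' x -> P x) ->
  (forall x, P x -> Q x -> Q' x) -> subgrp P -> fin_index P Q -> fin_index P' Q'.
Proof.
move=> sQ' PP QQ sP /fin_indexP[s sC]; apply: (fin_index_cover (s := s)) => // x /PP Px.
by have [y ys [Py Qy]] := sC _ Px; exists y => //; apply: QQ => //; apply: sP.2.
Qed.

Lemma fin_index_tower P P' Q R : subgrp R -> (forall x, P' x -> P x) ->
  (forall x, P x -> (Q x <-> exists2 y, P' y & R (x - y))) -> subgrp P ->
  fin_index P Q -> fin_index P' R -> fin_index P R.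
Proof.
move=> sR PP QE sP /fin_indexP[s sC] /fin_indexP[t tC].
apply: (fin_index_cover (s := [seq x + y | x <- s, y <- t])) => // x Px.
have [y ys [Py /QE []]] := sC _ Px; first exact: sP.2.
move=> z P'z Rz; have [z' z't [_ Rz']] := tC _ P'z.
exists (y + z'); first by apply/allpairsP; exists (y, z').
by have := subgrpD sR Rz Rz'; rewrite addrA subrK opprD addrA.
Qed.

(* Q plays the role of P' + R; neither Q nor R need be contained in P. *)
Lemma index_tower P P' Q R : subgrp P -> subgrp P' -> subgrp Q -> subgrp R ->
  (forall x, P' x -> P x) ->
  (forall x, P x -> (Q x <-> exists2 y, P' y & R (x - y))) ->
  fin_index P Q -> fin_index P' R -> quot_index P R = (quot_index P Q * quot_index P' R)%N.
Proof.
move=> sP sP' sQ sR PP QE [a [s [sS [sI sC]]]] [b [t [tS [tI tC]]]].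
rewrite /quot_index (num_classesE (subgrp_equiv P sQ) (conj sS (conj sI sC))).
rewrite (num_classesE (subgrp_equiv P' sR) (conj tS (conj tI tC))) -card_prod.
apply: (num_classesE (subgrp_equiv P sR) (s := fun ij => s ij.1 + t ij.2)).
split=> [[i j]|] /=; first by apply: subgrpD => //; apply: PP.
split=> [[i j] [i' j'] /= Rij|x Px].
  have e : s i + t j - (s i' + t j') = s i - s i' - (t j' - t j).
    by rewrite opprB opprD addrACA; congr (_ + _); rewrite addrC.
  have eqi : i = i'.
    apply/sI/QE; first exact: sP.2.
    by exists (t j' - t j); [exact: sP'.2 | rewrite -e].
  rewrite eqi in Rij *; congr (_, _); apply: tI.
  by move: Rij; rewrite opprD addrACA subrr add0r.
have [i Qi] := sC _ Px; move/QE: Qi => [|y P'y Ry]; first exact: sP.2.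
have [j Rj] := tC _ P'y; exists (i, j) => /=.
by have := subgrpD sR Ry Rj; rewrite addrA subrK opprD addrA.
Qed.

End Index.

(** * Integral lattices *)

Lemma absz_unit (u : int) : u \is a GRing.unit -> absz u = 1%N.
Proof. by rewrite unfold_in /= => /orP[/eqP->|/eqP->]. Qed.

Definition in_span r n (D : 'M[int]_(r, n)) (x : 'rV[int]_n) : Prop :=
  exists c : 'rV[int]_r, x = c *m D.

Lemma in_span_subgrp r n (D : 'M[int]_(r, n)) : subgrp (in_span D).
Proof.
split; first by exists 0; rewrite mul0mx.
by move=> x y [c ->] [c' ->]; exists (c - c'); rewrite mulmxBl.
Qed.

(** By Smith normal form D = L Delta R with L and R invertible, so a box of residues 0 <= k_i <
    |d_i|, multiplied by R, represents the cosets; it has |det D| points. *)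
Lemma class_reps_det r (D : 'M[int]_r) : \det D != 0 ->
  exists (I : finType) (s : I -> 'rV[int]_r), #|I| = absz (\det D) /\
    class_reps (fun _ => True) (fun x y => in_span D (x - y)) s.
Proof.
move=> nzD; have [L uL [R uR [d _ defD]]] := int_Smith_normal_form D.
pose Delta : 'M[int]_r := \matrix_(i, j) (d`_i *+ (i == j :> nat)).
pose e (i : 'I_r) : int := d`_i.
have DeltaE : Delta = diag_mx (\row_i e i).
  by apply/matrixP=> i j; rewrite !mxE.
have absD : absz (\det D) = (\prod_(i < r) absz (e i))%N.
  rewrite defD !det_mulmx -/Delta DeltaE det_diag !abszM.
  rewrite (absz_unit uL) (absz_unit uR) mul1n muln1.
  rewrite (big_morph absz abszM absz1).
  by apply: eq_bigr => i _; rewrite mxE.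
have nzd (i : 'I_r) : e i != 0.
  by apply: contraNneq nzD => di0; rewrite -absz_eq0 absD (bigD1 i) //= di0.
(* The sides of the box differ; [K] bounds them all, so that the box is a family inside one function
   type. *)
pose K := (\max_(i < r) absz (e i)).+1.
pose F (i : 'I_r) := [pred k : 'I_K | (k < absz (e i))%N].
have dltK (i : 'I_r) : (absz (e i) < K)%N by rewrite ltnS (leq_bigmax i).
pose f0 (f : {f : {ffun 'I_r -> 'I_K} | f \in family F}) := \row_i (sval f i : nat)%:Z *m R.
have spanE x : in_span D x <-> in_span Delta (x *m invmx R).
  split=> [[c ->]|[c cE]].
    by exists (c *m L); rewrite defD -/Delta -!mulmxA mulmxV // mulmx1.
  by exists (c *m invmx L); rewrite defD -/Delta !mulmxA mulmxKV // -cE mulmxKV.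
have spanDelta x : in_span Delta x <-> forall i : 'I_r, (e i %| x ord0 i)%Z.
  rewrite DeltaE; split=> [[c ->] i|dv].
    by rewrite mul_mx_diag !mxE dvdz_mull.
  exists (\row_i (x ord0 i %/ e i)%Z); rewrite mul_mx_diag.
  by apply/rowP=> i; rewrite !mxE divzK.
exists _, f0; split.
  rewrite card_sig (eq_card (B := mem (family F))) // card_family absD.
  rewrite foldrE big_map big_enum /=; apply: eq_bigr => i _.
  rewrite -[RHS]card_ord -[RHS](card_codom (f := widen_ord (ltnW (dltK i)))); last first.
    by move=> a b /(congr1 val) /= /val_inj.
  apply: eq_card => k; apply/idP/codomP => [lt|[k' ->]] /=; last exact: (ltn_ord k').
  change (is_true (k < absz (e i))%N) in lt.
  by exists (Ordinal lt); apply: val_inj.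
split=> //; split=> [f g|x _].
  move/spanE; rewrite /f0 -mulmxBl mulmxK // => /spanDelta dv.
  apply: val_inj; apply/ffunP=> i; apply: val_inj; apply/eqP.
  have := dv i; rewrite !mxE -eqz_mod_dvd.
  have /familyP/(_ i) := valP f; have /familyP/(_ i) := valP g; rewrite !inE => lg lf.
  by rewrite -!(modz_abs _ (e i)) !modz_small.
have [y yE] : exists y, y = x *m invmx R by exists (x *m invmx R).
have lt (i : 'I_r) : (absz (y ord0 i %% e i)%Z < absz (e i))%N.
  by rewrite -ltz_nat gez0_abs ?modz_ge0 ?nzd // ltz_mod ?nzd.
have inF : [ffun i => Ordinal (ltn_trans (lt i) (dltK i))] \in family F.
  by apply/familyP=> i; rewrite ffunE; exact: lt.
exists (exist (fun f => is_true (f \in family F)) _ inF); apply/spanE/spanDelta => i; rewrite /f0 /= mulmxBl mulmxK // -yE.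
by rewrite !mxE ffunE /= gez0_abs ?modz_ge0 ?nzd // -eqz_mod_dvd modz_mod.
Qed.

Lemma fin_index_det r (D : 'M[int]_r) : \det D != 0 -> fin_index (fun _ => True) (in_span D).
Proof.
move=> /class_reps_det[I [s [_ [sS [sI sC]]]]].
exists #|I|, (fun i => s (enum_val i)); split=> //.
split=> [i j Rij|x _]; first by apply/enum_val_inj/sI.
by have [i Ri] := sC x Logic.I; exists (enum_rank i); rewrite enum_rankK.
Qed.

Lemma index_det r (D : 'M[int]_r) : \det D != 0 ->
  quot_index (fun _ => True) (in_span D) = absz (\det D).
Proof.
move=> /class_reps_det[I [s [<- tr]]].
exact: (num_classesE (subgrp_equiv _ (in_span_subgrp D)) tr).
Qed.

Section LatticeBasis.
Variable A : zmodType.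

Definition additive_int (f : A -> int) := forall x y, f (x + y) = f x + f y.

Lemma additive_int0 f : additive_int f -> f 0 = 0.
Proof. by move=> fD; apply: (addrI (f 0)); rewrite -fD !addr0. Qed.

Lemma additive_intN f x : additive_int f -> f (- x) = - f x.
Proof. by move=> fD; apply: (addrI (f x)); rewrite -fD !subrr additive_int0. Qed.

Lemma additive_intMz f x k : additive_int f -> f (x *~ k) = f x * k.
Proof.
move=> fD; have nat_case n : f (x *+ n) = f x * n%:Z.
  elim: n => [|n IHn]; first by rewrite mulr0n additive_int0 ?mulr0.
  by rewrite mulrSr fD IHn intS mulrDr mulr1 addrC.
by case: k => n; rewrite ?NegzE -?pmulrn ?mulrNz ?additive_intN // nat_case ?mulrN.
Qed.

Lemma additive_int_sum f (I : Type) (s : seq I) (P : pred I) (F : I -> A) :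
  additive_int f -> f (\sum_(i <- s | P i) F i) = \sum_(i <- s | P i) f (F i).
Proof. by move=> fD; rewrite (big_morph f fD (additive_int0 fD)). Qed.

(* Bases modulo the common kernel of finitely many functionals: eliminate one
   functional at a time, dividing by a generator of its image. *)
Lemma lattice_basis (S : A -> Prop) (N : nat) (f : nat -> A -> int) :
  subgrp S -> (forall k, additive_int (f k)) ->
  exists (r : nat) (b : 'I_r -> A),
    [/\ forall i, S (b i),
        forall x, S x -> exists c : 'I_r -> int,
          forall k, (k < N)%N -> f k (x - \sum_(i < r) b i *~ c i) = 0 &
        forall c : 'I_r -> int,
          (forall k, (k < N)%N -> f k (\sum_(i < r) b i *~ c i) = 0) -> forall i, c i = 0].
Proof.
move=> + fD; elim: N S => [|N IHN] S sS.
  exists 0%N, (fun _ => 0); split; [by case | | by move=> c _ []].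
  by move=> x _; exists (fun _ => 0).
have sS' : subgrp (fun x => S x /\ f N x = 0).
  split=> [|x y [Sx fx] [Sy fy]]; first by split; [case: sS | rewrite additive_int0].
  by split; [apply: sS.2 | rewrite fD additive_intN // fx fy subrr].
have [r [b [bS bC bI]]] := IHN _ sS'.
have fb i : f N (b i) = 0 by case: (bS i).
have fbs c : f N (\sum_(i < r) b i *~ c i) = 0.
  by rewrite additive_int_sum // big1 // => i _; rewrite additive_intMz // fb mul0r.
have [[x0 [Sx0 fx0]]|no] := classic (exists x, S x /\ f N x != 0); last first.
  exists r, b; split=> [i|x Sx|c cP]; first by case: (bS i).
    have fx : f N x = 0 by apply/eqP; apply: contra_notT no => fx; exists x.
    have [c cP] := bC x (conj Sx fx); exists c => k.
    rewrite ltnS leq_eqVlt => /predU1P[->|/cP//].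
    by rewrite fD additive_intN // fbs fx subrr.
  by apply: bI => k kN; apply: cP; rewrite ltnS ltnW.
(* The generator of the image is a non-zero value of least absolute value, found by descent. *)
have [d [[x1 [Sx1 nz1 dE]] dmin]] : exists d, (exists x, [/\ S x, f N x != 0 & absz (f N x) = d])
    /\ forall x, S x -> f N x != 0 -> (d <= absz (f N x))%N.
  move: {2}(absz _) (leqnn (absz (f N x0))) => k; elim: k x0 Sx0 fx0 => [|k IHk] x0 Sx0 nz0 le0.
    by move: le0; rewrite leqn0 absz_eq0 (negPf nz0).
  have [[y [Sy nzy lty]]|no] := classic (exists y, [/\ S y, f N y != 0 & (absz (f N y) < absz (f N x0))%N]).
    by apply: (IHk y Sy nzy); rewrite -ltnS (leq_trans lty).
  exists (absz (f N x0)); split; first by exists x0.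
  by move=> x Sx nzx; rewrite leqNgt; apply: contra_notN no => lt; exists x.
have SMz x k : S x -> S (x *~ k).
  move=> Sx; have Sn n : S (x *+ n).
    by elim: n => [|n IHn]; [case: sS | rewrite mulrS; apply: subgrpD].
  case: k => n; first exact: Sn.
  by rewrite NegzE mulrNz; apply: subgrpN => //; exact: Sn.
have dvd x : S x -> (f N x1 %| f N x)%Z.
  move=> Sx; pose q := (f N x %/ f N x1)%Z.
  have fE : f N (x - x1 *~ q) = (f N x %% f N x1)%Z.
    by rewrite fD additive_intN // additive_intMz // {1}(divz_eq (f N x) (f N x1)) mulrC addrAC subrr add0r.
  apply: contraT => ndv; have := dmin (x - x1 *~ q).
  rewrite fE; have -> : ((f N x %% f N x1)%Z != 0) by apply: contraNneq ndv => /dvdz_mod0P.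
  rewrite -dE => /(_ (sS.2 _ _ Sx (SMz _ _ Sx1)) isT).
  by rewrite leqNgt -ltz_nat gez0_abs ?modz_ge0 // ltz_mod.
exists r.+1, (fun i => oapp b x1 (unlift ord0 i)).
have sumE c : \sum_(i < r.+1) oapp b x1 (unlift ord0 i) *~ c i =
    x1 *~ c ord0 + \sum_(i < r) b i *~ c (lift ord0 i).
  by rewrite big_ord_recl unlift_none /=; congr (_ + _); apply: eq_bigr => i _; rewrite liftK.
split=> [i|x Sx|c cP].
- by case: (unliftP ord0 i) => [j|] _ //=; case: (bS j).
- pose q := (f N x %/ f N x1)%Z.
  have fE : f N (x - x1 *~ q) = 0.
    by rewrite fD additive_intN // additive_intMz // mulrC divzK ?subrr // dvd.
  have [c cP] := bC (x - x1 *~ q) (conj (sS.2 _ _ Sx (SMz _ _ Sx1)) fE).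
  exists (fun i => oapp c q (unlift ord0 i)) => k.
  rewrite sumE unlift_none /= opprD addrA.
  under eq_bigr do rewrite liftK /=.
  rewrite ltnS leq_eqVlt => /predU1P[->|/cP//].
  by rewrite fD fE additive_intN // fbs subrr.
have c0 : c ord0 = 0.
  have := cP N (ltnSn N); rewrite sumE fD (fbs (fun i => c (lift ord0 i))) addr0.
  by rewrite additive_intMz // => /eqP; rewrite mulf_eq0 (negPf nz1) => /eqP.
have cb : forall j, c (lift ord0 j) = 0.
  apply: (bI (fun j => c (lift ord0 j))) => k kN.
  have := cP k (leqW kN); by rewrite sumE c0 mulr0z add0r.
by move=> i; case: (unliftP ord0 i) => [j|] ->.
Qed.

End LatticeBasis.

(** * Determinants on subspaces and Brauer relations *)

Definition lcomb (vT : lmodType rat) k (b : 'I_k -> vT) (c : 'rV[rat]_k) : vT :=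
  \sum_(i < k) c ord0 i *: b i.

(* [det_on E a d]: d is the determinant of a restricted to the finite-dimensional
   a-stable subspace E. *)
Definition det_on (vT : lmodType rat) (E : vT -> Prop) (a : vT -> vT) (d : rat) : Prop :=
  exists (k : nat) (b : 'I_k -> vT) (A : 'M[rat]_k),
    [/\ forall c, lcomb b c = 0 -> c = 0,
        forall v, E v <-> exists c, v = lcomb b c,
        forall i, a (b i) = lcomb b (row i A) & d = \det A].

Section LinearCombinations.
Variable vT : lmodType rat.
Implicit Types (E : vT -> Prop).

Lemma lcomb_mulmx k l (b : 'I_k -> vT) (b' : 'I_l -> vT) (C : 'M_(k, l)) (c : 'rV_k) :
  (forall i, b i = lcomb b' (row i C)) -> lcomb b c = lcomb b' (c *m C).
Proof.
move=> bE; rewrite /lcomb; under eq_bigr => i _ do rewrite bE scaler_sumr.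
rewrite exchange_big /=; apply: eq_bigr => j _; rewrite mxE scaler_suml.
by apply: eq_bigr => i _; rewrite scalerA mxE.
Qed.

Lemma lcombB k (b : 'I_k -> vT) (c c' : 'rV_k) : lcomb b c - lcomb b c' = lcomb b (c - c').
Proof.
by rewrite /lcomb -sumrB; apply: eq_bigr => i _; rewrite !mxE scalerBl.
Qed.

Lemma lcomb_inj k (b : 'I_k -> vT) : (forall c, lcomb b c = 0 -> c = 0) -> injective (lcomb b).
Proof.
by move=> bI c c' e; apply/eqP; rewrite -subr_eq0; apply/eqP/bI; rewrite -lcombB e subrr.
Qed.

Lemma lcomb_delta k (b : 'I_k -> vT) i : lcomb b (delta_mx ord0 i) = b i.
Proof.
rewrite /lcomb (bigD1 i) //= big1 => [|j ne]; rewrite mxE eqxx ?eqxx ?scale1r ?addr0 //=.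
by rewrite (negPf ne) scale0r.
Qed.

Lemma det_on_uniq E a d d' :
  (forall (x : rat) u v, E u -> E v -> a (x *: u + v) = x *: a u + a v) ->
  det_on E a d -> det_on E a d' -> d = d'.
Proof.
move=> aL [k [b [A [bI bE bA ->]]]] [l [b' [B [b'I b'E b'B ->]]]].
have mem i : E (b i) by apply/bE; exists (delta_mx ord0 i); rewrite lcomb_delta.
have mem' i : E (b' i) by apply/b'E; exists (delta_mx ord0 i); rewrite lcomb_delta.
have /choice_on[C CP] : forall i, exists c, b i = lcomb b' c by move=> i; apply/b'E.
have /choice_on[D DP] : forall i, exists c, b' i = lcomb b c by move=> i; apply/bE.
pose MC := \matrix_i C i; pose MD := \matrix_i D i.
have bC i : b i = lcomb b' (row i MC) by rewrite rowK.
have bD i : b' i = lcomb b (row i MD) by rewrite rowK.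
have CD : MC *m MD = 1%:M.
  apply/row_matrixP=> i; apply: (lcomb_inj bI).
  by rewrite row_mul -(lcomb_mulmx _ bD) -bC rowE mulmx1 lcomb_delta.
have DC : MD *m MC = 1%:M.
  apply/row_matrixP=> i; apply: (lcomb_inj b'I).
  by rewrite row_mul -(lcomb_mulmx _ bC) -bD rowE mulmx1 lcomb_delta.
have eqkl : k = l by apply/eqP; rewrite eqn_leq (mulmx1_min CD) (mulmx1_min DC).
case: l / eqkl in b' B b'I b'E b'B mem' C CP D DP MC MD bC bD CD DC *.
have a_lcomb (c : 'rV_k) : a (lcomb b' c) = \sum_j c ord0 j *: a (b' j).
  have E0 : E 0 by apply/b'E; exists 0; rewrite /lcomb big1 // => i _; rewrite mxE scale0r.
  have a0 : a 0 = 0.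
    by have := aL (-1) 0 0 E0 E0; rewrite scaler0 add0r scaleN1r addNr.
  (* [a] is linear on [E] only, so membership of the partial sums is carried through the
     induction. *)
  rewrite /lcomb; have : forall s : seq 'I_k, E (\sum_(j <- s) c ord0 j *: b' j) /\
      a (\sum_(j <- s) c ord0 j *: b' j) = \sum_(j <- s) c ord0 j *: a (b' j).
    elim=> [|j s [Es IHs]]; first by rewrite !big_nil.
    rewrite !big_cons aL // IHs; split=> //.
    case/b'E: Es => e ->; apply/b'E; exists (c ord0 j *: delta_mx ord0 j + e).
    rewrite -[b' j](lcomb_delta b') /lcomb scaler_sumr -big_split /=.
    by apply: eq_bigr => i _; rewrite !mxE scalerDl scalerA.
  by case/(_ (index_enum _)).
have AC : A *m MC = MC *m B.
  apply/row_matrixP=> i; apply: (lcomb_inj b'I).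
  rewrite !row_mul -(lcomb_mulmx _ bC) -bA bC a_lcomb -(lcomb_mulmx (b := fun j => a (b' j))) //.
have : \det A * \det MC = \det MC * \det B by rewrite -!det_mulmx AC.
have nz : \det MC != 0.
  by rewrite -unitfE -unitmxE; case/mulmx1_unit: CD.
by rewrite mulrC => /(mulfI nz).
Qed.

Lemma det_on_add E E1 E2 a d1 d2 :
  (forall v, E v <-> exists v1 v2, [/\ E1 v1, E2 v2 & v = v1 + v2]) ->
  (forall v1 v2, E1 v1 -> E2 v2 -> v1 + v2 = 0 -> v1 = 0 /\ v2 = 0) ->
  det_on E1 a d1 -> det_on E2 a d2 -> det_on E a (d1 * d2).
Proof.
move=> EE dis [k [b [A [bI bE bA ->]]]] [l [b' [B [b'I b'E b'B ->]]]].
pose c0 (i : 'I_(k + l)) := match split i with inl i => b i | inr j => b' j end.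
have cE (c : 'rV_(k + l)) : lcomb c0 c = lcomb b (lsubmx c) + lcomb b' (rsubmx c).
  rewrite /lcomb big_split_ord /=; congr (_ + _); apply: eq_bigr => i _.
    by rewrite mxE /c0 (unsplitK (inl i)).
  by rewrite mxE /c0 (unsplitK (inr i)).
exists (k + l)%N, c0, (block_mx A 0 0 B); split.
- move=> c; rewrite cE => /dis[].
  + by apply/bE; exists (lsubmx c).
  + by apply/b'E; exists (rsubmx c).
  by move=> /bI l0 /b'I r0; rewrite -[c]hsubmxK l0 r0 row_mx0.
- move=> v; split=> [/EE[v1 [v2 [/bE[c1 ->] /b'E[c2 ->] ->]]]|[c ->]].
    by exists (row_mx c1 c2); rewrite cE row_mxKl row_mxKr.
  apply/EE; exists (lcomb b (lsubmx c)), (lcomb b' (rsubmx c)); split=> //.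
    by apply/bE; exists (lsubmx c).
  by apply/b'E; exists (rsubmx c).
- have lc0 m (u : 'I_m -> vT) : lcomb u 0 = 0.
    by rewrite /lcomb big1 // => i _; rewrite mxE scale0r.
  move=> i; rewrite cE /c0; case: splitP => j ij.
    have -> : i = lshift l j by apply: val_inj.
    by rewrite rowKu row_row_mx row_mxKl row_mxKr row0 lc0 addr0.
  have -> : i = rshift k j by apply: val_inj.
  by rewrite rowKd row_row_mx row_mxKl row_mxKr row0 lc0 add0r.
by rewrite det_ublock.
Qed.

Lemma det_on0 E a : (forall v, E v <-> v = 0) -> det_on E a 1.
Proof.
move=> E0; exists 0%N, (fun _ => 0), 0; split.
- by move=> c _; apply/rowP; case.
- by move=> v; split=> [/E0->|[c ->]]; [exists 0|apply/E0]; rewrite /lcomb big_ord0.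
- by case.
by rewrite det_mx00.
Qed.

Lemma det_on_eq E E' a d : (forall v, E v <-> E' v) -> det_on E a d -> det_on E' a d.
Proof.
move=> EE [k [b [A [bI bE bA ->]]]]; exists k, b, A; split=> //.
by move=> v; rewrite -EE.
Qed.

End LinearCombinations.

Lemma det_on_iso (vT wT : lmodType rat) (E : vT -> Prop) (E' : wT -> Prop) a a' F d :
  (forall (x : rat) u v, F (x *: u + v) = x *: F u + F v) ->
  (forall v, E v -> E' (F v)) ->
  (forall v, E v -> F v = 0 -> v = 0) ->
  (forall w, E' w -> exists2 v, E v & w = F v) ->
  (forall v, E v -> F (a v) = a' (F v)) ->
  det_on E a d -> det_on E' a' d.
Proof.
move=> FL FE FI FS Fa [k [b [A [bI bE bA ->]]]].
have F0 : F 0 = 0 by have := FL (-1) 0 0; rewrite scaler0 add0r scaleN1r addNr.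
have F_lcomb c : F (lcomb b c) = lcomb (F \o b) c.
  rewrite /lcomb; elim/big_rec2: _ => // i u v _ <-; exact: FL.
have mem c : E (lcomb b c) by apply/bE; exists c.
exists k, (F \o b), A; split=> // [c|w|i] /=.
- by rewrite -F_lcomb => /FI e; apply/bI/e.
- split=> [/FS[v /bE[c ->] ->]|[c ->]]; first by exists c; rewrite F_lcomb.
  by rewrite -F_lcomb; apply: FE.
by rewrite -F_lcomb -bA Fa // -lcomb_delta.
Qed.

Section BrauerDeterminant.
Variables (gT : finGroupType) (G : {group gT}) (n : {group gT} -> int).
Variables (r : nat) (rho : gT -> 'M[rat]_r) (alpha : 'M[rat]_r).
Hypothesis rho1 : rho 1%g = 1%:M.
Hypothesis rhoM : forall g h, g \in G -> h \in G -> rho (g * h)%g = rho h *m rho g.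
Hypothesis alphaC : forall g, g \in G -> rho g *m alpha = alpha *m rho g.

Local Notation T := (brT n).
Local Notation K := (brK n).
Local Notation uT := {ffun T -> 'rV[rat]_r}.

(** The group acts on row vectors by right multiplication with [rho g]; this is a left action
    because [rho] reverses products. *)
Definition fixed_vec (H : {group gT}) (v : 'rV[rat]_r) : Prop :=
  forall h, h \in H -> v *m rho h = v.

(* G-maps from the G-set P to W, i.e. Hom_G(Q[P], W) *)
Definition equiv_fun (P : pred T) (u : uT) : Prop :=
  (forall g t, g \in G -> u (br_act g t) = u t *m rho g) /\ (forall t, ~~ P t -> u t = 0).

Definition apply_alpha (u : uT) : uT := [ffun t => u t *m alpha].

Definition in_orbit (x : {group gT} * 'I_K) : pred T :=
  fun t => let: (H, C, i) := t in [&& H == x.1, C \in lcosets H G & i == x.2].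

Lemma br_actM g h t : br_act (n := n) (g * h)%g t = br_act g (br_act h t).
Proof. by case: t => [[H C] i] /=; rewrite lcosetM. Qed.

Lemma br_act1 t : br_act (n := n) 1%g t = t.
Proof. by case: t => [[H C] i] /=; rewrite mul1g. Qed.

Lemma br_actK g : cancel (br_act (n := n) g) (br_act g^-1%g).
Proof. by move=> t; rewrite -br_actM mulVg br_act1. Qed.

Lemma br_actKV g : cancel (br_act (n := n) g^-1%g) (br_act g).
Proof. by move=> t; rewrite -br_actM mulgV br_act1. Qed.

Lemma lcosets_act (H : {group gT}) g C : g \in G -> ((g *: C)%g \in lcosets H G) = (C \in lcosets H G).
Proof.
have imp h D : h \in G -> D \in lcosets H G -> (h *: D)%g \in lcosets H G.
  move=> hG /lcosetsP[x xG ->]; apply/lcosetsP; exists (h * x)%g; first by rewrite groupM.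
  by rewrite lcosetM.
move=> gG; apply/idP/idP; last exact: imp.
by move/(imp g^-1%g); rewrite groupV => /(_ gG); rewrite -lcosetM mulVg mul1g.
Qed.

Lemma in_orbit_act x g t : g \in G -> in_orbit x (br_act g t) = in_orbit x t.
Proof. by case: t => [[H C] i] gG /=; rewrite lcosets_act. Qed.

Lemma br_in_act pos g (t : T) : g \in G -> br_in G pos (br_act g t) = br_in G pos t.
Proof. by case: t => [[H C] i] gG; rewrite /br_in /= lcosets_act. Qed.

(** Frobenius reciprocity: a G-map from G/H to W is determined by its value at the coset H, which is
    an arbitrary H-fixed vector, and [alpha] acts on values. *)
Lemma det_on_orbit (H : {group gT}) i d : H \subset G ->
  det_on (fixed_vec H) (mulmxr alpha) d ->
  det_on (equiv_fun (in_orbit (H, i))) apply_alpha d.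
Proof.
move=> sHG.
(* Any point of the coset gives the same vector when [w] is H-fixed, so the choice made by [repr] is
   harmless. *)
pose F (w : 'rV[rat]_r) : uT := [ffun t => if in_orbit (H, i) t then w *m rho (repr t.1.2) else 0].
have FE w x : fixed_vec H w -> x \in G -> F w (H, (x *: H)%g, i) = w *m rho x.
  move=> wH xG; rewrite ffunE /= !eqxx.
  have -> /= : (x *: H)%g \in lcosets H G by apply/lcosetsP; exists x.
  have /lcosetP[h hH ->] : repr (x *: H)%g \in (x *: H)%g by rewrite (mem_repr x) ?lcoset_refl.
  have hG := subsetP sHG _ hH.
  by rewrite rhoM // mulmxA wH.
have orbE t : in_orbit (H, i) t -> exists2 x, x \in G & t = (H, (x *: H)%g, i).
  by case: t => [[H' C] j] /and3P[/eqP/= -> /lcosetsP[x xG ->] /eqP ->]; exists x.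
apply: (det_on_iso (F := F)).
- move=> x u v; apply/ffunP=> t; rewrite !ffunE.
  by case: ifP => _; rewrite ?scaler0 ?addr0 // mulmxDl scalemxAl.
- move=> w wH; split=> [g t gG|t /negPf nt]; last by rewrite ffunE nt.
  have [/orbE[x xG ->]|nt] := boolP (in_orbit (H, i) t).
    by rewrite /= -lcosetM !FE ?groupM // rhoM // mulmxA.
  by rewrite !ffunE in_orbit_act // (negPf nt) mul0mx.
- move=> w wH /ffunP/(_ (H, (1 *: H)%g, i)).
  by rewrite FE // rho1 mulmx1 ffunE.
- move=> u [uE uS]; pose w := u (H, (H : {set gT}), i).
  have wH : fixed_vec H w.
    by move=> h hH; rewrite /w -uE ?(subsetP sHG) //= lcoset_id.
  exists w => //; apply/ffunP=> t.
  have [/orbE[x xG ->]|nt] := boolP (in_orbit (H, i) t).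
    by rewrite FE // /w -uE.
  by rewrite uS // ffunE (negPf nt).
move=> w wH; apply/ffunP=> t; rewrite !ffunE.
have [/orbE[x xG ->]|nt] := boolP (in_orbit (H, i) t); last by rewrite mul0mx.
have /lcosetP[h hH ->] : repr (x *: H)%g \in (x *: H)%g by rewrite (mem_repr x) ?lcoset_refl.
have hG := subsetP sHG _ hH.
by rewrite /= -!mulmxA alphaC // groupM.
Qed.

Lemma det_on_orbits (d : {group gT} -> rat) (s : seq ({group gT} * 'I_K)) : uniq s ->
  (forall x, x \in s -> x.1 \subset G) ->
  (forall H : {group gT}, H \subset G -> det_on (fixed_vec H) (mulmxr alpha) (d H)) ->
  det_on (equiv_fun (fun t => has (in_orbit^~ t) s)) apply_alpha (\prod_(x <- s) d x.1).
Proof.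
move=> + + dH; elim: s => [_ _|x s IHs /= /andP[xs us] sG].
  rewrite big_nil; apply: det_on0 => u; split=> [[_ u0]|->].
    by apply/ffunP=> t; rewrite u0 ?ffunE.
  by split=> [g t _|t _]; rewrite !ffunE ?mul0mx.
have orb_dis t : in_orbit x t -> ~~ has (in_orbit^~ t) s.
  case: t => [[H C] i] /and3P[/eqP Hx _ /eqP ix]; apply: contra xs => /hasP[[H' j] ys].
  by move=> /and3P[/= /eqP eH _ /eqP ei]; case: x Hx ix {sG} => H0 i0 /= <- <-; rewrite eH ei.
rewrite big_cons; apply: (det_on_add _ _ (det_on_orbit (H := x.1) x.2 _ (dH _ _))
  (IHs us _)); try by [apply: sG; rewrite inE eqxx | move=> y ys; apply: sG; rewrite inE ys orbT].
- rewrite -surjective_pairing => u; split=> [[uE uS]|].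
    exists [ffun t => if in_orbit x t then u t else 0],
           [ffun t => if has (in_orbit^~ t) s then u t else 0]; split.
    + split=> [g t gG|t /negPf nt]; rewrite !ffunE ?nt // in_orbit_act // uE //.
      by case: ifP; rewrite ?mul0mx.
    + split=> [g t gG|t /negPf nt]; rewrite !ffunE ?nt // uE //.
      rewrite (eq_has (a2 := in_orbit^~ t)) => [|y]; last exact: in_orbit_act.
      by case: ifP; rewrite ?mul0mx.
    apply/ffunP=> t; rewrite !ffunE; have [/orb_dis/negPf->|nx] := boolP (in_orbit x t).
      by rewrite addr0.
    by case: ifP => ns; rewrite add0r // uS // (negPf nx) ns.
  move=> [v1 [v2 [[E1 S1] [E2 S2] ->]]]; split=> [g t gG|t].
    by rewrite !ffunE E1 // E2 // mulmxDl.
  by rewrite negb_or ffunE => /andP[n1 n2]; rewrite S1 // S2 // addr0.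
rewrite -surjective_pairing => v1 v2 [E1 S1] [E2 S2] /ffunP e.
suff v10 : v1 = 0.
  split=> //; apply/ffunP=> t; have := e t; rewrite v10 !ffunE add0r; exact.
apply/ffunP=> t; have := e t; rewrite !ffunE.
have [/orb_dis/S2->|/S1->] := boolP (in_orbit x t); last by [].
by rewrite addr0.
Qed.

Definition sign_ok (pos : bool) (H : {group gT}) := if pos then 0 < n H else n H < 0.

Lemma absz_lt_brK (H : {group gT}) : (absz (n H) < K)%N.
Proof. by rewrite ltnS (bigD1 H) //= leq_addr. Qed.

(** X_+ and X_- split into |n_H| copies of each G/H with n_H of the given sign, and the determinant
    is multiplicative over orbits. *)
Lemma det_on_br_in pos (d : {group gT} -> rat) :
  (forall H : {group gT}, H \subset G -> det_on (fixed_vec H) (mulmxr alpha) (d H)) ->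
  det_on (equiv_fun (br_in (n := n) G pos)) apply_alpha
    (\prod_(H : {group gT} | (H \subset G) && sign_ok pos H) d H ^+ absz (n H)).
Proof.
move=> dH; pose P (x : {group gT} * 'I_K) :=
  ((x.1 \subset G) && sign_ok pos x.1) && (x.2 < absz (n x.1))%N.
have -> : \prod_(H : {group gT} | (H \subset G) && sign_ok pos H) d H ^+ absz (n H) =
    \prod_(x <- enum P) d x.1.
  rewrite big_enum /=.
  rewrite -(pair_big_dep (fun H : {group gT} => (H \subset G) && sign_ok pos H)
     (fun (H : {group gT}) (i : 'I_K) => (i < absz (n H))%N) (fun H _ => d H)) /=.
  apply: eq_bigr => H _.
  rewrite -(big_ord_widen _ (fun _ => d H) (ltnW (absz_lt_brK H))).
  by rewrite prodr_const card_ord.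
apply: det_on_eq (det_on_orbits (enum_uniq P) _ dH); last first.
  by move=> x; rewrite mem_enum => /andP[/andP[]].
have E (t : T) : has (in_orbit^~ t) (enum P) = br_in G pos t.
  case: t => [[H C] i]; rewrite /br_in -/(sign_ok pos H); apply/hasP/and4P.
    move=> [[H' j]]; rewrite mem_enum => /andP[/= /andP[HG sg] lt] /and3P[/= /eqP-> CC /eqP->].
    by split.
  move=> [HG CC lt sg]; exists (H, i); first by rewrite mem_enum /P unfold_in /= HG sg.
  by rewrite /= !eqxx CC.
by move=> u; split=> [[uE uS]|[uE uS]]; split=> // t nt; apply: uS; [rewrite E|rewrite -E].
Qed.

End BrauerDeterminant.

(** * Transport of equivariant maps along the isomorphism of permutation modules *)

Section BrauerIso.
Variables (gT : finGroupType) (G : {group gT}) (n : {group gT} -> int).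
Variables (r : nat) (rho : gT -> 'M[rat]_r) (alpha : 'M[rat]_r).

Local Notation T := (brT n).
Local Notation fT := {ffun T -> rat}.
Local Notation uT := {ffun T -> 'rV[rat]_r}.
Local Notation Xp := (br_in (n := n) G true).
Local Notation Xm := (br_in (n := n) G false).

Variable Phi : fT -> fT.
Hypothesis PhiL : forall (a : rat) f f', supported Xp f -> supported Xp f' ->
  Phi [ffun t => a * f t + f' t] = [ffun t => a * Phi f t + Phi f' t].
Hypothesis PhiS : forall f, supported Xp f -> supported Xm (Phi f).
Hypothesis PhiG : forall g f, g \in G -> supported Xp f -> Phi (br_gf g f) = br_gf g (Phi f).
Hypothesis Phi_ker : forall f, supported Xp f -> Phi f = 0 -> f = 0.
Hypothesis Phi_surj : forall f', supported Xm f' -> exists f, supported Xp f /\ Phi f = f'.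

Definition delta_at (t : T) : fT := [ffun s => (s == t)%:R].

Lemma supported_delta (P : pred T) t : P t -> supported P (delta_at t).
Proof. by move=> Pt s nPs; rewrite ffunE; case: eqP Pt nPs => // -> ->. Qed.

Lemma Phi_inj f f' : supported Xp f -> supported Xp f' -> Phi f = Phi f' -> f = f'.
Proof.
move=> Sf Sf' e; have S : supported Xp [ffun t => -1 * f t + f' t].
  by move=> t nt; rewrite ffunE Sf // Sf' // mulr0 addr0.
have /ffunP d0 : [ffun t => -1 * f t + f' t] = 0 :> fT.
  apply: Phi_ker => //; rewrite PhiL // e.
  by apply/ffunP=> t; rewrite !ffunE mulN1r addNr.
by apply/ffunP=> t; have := d0 t; rewrite !ffunE mulN1r addrC => /eqP; rewrite subr_eq0 => /eqP.
Qed.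

Lemma Phi_expand f t' : supported Xp f -> Phi f t' = \sum_(t | Xp t) f t * Phi (delta_at t) t'.
Proof.
move=> Sf.
have Phi0 : Phi [ffun _ => 0] = [ffun _ => 0].
  have S0 : supported Xp ([ffun _ => 0] : fT) by move=> t _; rewrite ffunE.
  have := PhiL (-1) S0 S0.
  have -> : [ffun t : T => -1 * ([ffun _ => 0] : fT) t + ([ffun _ => 0] : fT) t] = [ffun _ => 0] :> fT.
    by apply/ffunP=> t; rewrite !ffunE mulr0 addr0.
  by move=> ->; apply/ffunP=> t; rewrite !ffunE mulN1r addNr.
have gen (s : seq T) : {in s, forall t, Xp t} ->
    supported Xp [ffun x => \sum_(t <- s) f t * delta_at t x] /\
    forall x, Phi [ffun x => \sum_(t <- s) f t * delta_at t x] x =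
       \sum_(t <- s) f t * Phi (delta_at t) x.
  elim: s => [_|t s IHs sP].
    split=> [x _|x]; first by rewrite ffunE big_nil.
    rewrite big_nil; have -> : [ffun x => \sum_(t <- [::]) f t * delta_at t x] = [ffun _ => 0] :> fT.
      by apply/ffunP=> y; rewrite !ffunE big_nil.
    by rewrite Phi0 ffunE.
  have [|Ss Es] := IHs; first by move=> y ys; apply: sP; rewrite inE ys orbT.
  have Xt : Xp t by apply: sP; rewrite inE eqxx.
  have -> : [ffun x => \sum_(y <- t :: s) f y * delta_at y x] =
     [ffun x => f t * delta_at t x + ([ffun x => \sum_(y <- s) f y * delta_at y x] : fT) x] :> fT.
    by apply/ffunP=> x; rewrite !ffunE big_cons ffunE.
  have St := supported_delta Xt.
  split=> [x nx|x]; first by rewrite ffunE Ss // St // mulr0 addr0.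
  by rewrite PhiL // ffunE Es big_cons.
have [|_ E] := gen (enum Xp); first by move=> t; rewrite mem_enum.
rewrite -big_enum /= -E; congr (Phi _ t'); apply/ffunP=> x; rewrite ffunE big_enum /=.
have [Xx|nx] := boolP (Xp x).
  rewrite (bigD1 x) //= big1 ?addr0 => [|y /andP[_ ne]]; rewrite ffunE ?eqxx ?mulr1 //.
  by rewrite eq_sym (negPf ne) mulr0.
rewrite Sf // big1 // => y Xy; rewrite ffunE; case: eqP => [xy|_]; last by rewrite mulr0.
by case/negP: nx; rewrite xy; exact: Xy.
Qed.

Lemma delta_act g t : delta_at (br_act g t) = br_gf g (delta_at t).
Proof.
by apply/ffunP=> s; rewrite !ffunE -{1}(br_actKV g s) (can_eq (br_actK g)).
Qed.

Lemma Phi_delta_act g t t' : g \in G -> Xp t ->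
  Phi (delta_at (br_act g t)) (br_act g t') = Phi (delta_at t) t'.
Proof.
by move=> gG Xt; rewrite delta_act PhiG ?ffunE ?br_actK //; apply: supported_delta.
Qed.

(* Hom_G(Phi, W) : Hom_G(Q[X_-], W) -> Hom_G(Q[X_+], W) *)
Definition dual_map (u : uT) : uT :=
  [ffun t => if Xp t then \sum_t' Phi (delta_at t) t' *: u t' else 0].

Lemma dual_map_scaled f (u : uT) : supported Xp f ->
  \sum_(t | Xp t) f t *: dual_map u t = \sum_t' Phi f t' *: u t'.
Proof.
move=> Sf; under eq_bigr => t Xt do rewrite ffunE Xt scaler_sumr.
rewrite exchange_big /=; apply: eq_bigr => t' _.
by rewrite Phi_expand // scaler_suml; apply: eq_bigr => t _; rewrite scalerA.
Qed.

Lemma sum_delta_scale (u : uT) t : \sum_s delta_at t s *: u s = u t.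
Proof.
rewrite (bigD1 t) //= big1 => [|s ne]; rewrite ffunE ?eqxx ?scale1r ?addr0 //.
by rewrite (negPf ne) scale0r.
Qed.

(** [dual_map] is precomposition with [Phi]: bijective because [Phi] is, and commuting with [alpha]
    because [alpha] acts on values. *)
Lemma det_on_dual d : det_on (equiv_fun G rho Xm) (apply_alpha alpha) d ->
  det_on (equiv_fun G rho Xp) (apply_alpha alpha) d.
Proof.
have /choice_on[inv invP] : forall t', exists f, Xm t' -> supported Xp f /\ Phi f = delta_at t'.
  move=> t'; have [X|nX] := boolP (Xm t'); last by exists 0.
  by have [f ?] := Phi_surj (supported_delta X); exists f.
apply: (det_on_iso (F := dual_map)).
- move=> x u v; apply/ffunP=> t; rewrite !ffunE; case: ifP => _; last by rewrite scaler0 addr0.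
  rewrite scaler_sumr -big_split; apply: eq_bigr => s _.
  by rewrite !ffunE scalerDr !scalerA mulrC.
- move=> u [uE uS]; split=> [g t gG|t /negPf nt]; last by rewrite ffunE nt.
  rewrite !ffunE br_in_act //; case: ifP => [Xt|_]; last by rewrite mul0mx.
  rewrite (reindex_inj (can_inj (br_actK g))) /= mulmx_suml; apply: eq_bigr => s _.
  by rewrite Phi_delta_act // uE // scalemxAl.
- move=> u [uE uS] u0; apply/ffunP=> t'; rewrite ffunE.
  have [X|/uS//] := boolP (Xm t'); have [Sf Pf] := invP _ X.
  rewrite -sum_delta_scale -Pf -dual_map_scaled // u0 big1 // => t _.
  by rewrite ffunE scaler0.
(* The preimage of [v] is its composite with the inverse of [Phi], whose value at the basis vector
   t' is [inv t']; injectivity of [Phi] makes [inv] equivariant. *)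
- move=> v [vE vS]; pose u : uT := [ffun t' => if Xm t' then \sum_(t | Xp t) inv t' t *: v t else 0].
  exists u.
    split=> [g t' gG|t' /negPf nX]; last by rewrite ffunE nX.
    rewrite !ffunE br_in_act //; case: ifP => [X|_]; last by rewrite mul0mx.
    have [Sf Pf] := invP _ X; have [|Sg Pg] := invP (br_act g t'); first by rewrite br_in_act.
    have Sgf : supported Xp (br_gf g (inv t')).
      by move=> t nt; rewrite ffunE Sf // br_in_act ?groupV.
    have invE : inv (br_act g t') = br_gf g (inv t').
      by apply: Phi_inj => //; rewrite Pg PhiG // Pf delta_act.
    rewrite (reindex_inj (can_inj (br_actK g))) /= mulmx_suml.
    apply: eq_big => [t|t Xt]; first by rewrite br_in_act.
    by rewrite invE ffunE br_actK vE // scalemxAl.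
  apply/ffunP=> t; rewrite ffunE; case: ifP => [Xt|/negbT/vS//].
  (* [k] is the inverse of [Phi] applied to [Phi (delta_at t)], written out in the basis of
     points. *)
  pose k : fT := [ffun s => \sum_(t' | Xm t') Phi (delta_at t) t' * inv t' s].
  have Sk : supported Xp k.
    by move=> s ns; rewrite ffunE big1 // => t' X; case: (invP _ X) => -> //; rewrite mulr0.
  have kE : k = delta_at t.
    apply: Phi_inj => //; first exact: supported_delta.
    apply/ffunP=> t'; rewrite Phi_expand //.
    transitivity (\sum_(s' | Xm s') Phi (delta_at t) s' * delta_at s' t').
      under eq_bigr => s _ do rewrite ffunE mulr_suml.
      rewrite exchange_big /=; apply: eq_bigr => s' X; have [Sf Pf] := invP _ X.
      rewrite -Pf [in RHS](Phi_expand t' Sf) mulr_sumr.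
      by apply: eq_bigr => s _; rewrite mulrA.
    have [X|nX] := boolP (Xm t'); last first.
      rewrite (PhiS (supported_delta Xt) nX) big1 // => s' X.
      by rewrite (supported_delta X nX) mulr0.
    rewrite (bigD1 t') //= big1 ?addr0 => [|s' /andP[_ ne]]; rewrite ffunE ?eqxx ?mulr1 //.
    by rewrite eq_sym (negPf ne) mulr0.
  transitivity (\sum_(s | Xp s) k s *: v s).
    rewrite kE -[LHS]sum_delta_scale [LHS](bigID Xp) /= [X in _ + X]big1 ?addr0 // => s ns.
    by rewrite vS // scaler0.
  under eq_bigr => s _ do rewrite ffunE scaler_suml.
  rewrite exchange_big /= [RHS](bigID Xm) /= [X in _ = _ + X]big1 ?addr0 => [|s /negPf ns]; last first.
    by rewrite ffunE ns scaler0.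
  apply: eq_bigr => t' X; rewrite ffunE X scaler_sumr.
  by apply: eq_bigr => s _; rewrite scalerA.
move=> u _; apply/ffunP=> t; rewrite !ffunE; case: ifP => _; last by rewrite mul0mx.
rewrite mulmx_suml; apply: eq_bigr => s _.
by rewrite ffunE scalemxAl.
Qed.

End BrauerIso.

Theorem brauer_det (gT : finGroupType) (G : {group gT}) (n : {group gT} -> int)
    (r : nat) (rho : gT -> 'M[rat]_r) (alpha : 'M[rat]_r) (d : {group gT} -> rat) :
  is_brauer G n -> rho 1%g = 1%:M ->
  (forall g h, g \in G -> h \in G -> rho (g * h)%g = rho h *m rho g) ->
  (forall g, g \in G -> rho g *m alpha = alpha *m rho g) ->
  (forall H : {group gT}, H \subset G -> d H != 0 /\ det_on (fixed_vec rho H) (mulmxr alpha) (d H)) ->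
  \prod_(H : {group gT} | H \subset G) d H ^ n H = 1.
Proof.
move=> [Phi [PhiL [PhiS [PhiG [Phi_ker Phi_surj]]]]] rho1 rhoM alphaC dP.
have dH (H : {group gT}) (sHG : H \subset G) := (dP H sHG).2.
have Em := det_on_br_in n rho1 rhoM alphaC false dH.
have Ep := det_on_br_in n rho1 rhoM alphaC true dH.
have prodE := det_on_uniq _ (det_on_dual PhiL PhiS PhiG Phi_ker Phi_surj Em) Ep.
have {}prodE : \prod_(H : {group gT} | (H \subset G) && (n H < 0)) d H ^+ absz (n H) =
    \prod_(H : {group gT} | (H \subset G) && (0 < n H)) d H ^+ absz (n H).
  apply: prodE => x u v _ _; apply/ffunP=> t; rewrite !ffunE mulmxDl.
  by rewrite scalemxAl.
have nz (P : pred {group gT}) :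
    \prod_(H : {group gT} | (H \subset G) && P H) d H ^+ absz (n H) != 0.
  by apply/prodf_neq0 => H /andP[sHG _]; rewrite expf_neq0 //; case: (dP H sHG).
transitivity (\prod_(H : {group gT} | H \subset G)
   ((if 0 < n H then d H ^+ absz (n H) else 1) / (if n H < 0 then d H ^+ absz (n H) else 1))).
  apply: eq_bigr => H _; case: (n H) => [[|k]|k] /=; rewrite ?expr0z ?invr1 ?mulr1 //.
  by rewrite mul1r NegzE exprnN.
by rewrite prodf_div -!big_mkcondr /= prodE divff.
Qed.

(** * Independence of the pairing *)

Lemma toQ_inj m n : injective (fun A : 'M[int]_(m, n) => toQ A).
Proof.
by move=> A B /matrixP e; apply/matrixP=> i j; have := e i j; rewrite !mxE => /intr_inj.
Qed.

Lemma clear_denominators m n (A : 'M[rat]_(m, n)) :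
  exists k : int, k != 0 /\ exists B : 'M[int]_(m, n), k%:~R *: A = toQ B.
Proof.
exists (\prod_i \prod_j denq (A i j)); split.
  by apply/prodf_neq0 => i _; apply/prodf_neq0 => j _; exact: denq_neq0.
exists (\matrix_(i, j) (numq (A i j) * \prod_(x | x != (i, j)) denq (A x.1 x.2))).
apply/matrixP=> i j; rewrite !mxE (pair_bigA _ (fun i j => denq (A i j))) /=.
by rewrite (bigD1 (i, j)) //= !rmorphM /= mulrAC numqE [_ * A i j]mulrC.
Qed.

(** * Torsion, fixed points and norms *)

Section Torsion.
Variables (gT : finGroupType) (G : {group gT}) (M : zgmod G).
Local Notation MT := (zg_car M).
Local Notation zact := (@zg_act _ _ M).

Lemma zact0 g : g \in G -> zact g 0 = 0.
Proof. by move=> gG; apply: (addrI (zact g 0)); rewrite -zg_actD // !addr0. Qed.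

Lemma zactN g x : g \in G -> zact g (- x) = - zact g x.
Proof. by move=> gG; apply: (addrI (zact g x)); rewrite -zg_actD // !subrr zact0. Qed.

Lemma zactB g x y : g \in G -> zact g (x - y) = zact g x - zact g y.
Proof. by move=> gG; rewrite zg_actD // zactN. Qed.

Lemma zact_sum g (I : Type) (s : seq I) (P : pred I) (F : I -> MT) : g \in G ->
  zact g (\sum_(i <- s | P i) F i) = \sum_(i <- s | P i) zact g (F i).
Proof.
by move=> gG; rewrite (big_morph (zact g) (fun x y => zg_actD x y gG) (zact0 gG)).
Qed.

Lemma zactMn g x k : g \in G -> zact g (x *+ k) = zact g x *+ k.
Proof. by move=> gG; elim: k => [|k IHk]; rewrite ?mulr0n ?zact0 // !mulrS zg_actD // IHk. Qed.

Lemma tors_subgrp : subgrp (@is_tors _ _ M).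
Proof.
split=> [|x y [k [k0 kx]] [l [l0 ly]]]; first by exists 1%N.
exists (k * l)%N; rewrite muln_gt0 k0; split=> //.
by rewrite mulrnBl mulrnA kx mul0rn mulnC mulrnA ly mul0rn subrr.
Qed.

Lemma tors0 : is_tors (0 : MT). Proof. exact: tors_subgrp.1. Qed.

Lemma tors_act g x : g \in G -> is_tors x -> is_tors (zact g x).
Proof. by move=> gG [k [k0 kx]]; exists k; rewrite -zactMn // kx zact0. Qed.

Lemma tors_sum (I : Type) (s : seq I) (P : pred I) (F : I -> MT) :
  (forall i, P i -> is_tors (F i)) -> is_tors (\sum_(i <- s | P i) F i).
Proof. by move=> FP; apply: big_ind => //; [exact: tors0 | move=> x y; apply: subgrpD tors_subgrp]. Qed.

Lemma fixed_subgrp (H : {group gT}) : H \subset G -> subgrp (fixed H (whole_mod M)).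
Proof.
move=> /subsetP sHG; split=> [|x y [_ hx] [_ hy]].
  by split=> // h /sHG; apply: zact0.
by split=> // h hH; rewrite zactB ?sHG // hx // hy.
Qed.

Lemma nrm_fixed (H : {group gT}) x : H \subset G -> fixed H (whole_mod M) (nrm H x).
Proof.
move=> /subsetP sHG; split=> // h hH; rewrite zact_sum ?sHG //.
rewrite [RHS](reindex_inj (mulgI h)) /=; apply: eq_big => [g|g gH].
  by rewrite groupMl.
by rewrite zg_actM ?sHG.
Qed.

Lemma nrmD (H : {group gT}) x y : H \subset G -> nrm H (x + y : MT) = nrm H x + nrm H y.
Proof.
move=> /subsetP sHG; rewrite /nrm -big_split; apply: eq_bigr => h hH.
by rewrite zg_actD ?sHG.
Qed.

Lemma nrmB (H : {group gT}) x y : H \subset G -> nrm H (x - y : MT) = nrm H x - nrm H y.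
Proof.
move=> /subsetP sHG; rewrite /nrm -sumrB; apply: eq_bigr => h hH.
by rewrite zactB ?sHG.
Qed.

Lemma nrm_of_fixed (H : {group gT}) x : fixed H (whole_mod M) x -> nrm H x = x *+ #|H|.
Proof. by move=> [_ hx]; rewrite -sumr_const; apply: eq_bigr. Qed.

End Torsion.

(** * Coordinates of M modulo torsion *)

Section Coordinates.
Variables (gT : finGroupType) (G : {group gT}) (M : zgmod G).
Local Notation MT := (zg_car M).
Local Notation zact := (@zg_act _ _ M).

Definition comb r (b : 'I_r -> MT) (c : 'rV[int]_r) : MT := \sum_(i < r) b i *~ c ord0 i.

Lemma combB r (b : 'I_r -> MT) c c' : comb b (c - c') = comb b c - comb b c'.
Proof. by rewrite /comb -sumrB; apply: eq_bigr => i _; rewrite !mxE mulrzBr. Qed.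

Lemma comb0 r (b : 'I_r -> MT) : comb b 0 = 0.
Proof. by rewrite /comb big1 // => i _; rewrite mxE mulr0z. Qed.

Lemma comb_delta r (b : 'I_r -> MT) i : comb b (delta_mx ord0 i) = b i.
Proof.
rewrite /comb (bigD1 i) //= big1 => [|j ne]; rewrite mxE eqxx ?eqxx ?mulr1z ?addr0 //=.
by rewrite (negPf ne) mulr0z.
Qed.

Lemma tf_basis_span (H : {group gT}) r (b : 'I_r -> MT) x :
  is_tf_basis H (whole_mod M) b -> fixed H (whole_mod M) x ->
  exists c : 'rV[int]_r, is_tors (x - comb b c).
Proof.
move=> [_ [bC _]] /bC[c cP]; exists (\row_i c i).
by rewrite /comb (eq_bigr (fun i => b i *~ c i)) // => i _; rewrite mxE.
Qed.

Lemma tf_basis_indep (H : {group gT}) r (b : 'I_r -> MT) (c : 'rV[int]_r) :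
  is_tf_basis H (whole_mod M) b -> is_tors (comb b c) -> c = 0.
Proof. by move=> [_ [_ bI]] /bI c0; apply/rowP=> i; rewrite c0 mxE. Qed.

Lemma fixed1 x : fixed 1%G (whole_mod M) x.
Proof. by split=> // h /set1P->; apply: zg_act1. Qed.

Variables (r : nat) (b : 'I_r -> MT).
Hypothesis bP : is_tf_basis 1%G (whole_mod M) b.
Variable kappa : MT -> 'rV[int]_r.
Hypothesis kappaP : forall x, is_tors (x - comb b (kappa x)).

(** [kappa] is merely a choice of coordinates; their uniqueness is what makes it additive,
    equivariant and zero exactly on torsion. *)
Lemma kappa_uniq x c : is_tors (x - comb b c) -> kappa x = c.
Proof.
move=> tx; apply/eqP; rewrite -subr_eq0; apply/eqP/(tf_basis_indep bP); rewrite combB.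
have -> : comb b (kappa x) - comb b c = (x - comb b c) - (x - comb b (kappa x)).
  by rewrite opprB [RHS]addrC addrA subrK.
exact: (tors_subgrp M).2.
Qed.

Lemma kappaB x y : kappa (x - y) = kappa x - kappa y.
Proof.
apply: kappa_uniq; rewrite combB.
have -> : x - y - (comb b (kappa x) - comb b (kappa y)) =
   (x - comb b (kappa x)) - (y - comb b (kappa y)) by rewrite !opprB addrACA [RHS]addrACA; congr (_ + _); rewrite addrC.
exact: (tors_subgrp M).2.
Qed.

Lemma kappa_comb c : kappa (comb b c) = c.
Proof. by apply: kappa_uniq; rewrite subrr; apply: tors0. Qed.

Lemma kappa_basis i : kappa (b i) = delta_mx ord0 i.
Proof. by rewrite -comb_delta kappa_comb. Qed.

Lemma kappa_tors x : kappa x = 0 <-> is_tors x.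
Proof.
split=> [e|tx]; first by have := kappaP x; rewrite e comb0 subr0.
by apply: kappa_uniq; rewrite comb0 subr0.
Qed.

Lemma kappa_zero : kappa 0 = 0. Proof. by apply/kappa_tors/tors0. Qed.

Lemma kappaN x : kappa (- x) = - kappa x.
Proof. by rewrite -sub0r kappaB kappa_zero sub0r. Qed.

Lemma kappaD x y : kappa (x + y) = kappa x + kappa y.
Proof. by rewrite -[y in LHS]opprK kappaB kappaN opprK. Qed.

Lemma kappa_sum (I : Type) (s : seq I) (P : pred I) (F : I -> MT) :
  kappa (\sum_(i <- s | P i) F i) = \sum_(i <- s | P i) kappa (F i).
Proof. by rewrite (big_morph kappa kappaD kappa_zero). Qed.

Lemma kappaMn x k : kappa (x *+ k) = kappa x *+ k.
Proof. by elim: k => [|k IHk]; rewrite ?mulr0n ?kappa_zero // !mulrS kappaD IHk. Qed.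

Lemma kappaMz x (k : int) : kappa (x *~ k) = k *: kappa x.
Proof.
apply/rowP=> j; rewrite mxE (@additive_intMz _ (fun x => kappa x ord0 j)) 1?mulrC //.
by move=> y z; rewrite kappaD mxE.
Qed.

Lemma kappa_eq x y : kappa x = kappa y <-> is_tors (x - y).
Proof.
split=> [e|/kappa_tors]; first by apply/kappa_tors; rewrite kappaB e subrr.
by rewrite kappaB => /eqP; rewrite subr_eq0 => /eqP.
Qed.

Lemma kappa_comb_gen s (b' : 'I_s -> MT) c :
  kappa (comb b' c) = c *m (\matrix_i kappa (b' i)).
Proof.
rewrite /comb kappa_sum mulmx_sum_row; apply: eq_bigr => i _.
by rewrite kappaMz rowK.
Qed.

Definition act_mx (g : gT) : 'M[int]_r := \matrix_i kappa (zact g (b i)).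

Lemma kappa_act g x : g \in G -> kappa (zact g x) = kappa x *m act_mx g.
Proof.
move=> gG; transitivity (kappa (zact g (comb b (kappa x)))).
  by apply/kappa_eq; rewrite -zactB //; apply: tors_act.
rewrite /comb zact_sum // -kappa_comb_gen /comb; congr kappa; apply: eq_bigr => i _.
case: (kappa x ord0 i) => k; first by rewrite -!pmulrn zactMn.
by rewrite NegzE !mulrNz -!pmulrn zactN // zactMn.
Qed.

Lemma act_mx1 : act_mx 1%g = 1%:M.
Proof. by apply/row_matrixP=> i; rewrite rowK zg_act1 kappa_basis rowE mulmx1. Qed.

Lemma act_mxM g h : g \in G -> h \in G -> act_mx (g * h)%g = act_mx h *m act_mx g.
Proof.
move=> gG hG; apply/row_matrixP=> i; rewrite row_mul !rowK zg_actM //.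
by rewrite kappa_act.
Qed.

Lemma kappa_nrm (H : {group gT}) x : H \subset G ->
  (forall h, h \in H -> kappa (zact h x) = kappa x) -> kappa (nrm H x) = kappa x *+ #|H|.
Proof.
by move=> sHG hx; rewrite /nrm kappa_sum -sumr_const; apply: eq_bigr.
Qed.

End Coordinates.

Lemma exists_kappa (gT : finGroupType) (G : {group gT}) (M : zgmod G) r (b : 'I_r -> zg_car M) :
  is_tf_basis 1%G (whole_mod M) b ->
  exists kappa : zg_car M -> 'rV[int]_r, forall x, is_tors (x - comb b (kappa x)).
Proof.
move=> bP; apply: (@choice_on _ _ (fun x c => is_tors (x - comb b c))) => x.
exact: tf_basis_span bP (fixed1 x).
Qed.

(** * Gram determinants and change of basis *)

Section RegulatorDet.
Variables (gT : finGroupType) (G : {group gT}) (M : zgmod G).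
Local Notation MT := (zg_car M).
Local Notation zact := (@zg_act _ _ M).

Definition lattice_det (H : {group gT}) (p : MT -> MT -> rat) r (b : 'I_r -> MT) : rat :=
  \det (\matrix_(i < r, j < r) (p (b i) (b j) / #|H|%:R)).

Variables (r : nat) (b : 'I_r -> MT).
Hypothesis bP : is_tf_basis 1%G (whole_mod M) b.
Variable kappa : MT -> 'rV[int]_r.
Hypothesis kappaP : forall x, is_tors (x - comb b (kappa x)).

Local Notation rho := (act_mx b kappa).
Local Notation rhoQ := (fun g => toQ (rho g)).

Lemma additive_rat (f : MT -> rat) x : (forall x y, f (x + y) = f x + f y) ->
  f x = \sum_i (kappa x ord0 i)%:~R * f (b i).
Proof.
move=> fD; have f0 : f 0 = 0 by apply: (addrI (f 0)); rewrite -fD !addr0.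
have fMn y k : f (y *+ k) = f y *+ k.
  by elim: k => [|k IHk]; rewrite ?mulr0n // !mulrS fD IHk.
have fN y : f (- y) = - f y by apply: (addrI (f y)); rewrite -fD !subrr.
have ft y : is_tors y -> f y = 0.
  move=> [[|k] [// _ ky]]; have := fMn y k.+1; rewrite ky f0 => /esym/eqP.
  by rewrite mulrn_eq0 => /eqP.
have -> : f x = f (comb b (kappa x)).
  by rewrite -{1}(subrK (comb b (kappa x)) x) fD ft ?add0r.
rewrite /comb (big_morph f fD f0); apply: eq_bigr => i _.
case: (kappa x ord0 i) => k; first by rewrite -!pmulrn fMn mulr_natl.
by rewrite NegzE !mulrNz -!pmulrn fN fMn mulNr mulr_natl.
Qed.

Definition gram (p : MT -> MT -> rat) s (u : 'I_s -> MT) : 'M[rat]_s :=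
  \matrix_(i, j) p (u i) (u j).

Lemma lattice_detE H p s (u : 'I_s -> MT) :
  lattice_det H p u = \det (gram p u) / #|H|%:R ^+ s.
Proof.
have -> : \det (gram p u) / #|H|%:R ^+ s = #|H|%:R^-1 ^+ s * \det (gram p u).
  by rewrite exprVn mulrC.
by rewrite -detZ; congr (\det _); apply/matrixP=> i j; rewrite !mxE mulrC.
Qed.

Definition coord_mx s (u : 'I_s -> MT) : 'M[rat]_(s, r) := \matrix_i toQ (kappa (u i)).

Lemma pairing_gram p x y : good_pairing (whole_mod M) p ->
  p x y = (toQ (kappa x) *m gram p b *m (toQ (kappa y))^T) ord0 ord0.
Proof.
move=> [pD _]; rewrite (@additive_rat (fun x => p x y) x); last first.
  by move=> u v; case: (pD u v y).
rewrite -mulmxA mxE; apply: eq_bigr => i _; rewrite mxE; congr (_ * _).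
rewrite (@additive_rat (fun y => p (b i) y) y); last by move=> u v; case: (pD (b i) u v).
by rewrite mxE; apply: eq_bigr => j _; rewrite !mxE mulrC.
Qed.

Lemma gram_coord p s (u : 'I_s -> MT) : good_pairing (whole_mod M) p ->
  gram p u = coord_mx u *m gram p b *m (coord_mx u)^T.
Proof.
move=> pP; apply/matrixP=> i j; rewrite mxE (pairing_gram _ _ pP).
rewrite !mxE; apply: eq_bigr => k _.
rewrite !mxE; congr (_ * _); apply: eq_bigr => l _.
by rewrite !mxE.
Qed.

(** A kernel vector with its denominators cleared is an element of M orthogonal to everything, hence
    torsion by non-degeneracy. *)
Lemma gram_unit p : good_pairing (whole_mod M) p -> gram p b \in unitmx.
Proof.
move=> pP; rewrite -row_free_unit; apply: inj_row_free => v v0.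
have [k [k0 [c cE]]] := clear_denominators v.
have c0 : c = 0.
  have [_ [_ [nd _]]] := pP.
  have [//|nt] := classic (c = 0).
  have [|y [_ /eqP[]]] := nd (comb b c) Logic.I; first by move=> /(tf_basis_indep bP).
  rewrite (pairing_gram _ _ pP) (kappa_comb bP kappaP) -cE -!scalemxAl v0.
  by rewrite mul0mx scaler0 mxE.
by move/eqP: cE; rewrite c0 map_mx0 scaler_eq0 intr_eq0 (negPf k0) => /eqP.
Qed.

Lemma coord_mxE s (u : 'I_s -> MT) : coord_mx u = toQ (\matrix_i kappa (u i)).
Proof. by apply/matrixP=> i j; rewrite !mxE. Qed.

Lemma act_mx_unit g : g \in G -> rhoQ g \in unitmx.
Proof.
move=> gG; have : rho g *m rho g^-1%g = 1%:M.
  by rewrite -(act_mxM bP kappaP) ?groupV // mulVg (act_mx1 bP kappaP).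
by move/(congr1 (fun A => toQ A)); rewrite map_mxM map_mx1 => /mulmx1_unit[].
Qed.

Lemma gram_invariant p g : good_pairing (whole_mod M) p -> g \in G ->
  rhoQ g *m gram p b *m (rhoQ g)^T = gram p b.
Proof.
move=> pP gG; have [_ [pG _]] := pP.
have -> : rhoQ g = coord_mx (fun i => zact g (b i)).
  by apply/matrixP=> i j; rewrite !mxE.
by rewrite -gram_coord //; apply/matrixP=> i j; rewrite !mxE pG.
Qed.

Lemma coord_mx_inj (H : {group gT}) s (u : 'I_s -> MT) (c : 'rV_s) :
  is_tf_basis H (whole_mod M) u -> c *m coord_mx u = 0 -> c = 0.
Proof.
move=> uP c0; have [k [k0 [e eE]]] := clear_denominators c.
have e0 : e = 0.
  apply: (tf_basis_indep uP); apply/(kappa_tors bP kappaP).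
  apply: toQ_inj; rewrite (kappa_comb_gen bP kappaP) map_mx0 map_mxM -eE.
  by rewrite -coord_mxE -scalemxAl c0 scaler0.
by move/eqP: eE; rewrite e0 map_mx0 scaler_eq0 intr_eq0 (negPf k0) => /eqP.
Qed.

Lemma coord_mx_row_free (H : {group gT}) s (u : 'I_s -> MT) :
  is_tf_basis H (whole_mod M) u -> row_free (coord_mx u).
Proof. by move=> uP; apply: inj_row_free => v; apply: coord_mx_inj uP. Qed.

(** A vector fixed in M_tf need not lift to a fixed element of M, but the norm of a lift is fixed
    and has |H| times its coordinates. Rationally, M^H therefore spans all of W^H. *)
Lemma fixed_vecP (H : {group gT}) s (u : 'I_s -> MT) (v : 'rV_r) : H \subset G ->
  is_tf_basis H (whole_mod M) u ->
  (fixed_vec rhoQ H v <-> exists c, v = c *m coord_mx u).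
Proof.
move=> sHG uP; split=> [vH|[c ->] h hH]; last first.
  rewrite -mulmxA; congr (_ *m _); apply/row_matrixP=> i; rewrite row_mul !rowK -map_mxM.
  rewrite -(kappa_act bP kappaP) ?(subsetP sHG) //.
  by have [uH _] := uP; case: (uH i) => _ ->.
have [k [k0 [e eE]]] := clear_denominators v.
pose x := comb b e; have xH h : h \in H -> kappa (zact h x) = kappa x.
  move=> hH; rewrite (kappa_act bP kappaP) ?(subsetP sHG) // (kappa_comb bP kappaP).
  by apply: toQ_inj; rewrite map_mxM -eE -scalemxAl vH.
have [c cP] := tf_basis_span uP (nrm_fixed x sHG).
have := kappa_nrm bP kappaP sHG xH; rewrite (kappa_comb bP kappaP).
have /(kappa_eq bP kappaP)-> := cP.
rewrite (kappa_comb_gen bP kappaP) => /(congr1 (fun A => toQ A)).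
rewrite map_mxM raddfMn /= -eE => cE.
exists ((#|H|%:R * k%:~R)^-1 *: toQ c).
rewrite coord_mxE -scalemxAl cE -scaler_nat [X in _ *: X]scalerA scalerA mulVf ?scale1r //.
by rewrite mulf_neq0 ?intr_eq0 // pnatr_eq0 -lt0n cardG_gt0.
Qed.

(** The base change between the two bases is integral with integral inverse, so its determinant is 1
    or -1, and it enters the Gram determinant squared. *)
Lemma gram_change (H : {group gT}) p s (u : 'I_s -> MT) s' (u' : 'I_s' -> MT) :
  H \subset G -> good_pairing (whole_mod M) p ->
  is_tf_basis H (whole_mod M) u -> is_tf_basis H (whole_mod M) u' ->
  s = s' /\ \det (gram p u) = \det (gram p u').
Proof.
move=> sHG pP uP u'P.
have change t (v : 'I_t -> MT) t' (v' : 'I_t' -> MT) :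
    is_tf_basis H (whole_mod M) v -> is_tf_basis H (whole_mod M) v' ->
    exists E : 'M[int]_(t, t'), coord_mx v = toQ E *m coord_mx v'.
  move=> vP v'P; have /choice_on[E EP] : forall i, exists c, is_tors (v i - comb v' c).
    by move=> i; apply: tf_basis_span v'P _; case: vP.
  exists (\matrix_i E i); rewrite !coord_mxE -map_mxM; congr map_mx.
  apply/row_matrixP=> i; rewrite row_mul !rowK -(kappa_comb_gen bP kappaP).
  exact/(kappa_eq bP kappaP)/EP.
have [E EP] := change _ _ _ _ uP u'P; have [E' E'P] := change _ _ _ _ u'P uP.
have inv1 t (v : 'I_t -> MT) (F : 'M[int]_t) : is_tf_basis H (whole_mod M) v ->
    coord_mx v = toQ F *m coord_mx v -> F = 1%:M.
  move=> vP e; apply: toQ_inj; rewrite map_mx1; apply: (row_free_inj (coord_mx_row_free vP)).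
  by rewrite -e mul1mx.
have EE' : E *m E' = 1%:M by apply: (inv1 _ u) => //; rewrite map_mxM -mulmxA -E'P.
have E'E : E' *m E = 1%:M by apply: (inv1 _ u') => //; rewrite map_mxM -mulmxA -EP.
have eqs : s = s' by apply/eqP; rewrite eqn_leq (mulmx1_min EE') (mulmx1_min E'E).
split=> //; case: s' / eqs in u' u'P E EP E' E'P EE' E'E *.
have -> : gram p u = toQ E *m gram p u' *m (toQ E)^T.
  rewrite (gram_coord u pP) (gram_coord u' pP) EP trmx_mul !mulmxA.
  by [].
have [uE _] := mulmx1_unit EE'.
have detE : \det (toQ E) ^+ 2 = 1.
  rewrite det_map_mx -rmorphXn /=; move: uE; rewrite unitmxE unfold_in /=.
  by case/orP=> /eqP ->.
by rewrite det_mulmx det_mulmx det_tr mulrC mulrA -expr2 detE mul1r.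
Qed.

End RegulatorDet.

Lemma regulator_ratio (gT : finGroupType) (G : {group gT}) (n : {group gT} -> int) (M : zgmod G)
    (p p' : zg_car M -> zg_car M -> rat)
    (r r' : {group gT} -> nat) (b : forall H : {group gT}, 'I_(r H) -> zg_car M)
    (b' : forall H : {group gT}, 'I_(r' H) -> zg_car M) :
  is_brauer G n -> good_pairing (whole_mod M) p -> good_pairing (whole_mod M) p' ->
  (forall H : {group gT}, H \subset G -> is_tf_basis H (whole_mod M) (b H)) ->
  (forall H : {group gT}, H \subset G -> is_tf_basis H (whole_mod M) (b' H)) ->
  \prod_(H : {group gT} | H \subset G) lattice_det H p (b H) ^ n H =
  \prod_(H : {group gT} | H \subset G) lattice_det H p' (b' H) ^ n H.
Proof.
move=> br pP p'P bP b'P.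
have b1P := bP 1%G (sub1G G); have [kappa kappaP] := exists_kappa b1P.
pose rho := act_mx (b 1%G) kappa; pose rhoQ g := toQ (rho g).
pose P := gram p (b 1%G); pose P' := gram p' (b 1%G).
have uP : P \in unitmx := gram_unit b1P kappaP pP.
have uP' : P' \in unitmx := gram_unit b1P kappaP p'P.
(* [alpha] turns the first form into the second; since both are G-invariant, it commutes with the
   action. *)
pose alpha := P' *m invmx P.
have ualpha : alpha \in unitmx by rewrite unitmx_mul uP' unitmx_inv.
have alphaP : alpha *m P = P' by rewrite mulmxKV.
have alphaC g : g \in G -> rhoQ g *m alpha = alpha *m rhoQ g.
  move=> gG; have ur : (rhoQ g)^T \in unitmx by rewrite unitmx_tr act_mx_unit.
  have e : rhoQ g *m P *m (rhoQ g)^T = P := gram_invariant kappaP pP gG.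
  have e' : rhoQ g *m P' *m (rhoQ g)^T = P' := gram_invariant kappaP p'P gG.
  apply: (can_inj (mulmxK uP)); apply: (can_inj (mulmxK ur)).
  transitivity (rhoQ g *m (alpha *m P) *m (rhoQ g)^T); first by rewrite !mulmxA.
  transitivity (alpha *m (rhoQ g *m P *m (rhoQ g)^T)); last by rewrite !mulmxA.
  by rewrite alphaP e e' alphaP.
have /choice_on[d dP] : forall H : {group gT}, exists d : rat, H \subset G ->
    [/\ d != 0, det_on (fixed_vec rhoQ H) (mulmxr alpha) d &
      lattice_det H p' (b' H) = d * lattice_det H p (b H)].
  move=> H; have [sHG|_] := boolP (H \subset G); last by exists 0.
  have uH := bP H sHG; set U := coord_mx kappa (b H).
  have UE := fixed_vecP b1P kappaP _ sHG uH; rewrite -/rho -/rhoQ -/U in UE.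
  have /choice_on[A AP] : forall i, exists c, row i U *m alpha = c *m U.
    move=> i; apply/UE => h hH; rewrite -mulmxA -alphaC ?(subsetP sHG) // mulmxA.
    congr (_ *m _); move: h hH; apply/UE; exists (delta_mx ord0 i); exact: rowE.
  pose MA := \matrix_i A i.
  have AU : U *m alpha = MA *m U.
    by apply/row_matrixP=> i; rewrite !row_mul AP [row i MA]rowK.
  have uA : MA \in unitmx.
    rewrite -row_free_unit; apply: inj_row_free => v v0.
    apply: (coord_mx_inj b1P kappaP uH); rewrite -/U.
    by apply: (can_inj (mulmxK ualpha)); rewrite -mulmxA AU mulmxA v0 !mul0mx.
  exists (\det MA) => _; split; first by rewrite -unitfE -unitmxE.
    exists (r H), (fun i => row i U), MA; split=> //.
    - move=> c c0; apply: (coord_mx_inj b1P kappaP uH).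
      by rewrite -/U -[RHS]c0 mulmx_sum_row.
    - move=> v; split=> [/UE[c ->]|[c ->]]; first by exists c; rewrite mulmx_sum_row.
      by apply/UE; exists c; rewrite mulmx_sum_row.
    by move=> i; rewrite /= AP -[RHS]mulmx_sum_row rowK.
  (* With U the coordinates of the basis of M^H, U P' U^T = U alpha P U^T = MA (U P U^T): the two
     Gram determinants differ by the determinant of [alpha] on W^H. *)
  have gE : gram p' (b H) = MA *m gram p (b H).
    rewrite (gram_coord kappaP (b H) p'P) (gram_coord kappaP (b H) pP) -/U -/P -/P'.
    by rewrite -alphaP mulmxA AU -!mulmxA.
  have [eqr eqd] := gram_change b1P kappaP sHG p'P uH (b'P H sHG).
  rewrite [LHS]lattice_detE -eqd gE det_mulmx [in RHS]lattice_detE -eqr.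
  by rewrite mulrA.
have rho1 : rhoQ 1%g = 1%:M by rewrite /rhoQ /rho (act_mx1 b1P kappaP) map_mx1.
have rhoM g h : g \in G -> h \in G -> rhoQ (g * h)%g = rhoQ h *m rhoQ g.
  by move=> gG hG; rewrite -map_mxM -(act_mxM b1P kappaP).
have prodd := brauer_det br rho1 rhoM alphaC (fun H sHG => let: And3 nz D _ := dP H sHG in conj nz D).
transitivity ((\prod_(H : {group gT} | H \subset G) d H ^ n H) *
    \prod_(H : {group gT} | H \subset G) lattice_det H p (b H) ^ n H).
  by rewrite prodd mul1r.
rewrite -big_split; apply: eq_bigr => H sHG /=.
by have [_ _ ->] := dP H sHG; rewrite expfzMl.
Qed.

Section Regconst.
Variables (gT : finGroupType) (G : {group gT}) (n : {group gT} -> int) (M : zgmod G).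
Local Notation MT := (zg_car M).

Definition tors_card (H : {group gT}) (S : MT -> Prop) : nat :=
  card_prop (fun x => fixed H S x /\ is_tors x).

(** [regconst] uses an unspecified pairing and unspecified bases; by the independence just proved,
    any convenient ones compute it. *)
Lemma regconst_whole p (r : {group gT} -> nat) (b : forall H : {group gT}, 'I_(r H) -> MT) :
  is_brauer G n -> good_pairing (whole_mod M) p ->
  (forall H : {group gT}, H \subset G -> is_tf_basis H (whole_mod M) (b H)) ->
  regconst n (whole_mod M) =
    thprod G n (fun H => (tors_card H (whole_mod M))%:R ^- 2) *
    thprod G n (fun H => lattice_det H p (b H)).
Proof.
move=> br pP bP.
have : exists c, is_regconst n (whole_mod M) c by eexists; exists p; split=> //; exists r, b.
move=> /(epsilon_spec (inhabits 0)) [p' [p'P [r' [b' [b'P e]]]]].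
rewrite /regconst e /thprod (regulator_ratio br pP p'P bP b'P) -big_split.
by apply: eq_bigr => H _; rewrite /= -expfzMl.
Qed.

(** On a torsion module the zero pairing is admissible and every basis is empty, so all determinants
    are 1 and only the orders of fixed points remain. *)
Lemma regconst_tors (S : MT -> Prop) : S 0 -> (forall x, S x -> is_tors x) ->
  regconst n S = thprod G n (fun H => (tors_card H S)%:R ^- 2).
Proof.
move=> S0 St.
have basis0 H (u : 'I_0 -> MT) : is_tf_basis H S u.
  split; [by case | split=> [x [Sx _]|c _ []//]].
  by exists (fun _ => 0); rewrite big_ord0 subr0; apply: St.
have : exists c, is_regconst n S c.
  eexists; exists (fun _ _ => 0); split.
    split=> [x y z _ _ _|]; first by rewrite addr0.
    by split=> //; split=> [x /St|y /St].
  by exists (fun _ => 0%N), (fun _ _ => 0).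
move=> /(epsilon_spec (inhabits 0)) [p [_ [r [b [bP e]]]]].
rewrite /regconst e; apply: eq_bigr => H sHG; congr (_ ^ _); rewrite /reg_term -/(tors_card H S).
move: (bP H sHG); case: (r H) (b H) => [|k] u uP; first by rewrite det_mx00 mulr1.
have [uS [_ uI]] := uP; have /uI/(_ ord0) : is_tors (\sum_(i < k.+1) u i *~ (fun _ => 1) i).
  by apply: tors_sum => i _; rewrite mulr1z; apply: St; case: (uS i).
by [].
Qed.

End Regconst.

(** * Permutation modules and the dual lattice *)

Section PermutationModule.
Variables (gT : finGroupType) (G : {group gT}) (X : finType) (to : action G X).
Local Notation ZX := {ffun X -> int}.

Definition perm_act (g : gT) (a : ZX) : ZX := [ffun y => a (to y g)].

Definition dot (a a' : ZX) : int := \sum_y a y * a' y.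

Lemma dotDl a a' c : dot (a + a') c = dot a c + dot a' c.
Proof. by rewrite /dot -big_split; apply: eq_bigr => y _; rewrite ffunE mulrDl. Qed.

Lemma dotC a c : dot a c = dot c a.
Proof. by apply: eq_bigr => y _; rewrite mulrC. Qed.

Lemma dotDr a a' c : dot c (a + a') = dot c a + dot c a'.
Proof. by rewrite dotC dotDl !(dotC c). Qed.

Lemma dot_act g a c : dot (perm_act g a) (perm_act g c) = dot a c.
Proof.
rewrite [RHS](reindex_inj (act_inj to g)); apply: eq_bigr => y _.
by rewrite !ffunE.
Qed.

Lemma dot_eq0 a : dot a a = 0 -> a = 0.
Proof.
move=> /eqP; rewrite psumr_eq0 => [/allP a0|y _]; last by rewrite -expr2 sqr_ge0.
apply/ffunP=> y; rewrite ffunE; have := a0 y (mem_index_enum y).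
by rewrite mulf_eq0 orbb => /eqP.
Qed.

(* Shapiro's lemma: a cocycle restricted to a point stabiliser is a homomorphism
   from a finite group to Z, hence trivial. *)
Lemma perm_H1 (H : {group gT}) (f : gT -> ZX) : H \subset G ->
  (forall g h, g \in H -> h \in H -> f (g * h)%g = f g + perm_act g (f h)) ->
  exists a, forall h, h \in H -> f h = perm_act h a - a.
Proof.
move=> sHG fM; have HG h : h \in H -> h \in G by apply: (subsetP sHG).
have toM y g h : g \in H -> h \in H -> to y (g * h)%g = to (to y g) h.
  by move=> /HG gG /HG hG; rewrite actMin.
have fME g h y : g \in H -> h \in H -> f (g * h)%g y = f g y + f h (to y g).
  by move=> gH hH; rewrite fM // !ffunE.
have f1 y : f 1%g y = 0.
  by apply: (addrI (f 1%g y)); rewrite -{2}(act1 to y) -fME ?group1 // mulg1 addr0.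
have stab s y : s \in H -> to y s = y -> f s y = 0.
  move=> sH sy; have pow k : f (s ^+ k)%g y = f s y *+ k.
    elim: k => [|k IHk]; first by rewrite expg0 f1.
    by rewrite expgS fME ?groupX // sy IHk mulrS.
  have := pow #[s]%g; rewrite expg_order f1 => /esym/eqP.
  by rewrite mulrn_eq0 eqn0Ngt order_gt0 => /eqP.
have coset k k' y : k \in H -> k' \in H -> to y k = to y k' -> f k y = f k' y.
  move=> kH k'H e; pose s := (k * k'^-1)%g; have sH : s \in H by rewrite groupM ?groupV.
  have sy : to y s = y by rewrite toM ?groupV // e -toM ?groupV // mulgV act1.
  have -> : k = (s * k')%g by rewrite mulgKV.
  by rewrite fME // sy stab // add0r.
(* [pick] depends only on the orbit, which makes [rep] constant on orbits; the default [y] is never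
   reached, orbits being non-empty. *)
pose rep y := odflt y [pick z in orbit to H y].
have repP y : rep y \in orbit to H y.
  by rewrite /rep; case: pickP => //= _; exact: orbit_refl.
have rep_eq y h : h \in H -> rep (to y h) = rep y.
  move=> hH; have e : orbit to H (to y h) = orbit to H y.
    by apply/(orbit_in_eqP sHG); rewrite mem_orbit.
  rewrite /rep e; case: pickP => // none.
  by have := none y; rewrite orbit_refl.
have /choice_on[k kP] : forall y, exists g, g \in H /\ to (rep y) g = y.
  move=> y; have : y \in orbit to H (rep y) by rewrite (orbit_in_sym to sHG).
  by case/orbitP=> g gH e; exists g.
(* The relation f h y = a (y h) - a y, solved outward from a = 0 at the orbit representatives. *)
exists [ffun y => f (k y) (rep y)] => h hH; apply/ffunP=> y; rewrite !ffunE.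
have [kH ky] := kP y; have [k'H k'y] := kP (to y h).
rewrite rep_eq // in k'y *; rewrite (coset (k (to y h)) (k y * h)%g) ?groupM //.
  by rewrite fME // ky addrC addKr.
by rewrite k'y toM // ky.
Qed.

End PermutationModule.

Section LatticePairing.
Variables (gT : finGroupType) (G : {group gT}) (M : zgmod G).
Variables (X : finType) (to : action G X).
Local Notation MT := (zg_car M).
Local Notation zact := (@zg_act _ _ M).
Variable phi : MT -> {ffun X -> int}.
Hypothesis phiD : forall x y, phi (x + y) = phi x + phi y.
Hypothesis phiG : forall g x, g \in G -> phi (zact g x) = perm_act to g (phi x).
Hypothesis phi_tors : forall x, is_tors x <-> phi x = 0.

Definition pull_dot (x y : MT) : int := dot (phi x) (phi y).
Definition pull_dotQ (x y : MT) : rat := (pull_dot x y)%:~R.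

Lemma phi0 : phi 0 = 0. Proof. by apply: (addrI (phi 0)); rewrite -phiD !addr0. Qed.

Lemma phiN x : phi (- x) = - phi x.
Proof. by apply: (addrI (phi x)); rewrite -phiD !subrr phi0. Qed.

Lemma phiB x y : phi (x - y) = phi x - phi y. Proof. by rewrite phiD phiN. Qed.

Lemma pull_dot_good : good_pairing (whole_mod M) pull_dotQ.
Proof.
split; first by move=> x y z _ _ _; rewrite /pull_dotQ /pull_dot !phiD dotDl dotDr !rmorphD.
split; first by move=> g x y gG _ _; rewrite /pull_dotQ /pull_dot !phiG // dot_act.
have nd x : ~ is_tors x -> pull_dotQ x x != 0.
  by move=> nt; rewrite intr_eq0; apply: contra_notN nt => /eqP/dot_eq0/phi_tors.
by split=> x _ /nd nx; exists x.
Qed.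

(* Any subgroup has a finite basis modulo torsion because M_tf embeds into Z[X]. *)
Lemma tf_basis_exists (S : MT -> Prop) : subgrp S -> exists r (b : 'I_r -> MT),
  [/\ forall i, S (b i), forall x, S x -> exists c : 'I_r -> int, is_tors (x - \sum_(i < r) b i *~ c i) &
      forall c : 'I_r -> int, is_tors (\sum_(i < r) b i *~ c i) -> forall i, c i = 0].
Proof.
move=> sS; pose f k x := if insub k is Some i then phi x (enum_val (i : 'I_#|X|)) else 0.
have fD k : additive_int (f k).
  by move=> x y; rewrite /f; case: insub => [i|]; rewrite ?addr0 // phiD ffunE.
have fE x : is_tors x <-> forall k, (k < #|X|)%N -> f k x = 0.
  split=> [/phi_tors e k lt|f0]; first by rewrite /f insubT /= e ffunE.
  apply/phi_tors/ffunP=> y; rewrite ffunE; have := f0 (enum_rank y) (ltn_ord _).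
  by rewrite /f valK enum_rankK.
have [r [b [bS bC bI]]] := lattice_basis #|X| sS fD.
exists r, b; split=> // [x /bC[c cP]|c /fE /bI //].
by exists c; apply/fE.
Qed.

Lemma fixed_tf_basis (H : {group gT}) : H \subset G ->
  exists r (b : 'I_r -> MT), is_tf_basis H (whole_mod M) b.
Proof.
move=> sHG; have [r [b [bS bC bI]]] := tf_basis_exists (fixed_subgrp M sHG).
by exists r, b.
Qed.

End LatticePairing.

(** * The dual lattice and its invariants *)

Section DualLattice.
Variables (gT : finGroupType) (G : {group gT}) (M : zgmod G).
Variables (X : finType) (to : action G X).
Local Notation MT := (zg_car M).
Local Notation zact := (@zg_act _ _ M).
Variable phi : MT -> {ffun X -> int}.
Hypothesis phiD : forall x y, phi (x + y) = phi x + phi y.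
Hypothesis phiG : forall g x, g \in G -> phi (zact g x) = perm_act to g (phi x).
Hypothesis phi_tors : forall x, is_tors x <-> phi x = 0.
Variables (n : nat) (b : 'I_n -> MT).
Hypothesis bP : is_tf_basis 1%G (whole_mod M) b.
Variable kappa : MT -> 'rV[int]_n.
Hypothesis kappaP : forall x, is_tors (x - comb b (kappa x)).

Local Notation pd := (pull_dot phi).

Lemma pull_dotDl x y z : pd (x + y) z = pd x z + pd y z.
Proof. by rewrite /pull_dot phiD dotDl. Qed.

Lemma pull_dotC x y : pd x y = pd y x. Proof. exact: dotC. Qed.

Lemma additive_intE (f : MT -> int) x : additive_int f ->
  f x = \sum_i kappa x ord0 i * f (b i).
Proof.
move=> fD; apply: (@intr_inj rat).
rewrite (additive_rat kappaP (f := fun x => (f x)%:~R)) => [|u v]; last by rewrite fD rmorphD.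
by rewrite rmorph_sum /=; apply: eq_bigr => i _; rewrite rmorphM.
Qed.

(* Elements of the dual lattice Hom(M, Z) are coordinate vectors d with
   [ev d (b i) = d_i]; [lam] is the map M -> Hom(M, Z) induced by the form. *)
Definition ev (d : 'rV[int]_n) (x : MT) : int := (d *m (kappa x)^T) ord0 ord0.
Definition gramZ : 'M[int]_n := \matrix_(i, j) pd (b i) (b j).
Definition lam (x : MT) : 'rV[int]_n := kappa x *m gramZ.
(** The transpose of [phi], with Z[X] identified with its dual. It factors [lam] as [emb] after
    [phi], which is how Z[X] comes to control the map on H^1. *)
Definition emb (a : {ffun X -> int}) : 'rV[int]_n := \row_i dot a (phi (b i)).
Definition dual_mx (g : gT) : 'M[int]_n := (act_mx b kappa g^-1%g)^T.
Definition dact (g : gT) (d : 'rV[int]_n) : 'rV[int]_n := d *m dual_mx g.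

Lemma evE d x : ev d x = \sum_i d ord0 i * kappa x ord0 i.
Proof. by rewrite /ev mxE; apply: eq_bigr => i _; rewrite mxE. Qed.

Lemma evD d x y : ev d (x + y) = ev d x + ev d y.
Proof. by rewrite /ev (kappaD bP kappaP) linearD /= mulmxDr mxE. Qed.

Lemma evBl d d' x : ev (d - d') x = ev d x - ev d' x.
Proof. by rewrite /ev mulmxBl !mxE. Qed.

Lemma ev_basis d i : ev d (b i) = d ord0 i.
Proof.
rewrite evE (kappa_basis bP kappaP) (bigD1 i) //= big1 => [|j ne]; rewrite mxE eqxx ?eqxx ?mulr1 ?addr0 //=.
by rewrite (negPf ne) mulr0.
Qed.

Lemma ev_ext d d' : (forall x, ev d x = ev d' x) -> d = d'.
Proof. by move=> e; apply/rowP=> i; rewrite -!ev_basis. Qed.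

Lemma ev_tors d x y : is_tors (x - y) -> ev d x = ev d y.
Proof. by move=> /(kappa_eq bP kappaP) e; rewrite /ev e. Qed.

Lemma ev_emb a x : ev (emb a) x = dot a (phi x).
Proof.
rewrite (additive_intE (f := fun x => dot a (phi x))) => [|u v]; last by rewrite phiD dotDr.
by rewrite evE; apply: eq_bigr => i _; rewrite mxE mulrC.
Qed.

Lemma emb_phi x : emb (phi x) = lam x.
Proof.
apply/rowP=> i; rewrite !mxE.
rewrite -[LHS](_ : pd x (b i) = _) // (additive_intE (f := fun x => pd x (b i))).
  by apply: eq_bigr => j _; rewrite mxE.
by move=> u v; rewrite pull_dotDl.
Qed.

Lemma ev_lam x y : ev (lam x) y = pd x y.
Proof. by rewrite -emb_phi ev_emb. Qed.

Lemma ev_dact g d x : g \in G -> ev (dact g d) x = ev d (zact g^-1%g x).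
Proof.
move=> gG; rewrite /ev /dact /dual_mx (kappa_act bP kappaP) ?groupV //.
by rewrite trmx_mul mulmxA.
Qed.

Lemma emb_act g a : g \in G -> emb (perm_act to g a) = dact g (emb a).
Proof.
move=> gG; apply: ev_ext => x; rewrite ev_dact // !ev_emb.
have -> : phi x = perm_act to g (phi (zact g^-1%g x)).
  by rewrite -phiG // -zg_actM ?groupV // mulgV zg_act1.
exact: dot_act.
Qed.

Lemma lam_act g x : g \in G -> lam (zact g x) = dact g (lam x).
Proof. by move=> gG; rewrite -!emb_phi phiG // emb_act. Qed.

Lemma lamB x y : lam (x - y) = lam x - lam y.
Proof. by rewrite /lam (kappaB bP kappaP) mulmxBl. Qed.

Lemma lam_tors x : lam x = 0 <-> is_tors x.
Proof.
split=> [l0|/(kappa_tors bP kappaP) k0]; last by rewrite /lam k0 mul0mx.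
by apply/phi_tors/dot_eq0; rewrite -/(pd x x) -ev_lam l0 /ev mul0mx mxE.
Qed.

Lemma lam_eq x y : lam x = lam y <-> is_tors (x - y).
Proof.
split=> [e|/lam_tors]; first by apply/lam_tors; rewrite lamB e subrr.
by rewrite lamB => /eqP; rewrite subr_eq0 => /eqP.
Qed.

Lemma gramZ_det : \det gramZ != 0.
Proof.
have := gram_unit bP kappaP (pull_dot_good phiD phiG phi_tors).
have -> : gram (pull_dotQ phi) b = toQ gramZ by apply/matrixP=> i j; rewrite !mxE.
by rewrite unitmxE det_map_mx unitfE intr_eq0.
Qed.

Lemma dactB g d d' : dact g (d - d') = dact g d - dact g d'.
Proof. exact: mulmxBl. Qed.

Lemma dactM g h d : g \in G -> h \in G -> dact (g * h)%g d = dact g (dact h d).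
Proof.
move=> gG hG; apply: ev_ext => x; rewrite !ev_dact ?groupM //.
by rewrite -zg_actM ?groupV // invMg.
Qed.

Variable H : {group gT}.
Hypothesis sHG : H \subset G.
Let HG h : h \in H -> h \in G. Proof. exact: (subsetP sHG). Qed.

Definition dual_fixed (d : 'rV[int]_n) : Prop := forall h, h \in H -> dact h d = d.
Definition lam_fixed (d : 'rV[int]_n) : Prop := exists2 x, fixed H (whole_mod M) x & d = lam x.
(** On M^H this is N M + (M_tors)^H: when [y] is fixed, so is its difference from a norm. *)
Definition nrm_tors_mod (y : MT) : Prop := exists z, is_tors (y - nrm H z).

Lemma dual_fixed_subgrp : subgrp dual_fixed.
Proof.
split=> [h _|d d' dH d'H h hH]; first by rewrite /dact mul0mx.
by rewrite dactB dH // d'H.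
Qed.

Lemma lam_fixed_subgrp : subgrp lam_fixed.
Proof.
split; first by exists 0; [exact: (fixed_subgrp M sHG).1 | rewrite -(subrr (0 : MT)) lamB subrr].
by move=> _ _ [x xH ->] [y yH ->]; exists (x - y); [exact: (fixed_subgrp M sHG).2 | rewrite lamB].
Qed.

Lemma nrm_tors_mod_subgrp : subgrp nrm_tors_mod.
Proof.
split; first by exists 0; rewrite -(subrr (0 : MT)) nrmB // !subrr; apply: tors0.
move=> x y [z tz] [w tw]; exists (z - w); rewrite nrmB //.
have -> : x - y - (nrm H z - nrm H w) = (x - nrm H z) - (y - nrm H w).
  by rewrite !opprB addrACA [RHS]addrACA; congr (_ + _); rewrite addrC.
exact: (tors_subgrp M).2.
Qed.

Lemma ev_nrm d x : dual_fixed d -> ev d (nrm H x) = ev d x *+ #|H|.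
Proof.
move=> dH; rewrite /nrm (additive_int_sum _ _ _ (evD d)) -sumr_const; apply: eq_bigr => h hH.
by rewrite -[h]invgK -ev_dact ?groupV ?HG // dH ?groupV.
Qed.

Lemma comb_additive s (u v : 'I_s -> MT) (f : MT -> MT) c :
  (forall x y, f (x - y) = f x - f y) -> (forall i, f (u i) = v i) -> f (comb u c) = comb v c.
Proof.
move=> fB fuv; have f0 : f 0 = 0 by have := fB 0 0; rewrite !subrr.
have fN x : f (- x) = - f x by rewrite -sub0r fB f0 sub0r.
have fD x y : f (x + y) = f x + f y by rewrite -[y in LHS]opprK fB fN opprK.
have fMn x k : f (x *+ k) = f x *+ k.
  by elim: k => [|k IHk]; rewrite ?mulr0n // !mulrS fD IHk.
rewrite /comb (big_morph f fD f0); apply: eq_bigr => i _.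
case: (c ord0 i) => k; first by rewrite -!pmulrn fMn fuv.
by rewrite NegzE !mulrNz -!pmulrn fN fMn fuv.
Qed.

(** A basis of M modulo the elements with torsion norm. Invariant functionals factor through this
    lattice, because d(N x) = |H| d(x) and d kills torsion; it is therefore the lattice dual to
    L'^H. *)
Lemma norm_basis : exists s (z : 'I_s -> MT),
  (forall x, exists c : 'rV[int]_s, is_tors (nrm H (x - comb z c))) /\
  (forall c : 'rV[int]_s, is_tors (nrm H (comb z c)) -> c = 0).
Proof.
pose f k x := if insub k is Some i then phi (nrm H x) (enum_val (i : 'I_#|X|)) else 0.
have fD k : additive_int (f k).
  by move=> x y; rewrite /f; case: insub => [i|]; rewrite ?addr0 // nrmD // phiD ffunE.
have fE x : is_tors (nrm H x) <-> forall k, (k < #|X|)%N -> f k x = 0.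
  split=> [/phi_tors e k lt|f0]; first by rewrite /f insubT /= e ffunE.
  apply/phi_tors/ffunP=> y; rewrite ffunE; have := f0 (enum_rank y) (ltn_ord _).
  by rewrite /f valK enum_rankK.
have sT : subgrp (fun _ : MT => True) by split.
have [s [z [_ zC zI]]] := lattice_basis #|X| sT fD.
exists s, z; split=> [x|c tc].
  have [c cP] := zC x Logic.I; exists (\row_i c i); apply/fE => k kX.
  rewrite -(cP k kX) /comb; congr (f k (x - _)).
  by apply: eq_bigr => i _; rewrite mxE.
by apply/rowP=> i; rewrite mxE (zI (fun i => c ord0 i)) //; apply/fE.
Qed.

(** Let D express the norms N z_i in the basis B of M^H modulo torsion, and let E have entries <B_k,
    z_i>. The norm index is |det D|. Evaluation at the z_i identifies L'^H with Z^r, so the other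
    index is |det E|. From <B_k, N z_i> = |H| <B_k, z_i> it follows that E is |H|^-1 times the Gram
    matrix of B times D^T, whence det E = det_H det D. *)
Theorem dual_fixed_index r (B : 'I_r -> MT) : is_tf_basis H (whole_mod M) B ->
  [/\ fin_index dual_fixed lam_fixed,
      fin_index (fixed H (whole_mod M)) nrm_tors_mod,
      (0 < quot_index dual_fixed lam_fixed)%N &
      (quot_index dual_fixed lam_fixed)%:R =
      `|lattice_det H (pull_dotQ phi) B| * (quot_index (fixed H (whole_mod M)) nrm_tors_mod)%:R].
Proof.
move=> BP; have [s [z [zC zI]]] := norm_basis.
have combN c : nrm H (comb z c) = comb (fun i => nrm H (z i)) c.
  by apply: comb_additive => // x y; apply: nrmB.
pose NZ := \matrix_i kappa (nrm H (z i)); pose BM := \matrix_i kappa (B i).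
have BM_inj (c : 'rV[int]_r) : c *m BM = 0 -> c = 0.
  move=> c0; apply: (tf_basis_indep BP); apply/(kappa_tors bP kappaP).
  by rewrite (kappa_comb_gen bP kappaP).
have NZ_inj (c : 'rV[int]_s) : c *m NZ = 0 -> c = 0.
  move=> c0; apply: zI; rewrite combN; apply/(kappa_tors bP kappaP).
  by rewrite (kappa_comb_gen bP kappaP).
have mx_inj m1 (Y Z : 'M[int]_(m1, r)) : Y *m BM = Z *m BM -> Y = Z.
  move=> e; apply/row_matrixP=> i; apply/eqP; rewrite -subr_eq0; apply/eqP/BM_inj.
  by rewrite mulmxBl -!row_mul e subrr.
have mx_inj' m1 (Y Z : 'M[int]_(m1, s)) : Y *m NZ = Z *m NZ -> Y = Z.
  move=> e; apply/row_matrixP=> i; apply/eqP; rewrite -subr_eq0; apply/eqP/NZ_inj.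
  by rewrite mulmxBl -!row_mul e subrr.
have /choice_on[Df DP] : forall i, exists c, is_tors (nrm H (z i) - comb B c).
  by move=> i; apply: tf_basis_span BP (nrm_fixed _ sHG).
pose D := \matrix_i Df i.
have NZE : NZ = D *m BM.
  apply/row_matrixP=> i; rewrite row_mul !rowK -(kappa_comb_gen bP kappaP).
  exact/(kappa_eq bP kappaP)/DP.
(* D' expresses B in terms of z. As the norm multiplies fixed elements by |H|, both D' D and D D'
   are the scalar |H|: the two ranks agree and det D is non-zero. *)
have /choice_on[D'f D'P] : forall k, exists c, is_tors (nrm H (B k - comb z c)) by move=> k.
pose D' := \matrix_i D'f i.
have BME : BM *+ #|H| = D' *m NZ.
  apply/row_matrixP=> i; rewrite row_mul raddfMn /= !rowK -(kappa_comb_gen bP kappaP).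
  rewrite -(kappaMn bP kappaP) -nrm_of_fixed; last by case: BP.
  by apply/(kappa_eq bP kappaP); rewrite -combN -nrmB.
have H0 : (0 < #|H|)%N := cardG_gt0 H.
have BME' : #|H|%:R%:M *m BM = D' *m NZ by rewrite mul_scalar_mx scaler_nat.
have D'D : D' *m D = #|H|%:R%:M.
  by apply: mx_inj; rewrite -mulmxA -NZE BME'.
have DD' : D *m D' = #|H|%:R%:M.
  apply: mx_inj'; rewrite -mulmxA -BME' !mul_scalar_mx -scalemxAr -NZE.
  by [].
have H0Q : #|H|%:R != 0 :> rat by rewrite pnatr_eq0 -lt0n.
have toQH t : toQ (#|H|%:R%:M : 'M[int]_t) = #|H|%:R%:M by rewrite map_scalar_mx rmorph_nat.
have inv1 t t' (Y : 'M[int]_(t, t')) (Z : 'M[int]_(t', t)) : Y *m Z = #|H|%:R%:M -> (t <= t')%N.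
  move=> /(congr1 (fun A => toQ A)); rewrite map_mxM toQH => YZ.
  apply: (@mulmx1_min _ _ _ (toQ Y) (#|H|%:R^-1 *: toQ Z)).
  by rewrite -scalemxAr YZ scale_scalar_mx mulVf.
have eqrs : r = s by apply/eqP; rewrite eqn_leq (inv1 _ _ _ _ D'D) (inv1 _ _ _ _ DD').
case: s / eqrs in z zC zI combN NZ NZ_inj mx_inj' Df DP D NZE D'f D'P D' BME BME' D'D DD' *.
have detD : \det D != 0.
  apply/eqP=> d0; have /eqP := congr1 determinant D'D.
  by rewrite det_mulmx d0 mulr0 det_scalar eq_sym expf_eq0 pnatr_eq0 eqn0Ngt H0 andbF.
have BS k : fixed H (whole_mod M) (B k) by case: BP.
pose E : 'M[int]_r := \matrix_(k, i) pd (B k) (z i).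
have EE : toQ E = #|H|%:R^-1 *: (gram (pull_dotQ phi) B *m (toQ D)^T).
  apply/matrixP=> k i; rewrite !mxE.
  have -> : \sum_j gram (pull_dotQ phi) B k j * (toQ D)^T j i = (pd (B k) (nrm H (z i)))%:~R.
    rewrite -ev_lam (ev_tors _ (DP i)) /comb (additive_int_sum _ _ _ (evD _)) rmorph_sum /=.
    apply: eq_bigr => j _; rewrite (additive_intMz _ _ (evD _)) ev_lam rmorphM /=.
    by rewrite !mxE.
  have -> : pd (B k) (nrm H (z i)) = #|H|%:Z * pd (B k) (z i).
    rewrite -!ev_lam ev_nrm; first by rewrite -[LHS]mulr_natl natz.
    by move=> h hH; rewrite -lam_act ?HG //; case: (BS k) => _ ->.
  by rewrite intrM -pmulrn mulKf.
have detE : (\det E)%:~R = lattice_det H (pull_dotQ phi) B * (\det D)%:~R.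
  rewrite -!det_map_mx EE detZ det_mulmx det_tr lattice_detE exprVn.
  by rewrite mulrA [_^-1 * _]mulrC.
have EI (c : 'rV[int]_r) i : (c *m E) ord0 i = pd (comb B c) (z i).
  have aD : additive_int (fun x => pd x (z i)) by move=> u v; rewrite pull_dotDl.
  rewrite /comb (additive_int_sum _ _ _ aD) mxE; apply: eq_bigr => k _.
  by rewrite (additive_intMz _ _ aD) mxE mulrC.
have pd_tors x y u : is_tors (x - y) -> pd x u = pd y u.
  by move=> /lam_eq e; rewrite -!ev_lam e.
have lam_fix x : fixed H (whole_mod M) x -> dual_fixed (lam x).
  by move=> [_ xH] h hH; rewrite -lam_act ?HG // xH.
have combS c : fixed H (whole_mod M) (comb B c).
  split=> // h hH; apply: comb_additive => [x y|i]; first by rewrite zactB ?HG.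
  by case: (BS i) => _ ->.
have nrm_comb x c : is_tors (nrm H (x - comb z c)) <-> is_tors (nrm H x - comb (fun i => nrm H (z i)) c).
  by rewrite nrmB // combN.
have kap_NZ c : kappa (comb (fun i => nrm H (z i)) c) = kappa (comb B (c *m D)).
  by rewrite !(kappa_comb_gen bP kappaP) -/NZ -/BM NZE mulmxA.
have zero_on_z d : dual_fixed d -> (forall i, ev d (z i) = 0) -> d = 0.
  move=> dH dz; apply: ev_ext => x; have [c /nrm_comb tc] := zC x.
  have := ev_nrm x dH; rewrite (ev_tors d tc) /comb (additive_int_sum _ _ _ (evD d)) big1 => [|i _].
    by move/esym/eqP; rewrite mulrn_eq0 eqn0Ngt H0 /= => /eqP ->; rewrite /ev mul0mx mxE.
  by rewrite (additive_intMz _ _ (evD d)) ev_nrm // dz mul0rn mul0r.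
have [l_fin l_eq] : fin_index (fixed H (whole_mod M)) nrm_tors_mod /\
    quot_index (fixed H (whole_mod M)) nrm_tors_mod = absz (\det D).
  pose R' (x y : 'rV[int]_r) := in_span D (x - y).
  have eqR' : equiv_on (fun _ => True) R' := subgrp_equiv _ (in_span_subgrp D).
  pose Rel x (c : 'rV[int]_r) := is_tors (x - comb B c).
  have El x : fixed H (whole_mod M) x -> exists2 c, True & Rel x c.
    by move=> xH; have [c tc] := tf_basis_span BP xH; exists c.
  have Er (c : 'rV[int]_r) : True -> exists2 x, fixed H (whole_mod M) x & Rel x c.
    move=> _; exists (comb B c).
      exact: combS.
    rewrite /Rel.
    rewrite subrr.
    exact: tors0.
  have ER x x' c c' : fixed H (whole_mod M) x -> fixed H (whole_mod M) x' -> True -> True ->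
      Rel x c -> Rel x' c' -> (nrm_tors_mod (x - x') <-> R' c c').
    move=> _ _ _ _ /(kappa_eq bP kappaP) xc /(kappa_eq bP kappaP) xc'; split.
      move=> [w /(kappa_eq bP kappaP) e]; have [g /nrm_comb/(kappa_eq bP kappaP) ge] := zC w.
      exists g; apply/eqP; rewrite -subr_eq0; apply/eqP/(tf_basis_indep BP)/(kappa_tors bP kappaP).
      rewrite combB (kappaB bP kappaP) -kap_NZ -ge -e combB (kappaB bP kappaP) -xc -xc'.
      by rewrite -(kappaB bP kappaP) subrr.
    move=> [g ge]; exists (comb z g); apply/(kappa_eq bP kappaP).
    by rewrite combN kap_NZ -ge combB !(kappaB bP kappaP) xc xc'.
  split; first exact: (fin_classes_transfer El Er ER (fin_index_det detD)).
  by rewrite /quot_index (num_classes_transfer eqR' El Er ER (fin_index_det detD)); exact: index_det.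
have detE0 : \det E != 0.
  suff : row_free (toQ E) by rewrite row_free_unit unitmxE det_map_mx unitfE intr_eq0.
  apply: inj_row_free => v v0; have [k [k0 [c cE]]] := clear_denominators v.
  suff c0 : c = 0 by move/eqP: cE; rewrite c0 map_mx0 scaler_eq0 intr_eq0 (negPf k0) => /eqP.
  have cE0 : c *m E = 0 by apply: toQ_inj; rewrite map_mxM -cE -scalemxAl v0 scaler0 map_mx0.
  apply: (tf_basis_indep BP); apply/lam_tors/zero_on_z; first exact/lam_fix/combS.
  by move=> i; rewrite ev_lam -EI cE0 mxE.
have [q_fin q_eq] : fin_index dual_fixed lam_fixed /\
    quot_index dual_fixed lam_fixed = absz (\det E).
  pose R' (x y : 'rV[int]_r) := in_span E (x - y).
  have eqR' : equiv_on (fun _ => True) R' := subgrp_equiv _ (in_span_subgrp E).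
  pose Rel d (e : 'rV[int]_r) := forall i, ev d (z i) = e ord0 i.
  have El d : dual_fixed d -> exists2 e, True & Rel d e.
    by move=> _; exists (\row_i ev d (z i)) => // i; rewrite mxE.
  have Er (e : 'rV[int]_r) : True -> exists2 d, dual_fixed d & Rel d e.
    (* The functional with values [e] on the basis z sends x to the product of its z-coordinates
       c(x) with e. It is invariant because x and its H-translates have the same norm, hence the
       same coordinates. *)
    move=> _; have /choice_on[c cP] := zC.
    have cu x g : is_tors (nrm H (x - comb z g)) -> c x = g.
      move=> tg; apply/eqP; rewrite -subr_eq0; apply/eqP/zI; rewrite combB.
      have -> : comb z (c x) - comb z g = (x - comb z g) - (x - comb z (c x)).
        by rewrite opprB [RHS]addrC addrA subrK.
      by rewrite nrmB //; apply: (tors_subgrp M).2.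
    have cD : additive_int (fun x => (c x *m e^T) ord0 ord0).
      move=> x y; rewrite (cu (x + y) (c x + c y)) ?mulmxDl ?mxE //.
      have -> : comb z (c x + c y) = comb z (c x) + comb z (c y).
        by rewrite -[c y in LHS]opprK combB -[in LHS](sub0r (c y)) combB comb0 sub0r opprK.
      by rewrite opprD addrACA nrmD //; apply: subgrpD (cP x) (cP y); exact: tors_subgrp.
    pose d := \row_j (c (b j) *m e^T) ord0 ord0.
    have dE x : ev d x = (c x *m e^T) ord0 ord0.
      by rewrite (additive_intE _ cD) evE; apply: eq_bigr => j _; rewrite [d _ _]mxE mulrC.
    exists d.
      move=> h hH; apply: ev_ext => x; rewrite ev_dact ?HG // !dE (cu _ (c x)) //.
      suff e1 : nrm H (zact h^-1%g x) = nrm H x by rewrite nrmB // e1 -nrmB.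
      rewrite /nrm [RHS](reindex_inj (mulIg h^-1%g)) /=; apply: eq_big => [g|g gH].
        by rewrite groupMr ?groupV.
      by rewrite zg_actM ?groupV ?HG.
    move=> i; rewrite dE (cu _ (delta_mx ord0 i)); last first.
      by rewrite comb_delta subrr -(subrr (0 : MT)) nrmB // subrr; exact: tors0.
    by rewrite -rowE !mxE.
  have ER d d' e e' : dual_fixed d -> dual_fixed d' -> True -> True ->
      Rel d e -> Rel d' e' -> (lam_fixed (d - d') <-> R' e e').
    move=> dH d'H _ _ de d'e; have edd i : (e - e') ord0 i = ev (d - d') (z i).
      by rewrite evBl de d'e !mxE.
    split=> [[x xH dx]|[c ce]].
      have [c tc] := tf_basis_span BP xH; exists c; apply/rowP=> i.
      by rewrite edd dx ev_lam EI (pd_tors _ _ _ tc).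
    exists (comb B c); first exact: combS.
    apply/eqP; rewrite -subr_eq0; apply/eqP/zero_on_z.
      apply: dual_fixed_subgrp.2; first exact: dual_fixed_subgrp.2.
      exact/lam_fix/combS.
    by move=> i; rewrite evBl -edd ce EI ev_lam subrr.
  split; first exact: (fin_classes_transfer El Er ER (fin_index_det detE0)).
  by rewrite /quot_index (num_classes_transfer eqR' El Er ER (fin_index_det detE0)); exact: index_det.
split=> //; first by rewrite q_eq absz_gt0.
rewrite q_eq l_eq; have absQ (k : int) : (absz k)%:R = `|k%:~R| :> rat.
  by rewrite -intr_norm -abszE -pmulrn.
by rewrite !absQ detE normrM.
Qed.

End DualLattice.

(** * Low-degree cohomology of the torsion sequence *)

Lemma quot_index_gt0 (A : zmodType) (P Q : A -> Prop) :
  subgrp P -> subgrp Q -> fin_index P Q -> (0 < quot_index P Q)%N.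
Proof. by move=> [P0 _] sQ; apply: num_classes_gt0 P0; apply: subgrp_equiv. Qed.

Lemma subgrpI (A : zmodType) (P Q : A -> Prop) :
  subgrp P -> subgrp Q -> subgrp (fun x => P x /\ Q x).
Proof.
move=> sP sQ; split=> [|x y [Px Qx] [Py Qy]]; first by split; [case: sP|case: sQ].
by split; [apply: sP.2 | apply: sQ.2].
Qed.

Lemma subrACA (A : zmodType) (x y z t : A) : x - y - (z - t) = (x - z) - (y - t).
Proof. by rewrite !opprB addrACA [RHS]addrACA; congr (_ + _); rewrite addrC. Qed.

(** * Cochains as a group *)

Section Cochains.
Variables (gT : finGroupType) (G : {group gT}) (M : zgmod G) (H : {group gT}).
Hypothesis sHG : H \subset G.
Local Notation MT := (zg_car M).
Local Notation zact := (@zg_act _ _ M).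
Local Notation cochain := {ffun gT -> zg_car M}.
Let HG h : h \in H -> h \in G. Proof. exact: (subsetP sHG). Qed.

Definition delta1 (f : gT -> MT) (g h : gT) : MT := zact g (f h) - f (g * h)%g + f g.

Lemma delta1B (f f' : gT -> MT) g h : g \in H ->
  delta1 (fun g => f g - f' g) g h = delta1 f g h - delta1 f' g h.
Proof.
by move=> gH; rewrite /delta1 zactB ?HG // subrACA addrACA -opprD.
Qed.

Lemma delta1_delta0 z g h : g \in H -> h \in H -> delta1 (fun g => zact g z - z) g h = 0.
Proof.
move=> gH hH; rewrite /delta1 zactB ?HG // zg_actM ?HG //.
by rewrite -[X in X + _]subrACA subrr sub0r addrC opprB addrA subrK subrr.
Qed.

Lemma cocycle1E S f : cocycle1 H S f <->
  (forall g, g \in H -> S (f g)) /\ (forall g h, g \in H -> h \in H -> delta1 f g h = 0).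
Proof.
split=> -[fS fM]; split=> // g h gH hH.
  by rewrite /delta1 fM // opprD addrCA subrr addr0 addNr.
apply/eqP; rewrite eq_sym -subr_eq0 -(fM g h gH hH) /delta1.
by rewrite [f g + _]addrC addrAC.
Qed.

Lemma delta1_cocycle2 (f : gT -> MT) g h k : g \in H -> h \in H -> k \in H ->
  zact g (delta1 f h k) - delta1 f (g * h)%g k + delta1 f g (h * k)%g - delta1 f g h = 0.
Proof.
move=> gH hH kH; rewrite /delta1 zg_actD ?HG // zactB ?HG // -zg_actM ?HG // mulgA.
rewrite !opprD !opprK.
rewrite [LHS](AC (3*3*3*3) ((1*4)*(7*2)*(3*10)*(5*8)*(11*6)*(9*12))) /=.
by rewrite !subrr !addr0.
Qed.

Variable S : MT -> Prop.
Hypothesis sS : subgrp S.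
Hypothesis S_act : forall g x, g \in H -> S x -> S (zact g x).

Lemma delta1_ffunB (f f' : cochain) g h : g \in H ->
  delta1 (f - f' : cochain) g h = delta1 f g h - delta1 f' g h.
Proof. by move=> gH; rewrite -delta1B // /delta1 !ffunE. Qed.

Lemma cocycle1_subgrp : subgrp (fun f : cochain => cocycle1 H S f).
Proof.
split=> [|f f' /cocycle1E[fS fM] /cocycle1E[f'S f'M]].
  split=> [g _|g h gH hH]; first by rewrite ffunE; case: sS.
  by rewrite !ffunE zact0 ?HG // addr0.
apply/cocycle1E; split=> [g gH|g h gH hH].
  by rewrite !ffunE; apply: sS.2; [apply: fS|apply: f'S].
by rewrite delta1_ffunB // fM // f'M // subrr.
Qed.

Lemma cobound1_subgrp : subgrp (fun f : cochain => cobound1 H S f).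
Proof.
split=> [|f f' [z [Sz fz]] [z' [Sz' f'z]]].
  by exists 0; split=> [|g gH]; [case: sS | rewrite ffunE zact0 ?HG // subrr].
exists (z - z'); split=> [|g gH]; first exact: sS.2.
by rewrite !ffunE fz // f'z // zactB ?HG // subrACA.
Qed.

Lemma cobound1_cocycle1 (f : cochain) : cobound1 H S f -> cocycle1 H S f.
Proof.
move=> [z [Sz fz]]; apply/cocycle1E; split=> [g gH|g h gH hH].
  by rewrite fz //; apply: sS.2 => //; apply: S_act.
by rewrite -[RHS](delta1_delta0 z gH hH) /delta1 !fz // groupM.
Qed.

(** Passing to finite functions puts a group structure on cochains, so that indices apply; values
    outside [H] never enter the relation. *)
Lemma tate1_index : fin_index (fun f : cochain => cocycle1 H S f) (fun f => cobound1 H S f) ->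
  tate1 H S = quot_index (fun f : cochain => cocycle1 H S f) (fun f => cobound1 H S f).
Proof.
move=> fin; rewrite /tate1 /quot_index.
pose E (f : gT -> MT) (F : cochain) := F = finfun f.
have eqB := subgrp_equiv (fun f : cochain => cocycle1 H S f) cobound1_subgrp.
apply: (num_classes_transfer (E := E) eqB _ _ _ fin).
- move=> f [fS fM]; exists (finfun f) => //; split=> [g gH|g h gH hH]; rewrite !ffunE.
    exact: fS.
  exact: fM.
- by move=> F ZF; exists F => //; rewrite /E; apply/ffunP=> g; rewrite ffunE.
move=> f f' _ _ _ _ _ _ -> ->; split=> -[z [Sz fz]]; exists z; split=> // g gH.
  by rewrite !ffunE fz.
by have := fz g gH; rewrite !ffunE.
Qed.

Definition norms (y : MT) : Prop := exists z, S z /\ y = nrm H z.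

Lemma norms_subgrp : subgrp norms.
Proof.
split; first by exists 0; split; [case: sS | have := nrmB (0 : MT) 0 sHG; rewrite !subrr].
move=> _ _ [z [Sz ->]] [w [Sw ->]]; exists (z - w); split; first exact: sS.2.
by rewrite nrmB.
Qed.

Lemma fixed_subgrp_gen : subgrp (fixed H S).
Proof.
split=> [|x y [Sx hx] [Sy hy]].
  by split=> [|h /HG]; [case: sS | apply: zact0].
by split=> [|h hH]; [apply: sS.2 | rewrite zactB ?HG // hx // hy].
Qed.

End Cochains.

(** * The sequence M_tors -> M -> M_tf on cochains *)

Section TorsionSequences.
Variables (gT : finGroupType) (G : {group gT}) (M : zgmod G) (H : {group gT}).
Hypothesis sHG : H \subset G.
Local Notation MT := (zg_car M).
Local Notation zact := (@zg_act _ _ M).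
Local Notation cochain := {ffun gT -> zg_car M}.
Local Notation tors := (tors_mod M).
Local Notation whole := (whole_mod M).
Let HG h : h \in H -> h \in G. Proof. exact: (subsetP sHG). Qed.
Let wS : subgrp whole. Proof. by split. Qed.
Let tS : subgrp tors := tors_subgrp M.

(* 1-cocycles and 1-coboundaries with values in M_tf, lifted to M *)
Definition cocycle1_tf (f : cochain) : Prop :=
  forall g h, g \in H -> h \in H -> is_tors (delta1 f g h).
Definition cobound1_tf (f : cochain) : Prop :=
  exists z, forall g, g \in H -> is_tors (f g - (zact g z - z)).
(** The classes of H^1(H, M_tf) coming from H^1(H, M), equivalently killed by the connecting map to
    H^2(H, M_tors). *)
Definition lifts_mod_tors (f : cochain) : Prop :=
  exists2 f' : cochain, cocycle1 H whole f' & forall g, g \in H -> is_tors (f g - f' g).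
(** The preimage in M of (M_tf)^H; its index over [fixed_lift] measures the failure of M^H to
    surject onto (M_tf)^H. *)
Definition fixed_tf (x : MT) : Prop := forall h, h \in H -> is_tors (zact h x - x).
Definition fixed_lift (y : MT) : Prop := exists2 x, fixed H whole x & is_tors (y - x).

Lemma cocycle1_tf_subgrp : subgrp cocycle1_tf.
Proof.
split=> [g h gH hH|f f' fZ f'Z g h gH hH].
  by rewrite /delta1 !ffunE zact0 ?HG // subrr addr0; apply: tors0.
by rewrite (delta1_ffunB sHG) //; apply: tS.2; [apply: fZ|apply: f'Z].
Qed.

Lemma cobound1_tf_subgrp : subgrp cobound1_tf.
Proof.
split=> [|f f' [z fz] [z' f'z]].
  by exists 0 => g gH; rewrite ffunE zact0 ?HG // !subrr; apply: tors0.
exists (z - z') => g gH; rewrite !ffunE zactB ?HG //.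
have -> : f g - f' g - (zact g z - zact g z' - (z - z')) =
    (f g - (zact g z - z)) - (f' g - (zact g z' - z')) by rewrite [RHS]subrACA; congr (_ - _); rewrite subrACA.
by apply: tS.2; [apply: fz|apply: f'z].
Qed.

Lemma lifts_mod_tors_subgrp : subgrp lifts_mod_tors.
Proof.
split=> [|f f' [u Zu fu] [u' Zu' fu']].
  exists 0; first exact: (cocycle1_subgrp sHG wS).1.
  by move=> g gH; rewrite subrr; apply: tors0.
exists (u - u'); first exact: (cocycle1_subgrp sHG wS).2.
by move=> g gH; rewrite !ffunE subrACA; apply: tS.2; [apply: fu|apply: fu'].
Qed.

Hypothesis tors_fin : exists s : seq MT, forall x, is_tors x -> x \in s.

Lemma fin_index_tors_fixed (R : MT -> Prop) : subgrp R -> fin_index (fixed H tors) R.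
Proof.
move=> sR; have [s sP] := tors_fin; apply: (fin_index_cover (s := s)) => // x [tx _].
by exists x; [exact: sP | rewrite subrr; case: sR].
Qed.

Lemma fin_index_tors_cochain (R : cochain -> Prop) : subgrp R ->
  (forall f : cochain, (forall g, g \in H -> f g = 0) -> R f) ->
  fin_index (fun f : cochain => cocycle1 H tors f) R.
Proof.
move=> sR R0; have [s sP] := tors_fin.
pose c (F : {ffun gT -> seq_sub s}) : cochain := [ffun g => ssval (F g)].
apply: (fin_index_cover (s := [seq c F | F : {ffun gT -> seq_sub s}])) => // f [fT _].
have s0 : 0 \in s := sP _ (tors0 M).
(* Values outside [H] are unrestricted, so they are reset to 0 to land in the finite list [s]. *)
have fs g : (if g \in H then f g else 0) \in s.
  by case: ifP => // gH; apply/sP/fT.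
exists (c [ffun g => SeqSub (fs g)]); first by apply: image_f.
by apply: R0 => g gH; rewrite !ffunE /= gH subrr.
Qed.

End TorsionSequences.

(** * Orders in the long exact sequence *)

Section TorsionIndices.
Variables (gT : finGroupType) (G : {group gT}) (M : zgmod G) (H : {group gT}).
Hypothesis sHG : H \subset G.
Local Notation MT := (zg_car M).
Local Notation zact := (@zg_act _ _ M).
Local Notation cochain := {ffun gT -> zg_car M}.
Local Notation tors := (tors_mod M).
Local Notation whole := (whole_mod M).
Let HG h : h \in H -> h \in G. Proof. exact: (subsetP sHG). Qed.
Let wS : subgrp whole. Proof. by split. Qed.
Let tS : subgrp tors := tors_subgrp M.
Let w_act g x : g \in H -> whole x -> whole (zact g x). Proof. by []. Qed.

Local Notation ZF := (fun f : cochain => cocycle1_tf H f).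
Local Notation BF := (fun f : cochain => cobound1_tf H f).
Local Notation QZ := (fun f : cochain => lifts_mod_tors H f).
Local Notation ZM := (fun f : cochain => cocycle1 H whole f).
Local Notation BM := (fun f : cochain => cobound1 H whole f).
Local Notation ZT := (fun f : cochain => cocycle1 H tors f).
Local Notation BT := (fun f : cochain => cobound1 H tors f).
Local Notation ZTBM := (fun f : cochain => cocycle1 H tors f /\ cobound1 H whole f).

Let sZF := cocycle1_tf_subgrp M sHG.
Let sBF := cobound1_tf_subgrp M sHG.
Let sQZ := lifts_mod_tors_subgrp M sHG.
Let sZM := cocycle1_subgrp sHG wS.
Let sBM := cobound1_subgrp sHG wS.
Let sZT := cocycle1_subgrp sHG tS.
Let sBT := cobound1_subgrp sHG tS.

Hypothesis tors_fin : exists s : seq MT, forall x, is_tors x -> x \in s.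
Hypothesis finF : fin_index ZF BF.

Let ZM_ZF (f : cochain) : ZM f -> ZF f.
Proof. by move=> /cocycle1E[_ fM] g h gH hH; rewrite fM //; apply: tors0. Qed.

Let BT_BM (f : cochain) : BT f -> BM f.
Proof. by move=> [z [_ fz]]; exists z. Qed.

Let ZF_QZ (f : cochain) : BF f -> QZ f.
Proof.
move=> [z fz]; exists [ffun g => zact g z - z]; last by move=> g gH; rewrite ffunE; apply: fz.
apply: (cobound1_cocycle1 sHG wS w_act).
by exists z; split=> // g _; rewrite ffunE.
Qed.

Lemma fin_h1_lift : fin_index ZF QZ.
Proof. by apply: (fin_indexS sQZ _ _ sZF finF) => // f _; apply: ZF_QZ. Qed.

Lemma fin_h1_image : fin_index ZM BF.
Proof. exact: (fin_indexS sBF ZM_ZF _ sZF finF). Qed.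

(** Image and cokernel of H^1(H, M) -> H^1(H, M_tf); the image has order [quot_index ZM BF]. *)
Lemma h1_tf_tower : quot_index ZF BF = (quot_index ZF QZ * quot_index ZM BF)%N.
Proof.
apply: (index_tower sZF sZM sQZ sBF ZM_ZF _ fin_h1_lift fin_h1_image).
move=> f fZ; split=> [[f' f'Z ft]|[f' f'Z [z fz]]].
  exists f' => //; exists 0 => g gH.
  by rewrite zact0 ?HG // !subr0 !ffunE; apply: ft.
pose d : cochain := [ffun g => zact g z - z].
exists (f' + d).
  apply: (subgrpD sZM f'Z); apply: (cobound1_cocycle1 sHG wS w_act).
  by exists z; split=> // g _; rewrite ffunE.
move=> g gH; have -> : f g - (f' + d) g = (f - f') g - (zact g z - z); last exact: fz.
by rewrite !ffunE (opprD (f' g)) addrA.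
Qed.

Lemma fin_h1_tors_whole : fin_index ZT BM.
Proof.
apply: fin_index_tors_cochain => // f f0; exists 0; split=> // g gH.
by rewrite f0 // zact0 ?HG // subrr.
Qed.

Let ZT_ZM (f : cochain) : ZT f -> ZM f. Proof. by case=> _ fM; split. Qed.

Let BF_split (f : cochain) : ZM f -> (BF f <-> exists2 f', ZT f' & BM (f - f')).
Proof.
move=> fZ; split=> [[z fz]|[f' [f'T _] [z [_ fz]]]].
  pose d : cochain := [ffun g => zact g z - z].
  have dB : BM d by exists z; split=> // g _; rewrite ffunE.
  exists (f - d); last by rewrite opprB addrC subrK.
  have [_ fdM] := sZM.2 _ _ fZ (cobound1_cocycle1 sHG wS w_act dB).
  by split=> // g gH; have := fz g gH; rewrite !ffunE.
exists z => g gH; rewrite -fz // !ffunE opprB addrC subrK.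
exact: f'T.
Qed.

(** Exactness at H^1(H, M): a cocycle that bounds modulo torsion becomes torsion-valued after
    subtracting a coboundary. The image of H^1(H, M_tors) has order [quot_index ZT BM]. *)
Lemma h1_whole_tower : quot_index ZM BM = (quot_index ZM BF * quot_index ZT BM)%N.
Proof.
exact: (index_tower sZM sZT sBF sBM ZT_ZM BF_split fin_h1_image fin_h1_tors_whole).
Qed.

Lemma fin_h1_whole : fin_index ZM BM.
Proof. exact: (fin_index_tower sBM ZT_ZM BF_split sZM fin_h1_image fin_h1_tors_whole). Qed.

Lemma fin_h1_tors : fin_index ZT BT.
Proof.
apply: fin_index_tors_cochain => // f f0; exists 0; split=> [|g gH]; first exact: tors0.
by rewrite f0 // zact0 ?HG // subrr.
Qed.

Let ZTBM_ZT (f : cochain) : ZTBM f -> ZT f. Proof. by case. Qed.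

Lemma fin_connecting : fin_index ZTBM BT.
Proof. exact: (fin_indexS sBT ZTBM_ZT _ sZT fin_h1_tors). Qed.

(** Image and kernel of H^1(H, M_tors) -> H^1(H, M); the kernel is [ZTBM] modulo [BT]. *)
Lemma h1_tors_tower : quot_index ZT BT = (quot_index ZT BM * quot_index ZTBM BT)%N.
Proof.
apply: (index_tower sZT (subgrpI sZT sBM) sBM sBT ZTBM_ZT _ fin_h1_tors_whole fin_connecting).
move=> f fZ; split=> [fB|[f' [_ f'B] /BT_BM d]].
  by exists f => //; rewrite subrr; exact: sBT.1.
by have := subgrpD sBM d f'B; rewrite subrK.
Qed.

(* The connecting map M_tf^H -> H^1(H, M_tors) *)
Lemma connecting_index : fin_index (fixed_tf (M := M) H) (fixed_lift H) /\
  quot_index ZTBM BT = quot_index (fixed_tf (M := M) H) (fixed_lift H).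
Proof.
pose E (z : MT) (f : cochain) := forall g, g \in H -> f g = zact g z - z.
have El z : fixed_tf H z -> exists2 f, ZTBM f & E z f.
  move=> zF; pose d : cochain := [ffun g => zact g z - z].
  have dB : BM d by exists z; split=> // g _; rewrite ffunE.
  exists d; last by move=> g _; rewrite ffunE.
  split=> //; have [_ dM] := cobound1_cocycle1 sHG wS w_act dB.
  by split=> // g gH; rewrite ffunE; apply: zF.
have Er (f : cochain) : ZTBM f -> exists2 z, fixed_tf H z & E z f.
  move=> [[fT _] [z [_ fz]]]; exists z => // g gH; rewrite -fz //; exact: fT.
have ER z z' f f' : fixed_tf H z -> fixed_tf H z' -> ZTBM f -> ZTBM f' ->
    E z f -> E z' f' -> (fixed_lift H (z - z') <-> BT (f - f')).
  move=> _ _ _ _ zf zf'; split=> [[x [_ xH] tx]|[y [ty fy]]].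
    exists (z - z' - x); split=> // g gH.
    by rewrite !ffunE zf // zf' // subrACA !zactB ?HG // xH // [RHS]subrACA subrr subr0.
  exists (z - z' - y); last by rewrite opprB addrC subrK.
  split=> // h hH; apply/eqP; rewrite -subr_eq0; have := fy h hH.
  by rewrite !ffunE zf // zf' // subrACA !zactB ?HG // => e; rewrite subrACA e subrr.
have eqB := subgrp_equiv ZTBM sBT.
have finl : fin_index (fixed_tf (M := M) H) (fixed_lift H).
  exact: (fin_classes_transfer El Er ER fin_connecting).
split=> //; symmetry; exact: (num_classes_transfer eqB El Er ER fin_connecting).
Qed.

(** If a torsion-valued 2-cocycle is the coboundary of a cochain c in M, then c is a 1-cocycle
    modulo torsion; the class vanishes in H^2(H, M_tors) exactly when c is a genuine cocycle plus a
    torsion cochain. *)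
Lemma ker2_index : ker2 H tors whole = quot_index ZF QZ.
Proof.
pose E (F : gT -> gT -> MT) (f : cochain) := forall g h, g \in H -> h \in H -> F g h = delta1 f g h.
have eqQ := subgrp_equiv ZF sQZ.
apply: (num_classes_transfer (E := E) eqQ _ _ _ fin_h1_lift).
- move=> F [[FT _] [c [_ Fc]]]; exists (finfun c).
    move=> g h gH hH; rewrite /delta1 !ffunE.
    by have := FT g h gH hH; rewrite Fc.
  by move=> g h gH hH; rewrite Fc // /delta1 !ffunE.
- move=> f fZ; exists (delta1 f) => //; split; last by exists f.
  split=> [g h gH hH|g h k gH hH kH]; first exact: fZ.
  exact: (delta1_cocycle2 sHG).
move=> F F' f f' _ _ _ _ Ff Ff'; split=> [[c [cT Fc]]|[u uZ fu]].
  exists (f - f' - finfun c); last first.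
    move=> g gH; have -> : (f - f') g - (f - f' - finfun c) g = c g; last exact: cT.
    by rewrite !ffunE opprB addrC subrK.
  apply/cocycle1E; split=> // g h gH hH.
  rewrite (delta1_ffunB sHG) // (delta1_ffunB sHG) // -Ff // -Ff' // Fc //.
  by rewrite /delta1 !ffunE subrr.
have /cocycle1E[_ uM] := uZ.
exists (fun g => f g - f' g - u g); split=> [g gH|g h gH hH].
  by have := fu g gH; rewrite !ffunE.
rewrite Ff // Ff' // -[RHS]/(delta1 (fun g => f g - f' g - u g) g h).
by rewrite (delta1B sHG) // uM // subr0 (delta1B sHG).
Qed.

(** Orders alternate along M^H -> (M_tf)^H -> H^1(M_tors) -> H^1(M) -> H^1(M_tf) -> H^2(M_tors) ->
    H^2(M), cut at the cokernel of the first arrow and the kernel of the last. *)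
Lemma h1_identity :
  (tate1 H tors * quot_index ZF BF = quot_index (fixed_tf (M := M) H) (fixed_lift H) *
     tate1 H whole * ker2 H tors whole)%N /\
  [/\ (0 < tate1 H tors)%N, (0 < tate1 H whole)%N & (0 < ker2 H tors whole)%N].
Proof.
rewrite (tate1_index sHG tS fin_h1_tors) (tate1_index sHG wS fin_h1_whole) ker2_index.
split; last by split; apply: quot_index_gt0;
  do ?[exact: fin_h1_tors | exact: fin_h1_whole | exact: fin_h1_lift].
rewrite h1_tors_tower h1_tf_tower h1_whole_tower connecting_index.2.
by rewrite [LHS](AC (2*2) ((2*(4*1))*3)).
Qed.

(** In degree 0 of Tate cohomology, the image of M_tors in the group of M has order h^0(M_tors) /
    kappa^0, and the quotient by this image is M^H modulo N M + (M_tors)^H. *)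
Lemma h0_identity :
  fin_index (fixed H whole) (nrm_tors_mod (M := M) H) ->
  (tate0 H whole * ker0 H tors whole =
     quot_index (fixed H whole) (nrm_tors_mod (M := M) H) * tate0 H tors)%N /\
  [/\ (0 < tate0 H tors)%N, (0 < tate0 H whole)%N & (0 < ker0 H tors whole)%N].
Proof.
move=> finL.
have sFW := fixed_subgrp_gen sHG wS; have sFT := fixed_subgrp_gen sHG tS.
have sNW := norms_subgrp sHG wS; have sNT := norms_subgrp sHG tS.
have sNL := nrm_tors_mod_subgrp M sHG.
have FT_FW x : fixed H tors x -> fixed H whole x by case.
have split_L x : fixed H whole x -> (nrm_tors_mod H x <-> exists2 y, fixed H tors y & norms H whole (x - y)).
  move=> xH; split=> [[z tz]|[y [ty _] [z [_ xyz]]]].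
    exists (x - nrm H z); last by exists z; split=> //; rewrite opprB addrC subrK.
    by split=> //; have [_] := sFW.2 _ _ xH (nrm_fixed z sHG).
  by exists z; rewrite -xyz opprB addrC subrK.
have finTW := fin_index_tors_fixed H tors_fin sNW.
have finTT := fin_index_tors_fixed H tors_fin sNT.
have finW := fin_index_tower sNW FT_FW split_L sFW finL finTW.
pose K x := fixed H tors x /\ norms H whole x.
have sK : subgrp K := subgrpI sFT sNW.
have K_FT x : K x -> fixed H tors x by case.
have NT_NW x : norms H tors x -> norms H whole x by move=> [z [_ ->]]; exists z.
have finK : fin_index K (norms H tors) := fin_indexS sNT K_FT (fun x _ p => p) sFT finTT.
have split_K x : fixed H tors x -> (norms H whole x <-> exists2 y, K y & norms H tors (x - y)).
  move=> xT; split=> [xN|[y [_ yN] /NT_NW xyN]]; last by have := subgrpD sNW xyN yN; rewrite subrK.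
  by exists x => //; rewrite subrr; exact: sNT.1.
have e1 : tate0 H whole = (quot_index (fixed H whole) (nrm_tors_mod H) * quot_index (fixed H tors) (norms H whole))%N.
  exact: (index_tower sFW sFT sNL sNW FT_FW split_L finL finTW).
have e2 : tate0 H tors = (quot_index (fixed H tors) (norms H whole) * ker0 H tors whole)%N.
  exact: (index_tower sFT sK sNW sNT K_FT split_K finTW finK).
split; first by rewrite e1 e2 mulnA.
by split; [exact: (quot_index_gt0 sFT sNT) | exact: (quot_index_gt0 sFW sNW) | exact: (quot_index_gt0 sK sNT)].
Qed.

End TorsionIndices.

(** * The formula for a single subgroup H *)

Section LocalFormula.
Variables (gT : finGroupType) (G : {group gT}) (M : zgmod G).
Variables (X : finType) (to : action G X).
Local Notation MT := (zg_car M).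
Local Notation zact := (@zg_act _ _ M).
Local Notation cochain := {ffun gT -> zg_car M}.
Variable phi : MT -> {ffun X -> int}.
Hypothesis phiD : forall x y, phi (x + y) = phi x + phi y.
Hypothesis phiG : forall g x, g \in G -> phi (zact g x) = perm_act to g (phi x).
Hypothesis phi_tors : forall x, is_tors x <-> phi x = 0.
Variables (n : nat) (b : 'I_n -> MT).
Hypothesis bP : is_tf_basis 1%G (whole_mod M) b.
Variable kappa : MT -> 'rV[int]_n.
Hypothesis kappaP : forall x, is_tors (x - comb b (kappa x)).

Local Notation lam' := (lam phi b kappa).
Local Notation emb' := (emb phi b).
Local Notation dact' := (dact b kappa).

Definition in_lam (d : 'rV[int]_n) : Prop := exists x, d = lam' x.

Let lB := lamB phi bP kappaP.

Lemma in_lamP d : in_lam d <-> in_span (gramZ phi b) d.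
Proof.
split=> [[x ->]|[c ->]]; first by exists (kappa x).
by exists (comb b c); rewrite /lam (kappa_comb bP kappaP).
Qed.

Lemma in_lam_subgrp : subgrp in_lam.
Proof.
split; first by exists 0; have := lB 0 0; rewrite !subrr.
by move=> _ _ [x ->] [y ->]; exists (x - y); rewrite lB.
Qed.

Lemma fin_in_lam : fin_index (fun _ => True) in_lam.
Proof.
have sT : subgrp (fun _ : 'rV[int]_n => True) by split.
apply: (fin_indexS in_lam_subgrp _ _ sT (fin_index_det (gramZ_det phiD phiG phi_tors bP kappaP))) => // d _.
by move/in_lamP.
Qed.

Variable H : {group gT}.
Hypothesis sHG : H \subset G.
Let HG h : h \in H -> h \in G. Proof. exact: (subsetP sHG). Qed.

(* the H-fixed classes of Hom(M, Z) / lam(M) *)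
Definition coker_fixed (d : 'rV[int]_n) : Prop := forall h, h \in H -> in_lam (dact' h d - d).
(** The classes of V_1^H represented by an invariant functional: the kernel of the connecting map to
    H^1(H, M_tf). *)
Definition dual_fixed_lam (d : 'rV[int]_n) : Prop :=
  exists2 d', dual_fixed b kappa H d' & in_lam (d - d').

Local Notation DH := (dual_fixed b kappa H).
Local Notation LH := (lam_fixed phi b kappa H).
Local Notation ZF := (fun f : cochain => cocycle1_tf H f).
Local Notation BF := (fun f : cochain => cobound1_tf H f).

Let sL := in_lam_subgrp.
Let sDH := dual_fixed_subgrp b kappa H.
Let sLH := lam_fixed_subgrp phi bP kappaP sHG.

Lemma coker_fixed_subgrp : subgrp coker_fixed.
Proof.
split=> [h hH|d d' dV d'V h hH]; first by rewrite /dact mul0mx subrr; apply: sL.1.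
by rewrite dactB subrACA; apply: sL.2; [apply: dV|apply: d'V].
Qed.

Lemma dual_fixed_lam_subgrp : subgrp dual_fixed_lam.
Proof.
split=> [|d d' [e eD de] [e' e'D d'e']].
  by exists 0; [exact: sDH.1 | rewrite subrr; apply: sL.1].
by exists (e - e'); [exact: sDH.2 | rewrite subrACA; apply: sL.2].
Qed.

Let DH_VH d : DH d -> coker_fixed d.
Proof. by move=> dD h hH; rewrite dD // subrr; apply: sL.1. Qed.

Lemma fin_coker_fixed : fin_index coker_fixed in_lam.
Proof.
have sT : subgrp (fun _ : 'rV[int]_n => True) by split.
exact: (fin_indexS sL (fun _ _ => Logic.I) (fun _ _ p => p) sT fin_in_lam).
Qed.

Let fin_V_DL : fin_index coker_fixed dual_fixed_lam.
Proof.
apply: (fin_indexS dual_fixed_lam_subgrp (fun _ p => p) _ coker_fixed_subgrp fin_coker_fixed).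
by move=> d _ dL; exists 0; [exact: sDH.1 | rewrite subr0].
Qed.

Let fin_DH_L : fin_index DH in_lam.
Proof.
have sT : subgrp (fun _ : 'rV[int]_n => True) by split.
exact: (fin_indexS sL (fun _ _ => Logic.I) (fun _ _ p => p) sT fin_in_lam).
Qed.

Lemma embB a a' : emb' (a - a') = emb' a - emb' a'.
Proof.
apply/rowP=> i; rewrite !mxE /dot -sumrB; apply: eq_bigr => y _.
by rewrite !ffunE mulrBl.
Qed.

(* With L = Hom(M, Z), the connecting map (L / lam M)^H -> H^1(H, M_tf) is onto:
   H^1(H, M_tf) -> H^1(H, L) factors through H^1(H, Z[X]) = 0. *)
Lemma h1_tf_index : fin_index ZF BF /\ quot_index ZF BF = quot_index coker_fixed dual_fixed_lam.
Proof.
have lam_actH h x : h \in H -> lam' (zact h x) = dact' h (lam' x).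
  by move=> /HG; apply: (lam_act phiD phiG bP kappaP).
have lam_torsE x : lam' x = 0 <-> is_tors x := lam_tors phiD phi_tors bP kappaP x.
have dBH h d d' : dact' h (d - d') = dact' h d - dact' h d' := dactB b kappa h d d'.
pose E (f : cochain) d := forall h, h \in H -> dact' h d - d = lam' (f h).
have El f : ZF f -> exists2 d, coker_fixed d & E f d.
  move=> fZ.
  (* [phi] kills torsion, so it turns [f] into a genuine cocycle in Z[X]. A cochain [a] trivialising
     it gives [emb' a], the functional that the connecting map sends to [f]. *)
  have [|a aP] := perm_H1 (to := to) (f := fun g => phi (f g)) sHG.
    move=> g h gH hH; rewrite -phiG ?HG // -phiD.
    apply/eqP; rewrite -subr_eq0 -(phiB phiD); apply/eqP/phi_tors.
    have -> : f (g * h)%g - (f g + zact g (f h)) = - delta1 f g h.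
      by rewrite /delta1 (opprD (f g)) opprD opprB addrA addrAC.
    exact: subgrpN (tors_subgrp M) (fZ g h gH hH).
  have ad h : h \in H -> dact' h (emb' a) - emb' a = lam' (f h).
    move=> hH; rewrite -(emb_act phiD phiG bP kappaP) ?HG // -embB -aP //.
    exact: (emb_phi phiD kappaP).
  by exists (emb' a) => // h hH; exists (f h); apply: ad.
have Er d : coker_fixed d -> exists2 f, ZF f & E f d.
  move=> dV; have /choice_on[f fP] : forall h, exists x, h \in H -> dact' h d - d = lam' x.
    move=> h; have [hH|] := boolP (h \in H); last by exists 0.
    by have [x xE] := dV h hH; exists x.
  exists (finfun f); last by move=> h hH; rewrite ffunE fP.
  move=> g h gH hH; rewrite /delta1 !ffunE; apply/lam_torsE.
  have l0 : lam' 0 = 0 by have := lB 0 0; rewrite !subrr.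
  have lD x y : lam' (x + y) = lam' x + lam' y.
    by rewrite -[y in LHS]opprK lB -[- y]sub0r lB l0 sub0r opprK.
  rewrite lD lB lam_actH // -!fP ?groupM // dBH.
  rewrite (dactM bP kappaP) ?HG // subrACA subrr sub0r.
  by rewrite addNr.
have ER f f' d d' : ZF f -> ZF f' -> coker_fixed d -> coker_fixed d' ->
    E f d -> E f' d' -> (BF (f - f') <-> dual_fixed_lam (d - d')).
  move=> _ _ _ _ fd f'd'.
  have ff h : h \in H -> lam' ((f - f') h) = dact' h (d - d') - (d - d').
    by move=> hH; rewrite !ffunE lB -fd // -f'd' // dBH subrACA.
  split=> [[z fz]|[e eD [z ez]]].
    exists (d - d' - lam' z); last by exists z; rewrite opprB addrC subrK.
    move=> h hH; apply/eqP; rewrite -subr_eq0 dBH -lam_actH // subrACA -ff // -!lB.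
    exact/eqP/lam_torsE/fz.
  exists z => h hH; apply/lam_torsE; rewrite !lB lam_actH // ff // -ez (dBH _ (d - d') e) eD //.
  by rewrite (subrACA _ e) subrr subr0 subrr.
split; first exact: (fin_classes_transfer El Er ER fin_V_DL).
exact: (num_classes_transfer (subgrp_equiv _ dual_fixed_lam_subgrp) El Er ER fin_V_DL).
Qed.

Lemma coker_tower : quot_index coker_fixed in_lam =
  (quot_index coker_fixed dual_fixed_lam * quot_index DH in_lam)%N.
Proof.
by apply: (index_tower coker_fixed_subgrp sDH dual_fixed_lam_subgrp sL DH_VH _ fin_V_DL fin_DH_L).
Qed.

(** Between lam(M^H) and L'^H lies the group of invariant elements of lam(M). Since [lam] is
    injective modulo torsion, that group is (M_tf)^H, and its index over lam(M^H) is the defect of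
    M^H. *)
Lemma lam_fixed_index : fin_index DH (lam_fixed phi b kappa H) ->
  quot_index DH (lam_fixed phi b kappa H) =
    (quot_index DH in_lam * quot_index (fixed_tf (M := M) H) (fixed_lift H))%N /\
  (0 < quot_index (fixed_tf (M := M) H) (fixed_lift H))%N.
Proof.
move=> fin; pose DL d := DH d /\ in_lam d.
have sDL : subgrp DL := subgrpI sDH sL.
have finDL : fin_index DL LH.
  by apply: (fin_indexS sLH _ (fun _ _ p => p) sDH fin) => d [].
have LH_L d : LH d -> in_lam d by case=> x _ ->; exists x.
have -> : quot_index DH LH = (quot_index DH in_lam * quot_index DL LH)%N.
  apply: (index_tower sDH sDL sL sLH _ _ fin_DH_L finDL) => [d []//|d dD].
  split=> [dL|[e [_ eL] /LH_L de]]; last by have := subgrpD sL de eL; rewrite subrK.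
  by exists d => //; rewrite subrr; exact: sLH.1.
pose E (d : 'rV[int]_n) x := d = lam' x.
have lam_eqE x y : lam' x = lam' y <-> is_tors (x - y) := lam_eq phiD phi_tors bP kappaP x y.
have lam_actH h x : h \in H -> lam' (zact h x) = dact' h (lam' x).
  by move=> /HG; apply: (lam_act phiD phiG bP kappaP).
have El x : fixed_tf H x -> exists2 d, DL d & E d x.
  move=> xF; exists (lam' x) => //; split; last by exists x.
  by move=> h hH; rewrite -lam_actH //; apply/lam_eqE/xF.
have Er d : DL d -> exists2 x, fixed_tf H x & E d x.
  move=> [dD [x dx]]; exists x => // h hH; apply/lam_eqE.
  by rewrite lam_actH // -dx dD.
have ER x x' d d' : fixed_tf H x -> fixed_tf H x' -> DL d -> DL d' -> E d x -> E d' x' ->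
    (fixed_lift H (x - x') <-> LH (d - d')).
  move=> _ _ _ _ -> ->; rewrite -lB; split=> [[y yF xy]|[y yF xy]].
    by exists y => //; apply/lam_eqE.
  by exists y => //; apply/lam_eqE.
have e : quot_index (fixed_tf (M := M) H) (fixed_lift H) = quot_index DL LH.
  exact: (num_classes_transfer (E := fun x d => E d x) (subgrp_equiv _ sLH) El Er ER finDL).
by rewrite e; split=> //; apply: quot_index_gt0.
Qed.

Hypothesis tors_fin : exists s : seq MT, forall x, is_tors x -> x \in s.

Theorem local_formula r (B : 'I_r -> MT) : is_tf_basis H (whole_mod M) B ->
  [/\ (0 < tate0 H (tors_mod M))%N, (0 < tate0 H (whole_mod M))%N,
      (0 < tate1 H (tors_mod M))%N & (0 < tate1 H (whole_mod M))%N] /\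
  [/\ (0 < ker0 H (tors_mod M) (whole_mod M))%N, (0 < ker2 H (tors_mod M) (whole_mod M))%N,
      (0 < quot_index coker_fixed in_lam)%N &
      `|lattice_det H (pull_dotQ phi) B| *
        (tate0 H (whole_mod M) * tate1 H (whole_mod M) *
         ker0 H (tors_mod M) (whole_mod M) * ker2 H (tors_mod M) (whole_mod M))%:R =
      (quot_index coker_fixed in_lam * tate0 H (tors_mod M) * tate1 H (tors_mod M))%:R :> rat].
Proof.
move=> BP.
have [fin1 finL gt1 detE] := dual_fixed_index phiD phiG phi_tors bP kappaP sHG BP.
have [finF h1E] := h1_tf_index.
have [e1 [t1T t1M k2]] := h1_identity sHG tors_fin finF.
have [e0 [t0T t0M k0]] := h0_identity sHG tors_fin finL.
have [eLH j0] := lam_fixed_index fin1.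
split; first by split.
split=> //; first exact: (quot_index_gt0 coker_fixed_subgrp sL fin_coker_fixed).
(* [j] occurs both in the degree 1 identity and in the dual index; both sides are multiplied by it
   so that the two identities can be substituted. *)
set j := quot_index (fixed_tf H) _ in e1 eLH j0.
set l := quot_index (fixed H _) _ in e0 detE.
set a := quot_index DH in_lam in eLH *.
apply: (@mulIf _ j%:R); first by rewrite pnatr_eq0 -lt0n.
have -> : (tate0 H (whole_mod M) * tate1 H (whole_mod M) *
     ker0 H (tors_mod M) (whole_mod M) * ker2 H (tors_mod M) (whole_mod M))%N =
   (l * tate0 H (tors_mod M) * (tate1 H (whole_mod M) * ker2 H (tors_mod M) (whole_mod M)))%N.
  by rewrite -e0 [LHS](ACl ((1*3)*(2*4))).
rewrite coker_tower -h1E -/a -mulrA -natrM.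
have -> : (l * tate0 H (tors_mod M) * (tate1 H (whole_mod M) * ker2 H (tors_mod M) (whole_mod M)) * j =
   l * (tate0 H (tors_mod M) * (j * tate1 H (whole_mod M) * ker2 H (tors_mod M) (whole_mod M))))%N.
  by rewrite [LHS](AC (2*2*1) (1*(2*(5*3*4)))).
rewrite -e1 natrM mulrA -detE eLH -!natrM; congr (_%:R).
by rewrite [LHS](AC (2*(1*2)) (5*1*3*4*2)).
Qed.

End LocalFormula.

(** * The discriminant module *)

Section QuotientGroup.
Import generic_quotient.
Variables (A : zmodType) (N : A -> Prop).
Hypothesis sN : subgrp N.

(** The quotient construction needs a boolean predicate, obtained here from excluded middle. *)
Definition in_subgrp : {pred A} := fun x => if excluded_middle_informative (N x) then true else false.

Lemma in_subgrpP x : reflect (N x) (x \in in_subgrp).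
Proof. by rewrite unfold_in; case: excluded_middle_informative => h; constructor. Qed.

Lemma in_subgrp_closed : zmod_closed in_subgrp.
Proof.
split=> [|x y /in_subgrpP Nx /in_subgrpP Ny]; first by apply/in_subgrpP; case: sN.
by apply/in_subgrpP; apply: sN.2.
Qed.

HB.instance Definition _ := GRing.isZmodClosed.Build A in_subgrp in_subgrp_closed.

Local Open Scope quotient_scope.

Lemma quotient_exists : exists (Q : zmodType) (pi : A -> Q) (rep : Q -> A),
  [/\ forall x y, pi (x + y) = pi x + pi y, forall q, pi (rep q) = q &
      forall x y, pi x = pi y <-> N (x - y)].
Proof.
exists (Quotient.quot in_subgrp), (fun x => \pi_(Quotient.quot in_subgrp) x), (fun q => repr q).
split=> [x y|q|x y]; first by rewrite !piE.
  by rewrite reprK.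
by split=> [/eqP|h]; [rewrite -Quotient.idealrBE => /in_subgrpP | apply/eqP; rewrite -Quotient.idealrBE; apply/in_subgrpP].
Qed.

End QuotientGroup.

Lemma is_intqP q : is_intq q <-> exists k : int, q = k%:~R.
Proof.
split=> [d1|[k ->]]; last by rewrite /is_intq denq_int.
by exists (numq q); rewrite -[LHS]divq_num_den d1 divr1.
Qed.

Lemma is_intqB p q : is_intq p -> is_intq q -> is_intq (p - q).
Proof. by move=> /is_intqP[k ->] /is_intqP[l ->]; apply/is_intqP; exists (k - l); rewrite rmorphB. Qed.

Lemma is_intq0 : is_intq 0. Proof. by apply/is_intqP; exists 0. Qed.

Lemma is_intqN p : is_intq p -> is_intq (- p).
Proof. by move=> ip; rewrite -sub0r; apply: is_intqB => //; apply: is_intq0. Qed.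

Lemma is_intqD p q : is_intq p -> is_intq q -> is_intq (p + q).
Proof. by move=> ip iq; rewrite -[q]opprK; apply: is_intqB => //; apply: is_intqN. Qed.

(** * Rational-valued maps additive modulo Z *)

Section QZ.
Variable A : zmodType.
Variable f : A -> rat.
Hypothesis fD : forall x y, is_intq (f (x + y) - f x - f y).

Lemma QZ0 : is_intq (f 0).
Proof.
have := is_intqN (fD 0 0).
by rewrite addr0 subrr sub0r opprK.
Qed.

Lemma QZMz x k : is_intq (f (x *~ k) - k%:~R * f x).
Proof.
have nat_case n : is_intq (f (x *+ n) - n%:R * f x).
  elim: n => [|n IHn]; first by rewrite mulr0n mul0r subr0; apply: QZ0.
  rewrite (_ : _ - _ = f (x *+ n.+1) - f x - f (x *+ n) + (f (x *+ n) - n%:R * f x)).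
    by apply: is_intqD IHn; rewrite mulrS.
  by rewrite -natr1; ring.
case: k => n; first by rewrite -!pmulrn; apply: nat_case.
rewrite NegzE !mulrNz -!pmulrn.
have e : is_intq (f 0 - f (x *+ n.+1) - f (- (x *+ n.+1))).
  by have := fD (x *+ n.+1) (- (x *+ n.+1)); rewrite subrr.
rewrite (_ : _ - _ = f 0 - (f 0 - f (x *+ n.+1) - f (- (x *+ n.+1)) +
  (f (x *+ n.+1) - n.+1%:R * f x))); last by ring.
by apply: is_intqB; [exact: QZ0 | apply: is_intqD].
Qed.

Lemma QZ_sum (I : Type) (s : seq I) (F : I -> A) (u : I -> rat) :
  (forall i, is_intq (f (F i) - u i)) ->
  is_intq (f (\sum_(i <- s) F i) - \sum_(i <- s) u i).
Proof.
move=> Fu; elim: s => [|i s IHs]; first by rewrite !big_nil subr0; apply: QZ0.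
rewrite !big_cons.
set t := \sum_(j <- s) F j; set w := \sum_(j <- s) u j.
rewrite (_ : _ - _ = f (F i + t) - f (F i) - f t + ((f (F i) - u i) + (f t - w))); last by ring.
exact: is_intqD (fD _ _) (is_intqD (Fu i) IHs).
Qed.

End QZ.

(** * Discriminant modules and their powers *)

Section CokernelModule.
Variables (gT : finGroupType) (G : {group gT}) (n : nat).
Variables (Q : 'M[int]_n) (rho sigma : gT -> 'M[int]_n).
Hypothesis Q_det : \det Q != 0.
Hypothesis Q_sym : Q^T = Q.
Hypothesis Q_sigma : forall g, g \in G -> Q *m sigma g = rho g *m Q.
Hypothesis sigmaV : forall g, (sigma g^-1%g)^T = rho g.
Hypothesis sigma1 : sigma 1%g = 1%:M.
Hypothesis sigmaM : forall g h, g \in G -> h \in G -> sigma (g * h)%g = sigma h *m sigma g.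
Variable m : nat.

Local Notation mat := 'M[int]_(m, n).

(** The m-th power of Z^n / Z^n Q is modelled on m x n matrices, one row per factor, with the group
    multiplying on the right. *)
Definition in_rows (A : mat) : Prop := exists C : mat, A = C *m Q.

Lemma in_rows_subgrp : subgrp in_rows.
Proof.
split; first by exists 0; rewrite mul0mx.
by move=> _ _ [C ->] [D ->]; exists (C - D); rewrite mulmxBl.
Qed.

Lemma in_rowsP A : in_rows A <-> forall i, in_span Q (row i A).
Proof.
split=> [[C ->] i|h]; first by exists (row i C); rewrite row_mul.
have /choice_on[C CP] := h; exists (\matrix_i C i).
by apply/row_matrixP=> i; rewrite row_mul rowK.
Qed.

Lemma rows_class_reps (P : 'rV[int]_n -> Prop) (I : finType) (s : I -> 'rV[int]_n) :
  class_reps P (fun x y => in_span Q (x - y)) s ->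
  class_reps (fun A : mat => forall i, P (row i A)) (fun A B => in_rows (A - B))
    (fun f : {ffun 'I_m -> I} => \matrix_i s (f i)).
Proof.
move=> [sS [sI sC]]; split=> [f i|]; first by rewrite rowK.
split=> [f g /in_rowsP fg|A PA].
  by apply/ffunP=> i; apply: sI; have := fg i; rewrite linearB /= !rowK.
have /choice_on[f fP] : forall i, exists j, in_span Q (row i A - s j) by move=> i; apply: sC.
by exists (finfun f); apply/in_rowsP => i; rewrite linearB /= rowK ffunE.
Qed.

(** The trace adds up the discriminant forms of the rows, so this is their orthogonal sum. *)
Definition disc_form (A B : mat) : rat := \tr (toQ A *m invmx (toQ Q) *m (toQ B)^T).

Let uQ : toQ Q \in unitmx.
Proof. by rewrite unitmxE det_map_mx unitfE intr_eq0. Qed.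

Let QT : (invmx (toQ Q))^T = invmx (toQ Q).
Proof. by rewrite trmx_inv map_trmx Q_sym. Qed.

Lemma disc_formBl A A' B : disc_form (A - A') B = disc_form A B - disc_form A' B.
Proof. by rewrite /disc_form raddfB /= !mulmxBl raddfB. Qed.

Lemma disc_formC A B : disc_form A B = disc_form B A.
Proof. by rewrite /disc_form -mxtrace_tr !trmx_mul trmxK QT mulmxA. Qed.

Lemma disc_formBr A B B' : disc_form A (B - B') = disc_form A B - disc_form A B'.
Proof. by rewrite disc_formC disc_formBl !(disc_formC A). Qed.

Lemma mxtrace_toQ (C : 'M[int]_m) : is_intq (\tr (toQ C)).
Proof.
by apply/is_intqP; exists (\tr C); rewrite /mxtrace rmorph_sum; apply: eq_bigr => i _; rewrite mxE.
Qed.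

Lemma disc_form_rows A B : in_rows A -> is_intq (disc_form A B).
Proof.
move=> [C ->]; rewrite /disc_form map_mxM mulmxK // map_trmx -map_mxM.
exact: mxtrace_toQ.
Qed.

Lemma disc_form_rows_r A B : in_rows B -> is_intq (disc_form A B).
Proof. by rewrite disc_formC; apply: disc_form_rows. Qed.

(** From Q sigma(g) = rho(g) Q follows sigma(g) Q^-1 = Q^-1 rho(g), and rho(g) is the transpose of
    sigma(g^-1): the form is invariant. *)
Lemma disc_form_act g A B : g \in G ->
  disc_form (A *m sigma g) B = disc_form A (B *m sigma g^-1%g).
Proof.
move=> gG; rewrite /disc_form !map_mxM trmx_mul [(toQ (sigma _))^T]map_trmx sigmaV !mulmxA.
congr (\tr (_ *m _)); rewrite -!mulmxA; congr (_ *m _).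
apply: (can_inj (mulKmx uQ)); apply: (can_inj (mulmxK uQ)).
rewrite !mulmxA mulmxV // mul1mx -[LHS]mulmxA mulVmx // mulmx1.
by rewrite -!map_mxM Q_sigma.
Qed.

Lemma disc_form_delta A i j :
  disc_form A (delta_mx i j) = (toQ A *m invmx (toQ Q)) i j.
Proof.
rewrite /disc_form; have -> : (toQ (delta_mx i j : mat))^T = delta_mx j i.
  by apply/matrixP=> k l; rewrite !mxE andbC; case: (_ && _).
rewrite /mxtrace (bigD1 i) //= big1 ?addr0 => [|k ne]; rewrite mxE.
  rewrite (bigD1 j) //= big1 ?addr0 => [|l ne]; rewrite [delta_mx _ _ _ _]mxE !eqxx ?mulr1 //.
  by rewrite (negPf ne) mulr0.
by rewrite big1 // => l _; rewrite [delta_mx _ _ _ _]mxE (negPf ne) andbF mulr0.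
Qed.

Lemma disc_form_expand (q : 'M[rat]_(m, n)) (A B : mat) : toQ A = q *m toQ Q ->
  disc_form A B = \sum_i \sum_j (B i j)%:~R * q i j.
Proof.
move=> AE; rewrite /disc_form AE mulmxK // /mxtrace; apply: eq_bigr => i _.
by rewrite mxE; apply: eq_bigr => j _; rewrite !mxE mulrC.
Qed.

Lemma scale_intz (k : int) (A : mat) : k *: A = A *~ k.
Proof. by rewrite -{1}[k]intz scaler_int. Qed.

Lemma in_rows_mulr A g : g \in G -> in_rows A -> in_rows (A *m sigma g).
Proof. by move=> gG [C ->]; exists (C *m rho g); rewrite -!mulmxA Q_sigma. Qed.

(* Z^n / Z^n Q, m times, is self-dual through its discriminant form (x, y) |-> x Q^-1 y^T. *)
Theorem cokernel_module : exists V : zgmod G,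
  [/\ fin_mod V, self_dual V, forall x : zg_car V, is_tors x &
    forall H : {group gT}, H \subset G ->
      card_prop (fun x : zg_car V => fixed H (whole_mod V) x /\ is_tors x) =
      (quot_index (fun d => forall h, h \in H -> in_span Q (d *m sigma h - d)) (in_span Q) ^ m)%N].
Proof.
have [Vt [pi [rep [piD repK piE]]]] := quotient_exists in_rows_subgrp.
have pi0 : pi 0 = 0 by apply: (addrI (pi 0)); rewrite -piD !addr0.
have repP A : in_rows (rep (pi A) - A) by apply/piE; rewrite repK.
(* A [zgmod] constrains the action on [G] only; elsewhere it is set to the identity. *)
pose act g (q : Vt) : Vt := if g \in G then pi (rep q *m sigma g) else q.
have actE g A : g \in G -> act g (pi A) = pi (A *m sigma g).
  by move=> gG; rewrite /act gG; apply/piE; rewrite -mulmxBl; apply: in_rows_mulr.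
have actD g x y : g \in G -> act g (x + y) = act g x + act g y.
  move=> gG; rewrite -(repK x) -(repK y) -piD !actE // mulmxDl piD.
  by [].
have act1 x : act 1%g x = x by rewrite -(repK x) actE // sigma1 mulmx1.
have actM g h x : g \in G -> h \in G -> act (g * h)%g x = act g (act h x).
  by move=> gG hG; rewrite -(repK x) !actE ?groupM // sigmaM // mulmxA.
pose V := @ZGmod gT G Vt act actD act1 actM.
have tors_V (x : zg_car V) : is_tors x.
  exists (absz (\det Q)); rewrite absz_gt0; split=> //.
  have piMn A k : pi (A *+ k) = pi A *+ k.
    by elim: k => [|k IHk]; rewrite ?mulr0n ?pi0 // !mulrS piD IHk.
  change (rep x) with (rep (x : Vt)); rewrite -(repK x) -piMn -pi0; apply/piE; rewrite subr0.
  (* The adjugate of Q shows that det Q kills the cokernel. *)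
  have Qadj : in_rows (\det Q *: rep x).
    by exists (rep x *m \adj Q); rewrite -mulmxA mul_adj_mx mul_mx_scalar.
  rewrite scale_intz in Qadj; case: (\det Q) Qadj => k; first by rewrite -pmulrn.
  rewrite NegzE mulrNz -pmulrn => /(subgrpN in_rows_subgrp).
  by rewrite opprK.
exists V; split=> //.
- have [I [s [_ tr]]] := class_reps_det Q_det; have [_ [_ cov]] := rows_class_reps tr.
  exists (codom (fun f : {ffun 'I_m -> I} => pi (\matrix_i s (f i)))) => x.
  have [//|f fP] := cov (rep x).
  rewrite -(repK x) (_ : pi (rep x) = pi (\matrix_i s (f i))); last exact/piE.
  exact: (codom_f (fun f : {ffun 'I_m -> I} => pi (\matrix_i s (f i)))).
- exists (fun v w => disc_form (rep v) (rep w)); split.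
    move=> v x y; rewrite -!disc_formBr; apply: disc_form_rows_r.
    by rewrite -addrA -opprD; apply/piE; rewrite piD !repK.
  split.
    move=> v w x; rewrite -!disc_formBl; apply: disc_form_rows.
    by rewrite -addrA -opprD; apply/piE; rewrite piD !repK.
  split.
    move=> g v x gG; have gVG : g^-1%g \in G by rewrite groupV.
    have -> : zg_act (z := V) g v = pi (rep v *m sigma g) by rewrite /= /act gG.
    have -> : zg_act (z := V) g^-1%g x = pi (rep x *m sigma g^-1%g) by rewrite /= /act gVG.
    rewrite (_ : _ - _ = disc_form (rep (pi (rep v *m sigma g)) - rep v *m sigma g) (rep x) -
       disc_form (rep v) (rep (pi (rep x *m sigma g^-1%g)) - rep x *m sigma g^-1%g)); last first.
      rewrite disc_formBl disc_formBr (disc_form_act _ _ gG).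
      by ring.
    by apply: is_intqB; [apply: disc_form_rows | apply: disc_form_rows_r]; apply: repP.
  split.
    move=> v vI; rewrite -(repK v) -pi0; apply/piE; rewrite subr0.
    (* Pairing with the elementary matrices reads off the entries of v Q^-1; their integrality puts
       v in the row lattice. *)
    have /choice_on[c cP] : forall ij : 'I_m * 'I_n, exists k : int,
        (toQ (rep v) *m invmx (toQ Q)) ij.1 ij.2 = k%:~R.
      move=> [i j] /=; rewrite -disc_form_delta; apply/is_intqP.
      rewrite -[disc_form _ _](subrK (disc_form (rep v) (rep (pi (delta_mx i j))))).
      apply: is_intqD (vI _); rewrite -disc_formBr; apply: disc_form_rows_r.
      by apply/piE; rewrite repK.
    exists (\matrix_(i, j) c (i, j)); apply: toQ_inj; rewrite map_mxM.
    rewrite (_ : toQ (\matrix_(i, j) c (i, j)) = toQ (rep v) *m invmx (toQ Q)) ?mulmxKV //.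
    by apply/matrixP=> i j; rewrite mxE mxE -cP.
  move=> f fQ; pose F A := f (pi A).
  have FD A B : is_intq (F (A + B) - F A - F B) by rewrite /F piD; apply: fQ.
  have F_rows A B : in_rows (A - B) -> F A = F B by move=> /piE; rewrite /F => ->.
  (* [q] collects the values of the functional on elementary matrices. Once q Q is known to be
     integral, it represents the functional, as pairing with q Q amounts to the scalar product with
     q. *)
  pose q : 'M[rat]_(m, n) := \matrix_(i, j) F (delta_mx i j).
  have F_exp B : is_intq (F B - \sum_i \sum_j (B i j)%:~R * q i j).
    rewrite {1}[B]matrix_sum_delta; apply: (QZ_sum FD) => i; apply: (QZ_sum FD) => j.
    by rewrite scale_intz mxE; apply: QZMz.
  have /choice_on[c cP] : forall ij : 'I_m * 'I_n, exists k : int, (q *m toQ Q) ij.1 ij.2 = k%:~R.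
    move=> [i j] /=; apply/is_intqP.
    (* [B] has row j of Q in row i and zeros elsewhere. It lies in the row lattice, so its value is
       integral, and by symmetry of Q this value is the (i, j) entry of q Q modulo Z. *)
    pose B : mat := \matrix_(k, l) (Q j l *+ (k == i)).
    have BQ : F B = F 0.
      apply: F_rows; rewrite subr0; exists (delta_mx i j).
      apply/matrixP=> k l; rewrite !mxE (bigD1 j) //= big1 => [|t ne]; rewrite mxE.
        by rewrite eqxx andbT addr0; case: (k == i); rewrite ?mul1r ?mul0r.
      by rewrite (negPf ne) andbF mul0r.
    have := is_intqB (QZ0 FD) (F_exp B); rewrite BQ opprB addrC subrK.
    rewrite (bigD1 i) //= [X in _ + X]big1 ?addr0 => [|k ne]; last first.
      by rewrite big1 // => l _; rewrite !mxE (negPf ne) mulr0n mul0r.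
    rewrite mxE (eq_bigr (fun l => q i l * toQ Q l j)) // => l _.
    by rewrite mulrC !mxE eqxx mulr1n -[in RHS]Q_sym mxE.
  exists (pi (\matrix_(i, j) c (i, j))) => x; set A := \matrix_(i, j) c (i, j).
  have AE : toQ A = q *m toQ Q by apply/matrixP=> i j; rewrite mxE mxE -cP.
  rewrite (_ : _ - _ = (F (rep x) - \sum_i \sum_j (rep x i j)%:~R * q i j) -
     disc_form (rep (pi A) - A) (rep x)).
    by apply: is_intqB; [apply: F_exp | apply: disc_form_rows].
  by rewrite disc_formBl (disc_form_expand _ AE) /F repK opprB addrA subrK.
move=> H sHG; pose P (d : 'rV[int]_n) := forall h, h \in H -> in_span Q (d *m sigma h - d).
rewrite -/P.
have [k [s tr]] : fin_index P (in_span Q).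
  have sT : subgrp (fun _ : 'rV[int]_n => True) by split.
  exact: (fin_indexS (in_span_subgrp Q) (fun _ _ => Logic.I) (fun _ _ p => p) sT (fin_index_det Q_det)).
have rtr := rows_class_reps tr.
have -> : quot_index P (in_span Q) = k.
  by rewrite /quot_index (num_classesE (subgrp_equiv _ (in_span_subgrp Q)) tr) card_ord.
have [s' [s'S [s'I s'C]]] : exists s' : {ffun 'I_m -> 'I_k} -> zg_car V,
    class_reps (fun x : zg_car V => fixed H (whole_mod V) x /\ is_tors x) eq s'.
  pose E (x : zg_car V) (A : mat) := x = pi A.
  have fixE (A : mat) : (forall i, P (row i A)) <-> fixed H (whole_mod V) (pi A : zg_car V).
    split=> [PA|[_ hA] i h hH].
      split=> // h hH; rewrite /= actE ?(subsetP sHG) //; apply/piE/in_rowsP => i.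
      by rewrite linearB /= row_mul; apply: PA.
    have := hA h hH; rewrite /= actE ?(subsetP sHG) // => /piE/in_rowsP/(_ i).
    by rewrite linearB /= row_mul.
  apply: (class_reps_transfer (E := E) _ _ _ rtr).
  - move=> x [xF _]; exists (rep x); last by rewrite /E repK.
    by apply/fixE; rewrite repK.
  - by move=> A /fixE AF; exists (pi A).
  by move=> x x' A A' _ _ _ _ -> ->; exact: piE.
rewrite /card_prop (@num_classesE _ _ _ _ _ s').
- by rewrite card_ffun !card_ord.
- by split=> [x|x y _ _ ->|x y z _ _ _ -> ->].
by split.
Qed.

End CokernelModule.

(** * The theorem *)

Section Thprod.
Variables (gT : finGroupType) (G : {group gT}) (n : {group gT} -> int).
Implicit Types F : {group gT} -> rat.

Lemma thprodM F F' : thprod G n (fun H => F H * F' H) = thprod G n F * thprod G n F'.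
Proof. by rewrite /thprod -big_split; apply: eq_bigr => H _; rewrite expfzMl. Qed.

Lemma thprodV F : thprod G n (fun H => (F H)^-1) = (thprod G n F)^-1.
Proof. by rewrite /thprod -prodfV; apply: eq_bigr => H _; rewrite exprz_inv invr_expz. Qed.

Lemma thprodX F k : thprod G n (fun H => F H ^+ k) = thprod G n F ^+ k.
Proof. by rewrite /thprod -prodrXl; apply: eq_bigr => H _; rewrite !exprnP exprzAC. Qed.

End Thprod.

(** Subtracting the free part is an additive retraction of M onto its torsion. It sends the finitely
    many translates of the generators to generators of the torsion, whose coefficients matter only
    modulo a common exponent [K]. *)
Lemma tors_finite (gT : finGroupType) (G : {group gT}) (M : zgmod G) r (b : 'I_r -> zg_car M) :
  fin_gen M -> is_tf_basis 1%G (whole_mod M) b ->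
  exists s : seq (zg_car M), forall x, is_tors x -> x \in s.
Proof.
move=> [s sP] bP; have [kappa kappaP] := exists_kappa bP.
pose tau x := x - comb b (kappa x).
have tauB x y : tau (x - y) = tau x - tau y.
  by rewrite /tau (kappaB bP kappaP) combB subrACA.
have tau0 : tau 0 = 0 by have := tauB 0 0; rewrite !subrr.
have tauN x : tau (- x) = - tau x by rewrite -sub0r tauB tau0 sub0r.
have tauD x y : tau (x + y) = tau x + tau y by rewrite -[y in LHS]opprK tauB tauN opprK.
have tauMn x k : tau (x *+ k) = tau x *+ k.
  by elim: k => [|k IHk]; rewrite ?mulr0n // !mulrS tauD IHk.
have tauMz x k : tau (x *~ k) = tau x *~ k.
  by case: k => k; rewrite ?NegzE ?mulrNz -?pmulrn ?tauN tauMn.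
pose t (p : 'I_(size s) * gT) := if p.2 \in G then tau (zg_act (z := M) p.2 (nth 0 s p.1)) else 0.
have /choice_on[o oP] : forall p, exists k, (0 < k)%N /\ t p *+ k = 0.
  move=> p; rewrite /t; case: ifP => _; first exact: kappaP.
  by exists 1%N.
pose K := (\prod_p o p)%N.
have K0 : (0 < K)%N by apply: prodn_gt0 => p; case: (oP p).
have tK p : t p *+ K = 0.
  by rewrite /K (bigD1 p) //= mulrnA (oP p).2 mul0rn.
exists [seq \sum_p t p *+ val (f p) | f : {ffun 'I_(size s) * gT -> 'I_K}] => x tx.
have [c cE] := sP x.
have xE : x = \sum_p t p *~ c p.1 p.2.
  have -> : x = tau x by rewrite /tau ((kappa_tors bP kappaP x).2 tx) comb0 subr0.
  rewrite cE (big_morph tau tauD tau0) -(pair_bigA _ (fun i g => t (i, g) *~ c i g)) /=.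
  apply: eq_bigr => i _; rewrite (big_morph tau tauD tau0) [RHS](bigID (mem G)) /=.
  rewrite [X in _ = _ + X]big1 ?addr0 => [|g /negPf ng]; last by rewrite /t /= ng mul0rz.
  by apply: eq_bigr => g gG; rewrite tauMz /t /= gG.
have lt p : (absz (c p.1 p.2 %% K%:Z)%Z < K)%N.
  by rewrite -ltz_nat gez0_abs ?modz_ge0 ?ltz_mod -?lt0n ?eqz_nat // -lt0n.
apply/imageP; exists [ffun p => Ordinal (lt p)] => //; rewrite xE; apply: eq_bigr => p _.
rewrite ffunE /= {1}(divz_eq (c p.1 p.2) K%:Z) mulrzDr [_ * K%:Z]mulrC mulrzA -pmulrn tK mul0rz add0r.
by rewrite pmulrn gez0_abs // modz_ge0 // -lt0n.
Qed.

Theorem mainTheorem5 (gT : finGroupType) (G : {group gT}) (n : {group gT} -> int)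
    (M : zgmod G) (m : nat) :
  is_brauer G n -> fin_gen M -> (0 < m)%N -> perm_embedding M m ->
  exists V : zgmod G, fin_mod V /\ self_dual V /\
    regconst n (whole_mod M) ^+ (2 * m) =
      regconst n (tors_mod M) ^+ (2 * m) / regconst n (whole_mod V) *
      ((hhat0 n (tors_mod M) * hhat1 n (tors_mod M)) /
       (hhat0 n (whole_mod M) * hhat1 n (whole_mod M))) ^+ (2 * m) /
      kappa0 n (tors_mod M) (whole_mod M) ^+ (2 * m) /
      kappa2 n (tors_mod M) (whole_mod M) ^+ (2 * m).
Proof.
move=> br fg m0 [X1 [X [to1 [to [phis [psi [phisD [phisG [phisT [psiD [_ [inj _]]]]]]]]]]]].
(* Any one of the m copies of M_tf embeds in the permutation lattice; copy 0, present because m > 0,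
   supplies the form. *)
pose i0 := Ordinal m0; pose phi := phis i0.
have phiD x y : phi (x + y) = phi x + phi y := phisD i0 x y.
have phiG g x : g \in G -> phi (zg_act g x) = perm_act to g (phi x) := phisG i0 g x.
have phi_tors x : is_tors x <-> phi x = 0.
  split=> [|x0]; first exact: phisT.
  have psi0 : psi 0 = 0 by apply: (addrI (psi 0)); rewrite -psiD !addr0.
  have phis0 i : phis i 0 = 0 by apply: (addrI (phis i 0)); rewrite -phisD !addr0.
  have [|tx _] := inj (fun i => if i == i0 then x else 0) 0.
    rewrite psi0 addr0 (bigD1 i0) //= ?eqxx -/phi x0 add0r big1 // => i /negPf->.
    exact: phis0.
  by have := tx i0; rewrite eqxx.
have /choice_on[Bs BsP] : forall H : {group gT}, exists B : {r : nat & 'I_r -> zg_car M},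
    H \subset G -> is_tf_basis H (whole_mod M) (projT2 B).
  move=> H; have [sHG|_] := boolP (H \subset G); last by exists (existT _ 0%N (fun _ => 0)).
  by have [r [b bP]] := fixed_tf_basis phiD phi_tors sHG; exists (existT _ r b).
pose B (H : {group gT}) := projT2 (Bs H).
have bP : is_tf_basis 1%G (whole_mod M) (B 1%G) := BsP 1%G (sub1G G).
have [kappa kappaP] := exists_kappa bP.
have tors_fin := tors_finite fg bP.
have pP := pull_dot_good phiD phiG phi_tors.
pose Q := gramZ phi (B 1%G); pose rho := act_mx (B 1%G) kappa; pose sigma := dual_mx (B 1%G) kappa.
have Q_det : \det Q != 0 := gramZ_det phiD phiG phi_tors bP kappaP.
have Q_sym : Q^T = Q by apply/matrixP=> i j; rewrite !mxE; apply: pull_dotC.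
have Q_sigma g : g \in G -> Q *m sigma g = rho g *m Q.
  move=> gG; apply/row_matrixP=> i.
  have rowQ : row i Q = lam phi (B 1%G) kappa (B 1%G i) by rewrite /lam (kappa_basis bP kappaP) rowE.
  rewrite !row_mul rowQ rowK.
  exact: (esym (lam_act phiD phiG bP kappaP (B 1%G i) gG)).
have sigmaV g : (sigma g^-1%g)^T = rho g by rewrite /sigma /dual_mx trmxK invgK.
have sigma1 : sigma 1%g = 1%:M.
  by rewrite /sigma /dual_mx invg1 (act_mx1 bP kappaP) trmx1.
have sigmaM g h : g \in G -> h \in G -> sigma (g * h)%g = sigma h *m sigma g.
  move=> gG hG; rewrite /sigma /dual_mx invMg (act_mxM bP kappaP) ?groupV //.
  exact: trmx_mul.
have [V [Vfin Vsd Vtors VH]] := cokernel_module Q_det Q_sym Q_sigma sigmaV sigma1 sigmaM m.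
exists V; split=> //; split=> //.
(* [v H] is |V_1^H|, so V = V_1^m has (v H)^m fixed points. *)
pose v (H : {group gT}) := quot_index (coker_fixed phi (B 1%G) kappa H) (in_lam phi (B 1%G) kappa).
have vE (H : {group gT}) : H \subset G -> tors_card H (whole_mod V) = (v H ^ m)%N.
  move=> sHG; rewrite /tors_card VH // /v; congr (_ ^ _)%N.
  have -> : in_lam phi (B 1%G) kappa = in_span Q.
    apply: functional_extensionality => d; apply: propositional_extensionality.
    exact: in_lamP.
  rewrite /coker_fixed.
  have -> // : in_lam phi (B 1%G) kappa = in_span Q.
    apply: functional_extensionality => d; apply: propositional_extensionality.
    exact: in_lamP.
(* M and M_tors have the same torsion fixed points, so the torsion factor of the regulator constant
   of M is exactly that of M_tors. *)
have tcE (H : {group gT}) : tors_card H (tors_mod M) = tors_card H (whole_mod M).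
  rewrite /tors_card; congr card_prop; apply: functional_extensionality => x.
  apply: propositional_extensionality; rewrite /fixed /whole_mod /tors_mod.
  by split=> [[[_ hx] tx]|[[_ hx] tx]].
have CM := regconst_whole br pP (fun H sHG => BsP H sHG).
have CT : regconst n (tors_mod M) = thprod G n (fun H => (tors_card H (whole_mod M))%:R ^- 2).
  rewrite regconst_tors //; last exact: tors0.
  by apply: eq_bigr => H _; rewrite tcE.
have CV : regconst n (whole_mod V) = thprod G n (fun H => (v H ^ m)%:R ^- 2).
  by rewrite regconst_tors //; apply: eq_bigr => H sHG; rewrite vE.
pose d H := lattice_det H (pull_dotQ phi) (B H).
(* With the torsion factors set aside, equality holds for each H before the exponent n_H is
   applied. *)
have key : thprod G n (fun H => d H ^+ (2 * m)) =
    thprod G n (fun H => ((v H ^ m)%:R ^- 2)^-1 *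
      (((tate0 H (tors_mod M))%:R * (tate1 H (tors_mod M))%:R) /
       ((tate0 H (whole_mod M))%:R * (tate1 H (whole_mod M))%:R)) ^+ (2 * m) /
      (ker0 H (tors_mod M) (whole_mod M))%:R ^+ (2 * m) /
      (ker2 H (tors_mod M) (whole_mod M))%:R ^+ (2 * m)).
  apply: eq_bigr => H sHG; congr (_ ^ _).
  have [[T0 M0 T1 M1] [K0 K2 v0 E]] :=
    local_formula phiD phiG phi_tors bP kappaP sHG tors_fin (BsP H sHG).
  rewrite -/(v H) -/(d H) !natrM in E.
  have nz k : (0 < k)%N -> k%:R != 0 :> rat by rewrite pnatr_eq0 -lt0n.
  move/nz: T0 => T0; move/nz: M0 => M0; move/nz: T1 => T1; move/nz: M1 => M1.
  move/nz: K0 => K0; move/nz: K2 => K2; move/nz: v0 => v0.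
  (* The local formula only knows |det_H|, which the even exponent makes sufficient. *)
  have -> : d H ^+ (2 * m) = `|d H| ^+ (2 * m) by rewrite !exprM real_normK ?num_real.
  rewrite invrK natrX -exprM [(m * 2)%N]mulnC -!exprVn -!exprMn; congr (_ ^+ _).
  apply: (mulIf (mulf_neq0 (mulf_neq0 (mulf_neq0 M0 M1) K0) K2)); rewrite E.
  by field; rewrite ?M0 ?M1 ?K0 ?K2.
rewrite CM CT CV exprMn; set tau := _ ^+ _.
rewrite /hhat0 /hhat1 /kappa0 /kappa2 -/(d _).
have -> : thprod G n (fun H => lattice_det H (pull_dotQ phi) (projT2 (Bs H))) ^+ (2 * m) =
   thprod G n (fun H => d H ^+ (2 * m)) by rewrite thprodX.
rewrite key !thprodM thprodV !mulrA; congr (_ * _ * _ * _).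
- by rewrite thprodX thprodM thprodV !thprodM.
- by rewrite thprodV thprodX.
by rewrite thprodV thprodX.
Qed.
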